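(* Consider type A3 in infinite dimension (see context), let $\sigma:\mathbb{N}^*\to(A,\prec)$ be a bijection onto a totally ordered set and let $\mathbf{X}=\mathbf{X}(\mathcal{F}_\sigma,E)$. (a) For every $(w,\varepsilon)\in\mathfrak{I}_\infty(N_+,N_-)$ we have $$\boldsymbol{\mathcal{O}}_{(w,\varepsilon)}\cap\boldsymbol{\mathfrak{O}}_{(w,\varepsilon)}=\{\mathcal{F}_\sigma(\underline v):\underline v\text{ is }(w,\varepsilon)\text{-conjugate and }(w,\varepsilon)\text{-dual}\}\ne\emptyset.$$ (b) Let $(w,\varepsilon)\in\mathfrak{I}_\infty(N_+,N_-)$ and $\mathcal{F}=\{F'_a,F''_a:a\in A\}\in\mathbf{X}$. Then $\mathcal{F}\in\boldsymbol{\mathcal{O}}_{(w,\varepsilon)}$ if and only if $(\delta(\mathcal{F}),\mathcal{F})\in\mathbb{O}_w$ and, for all $\ell\in\mathbb{N}^*$ and each choice of sign $\pm$, $$\dim\,(F''_{\sigma(\ell)}\cap\mathbf{V}_\pm)/(F'_{\sigma(\ell)}\cap\mathbf{V}_\pm)=\begin{cases}1&\text{if }\sigma(w_\ell)\prec\sigma(\ell)\text{ or }(w_\ell,\varepsilon_\ell)=(\ell,\pm1),\\0&\text{otherwise.}\end{cases}$$ Likewise, $\mathcal{F}\in\boldsymbol{\mathfrak{O}}_{(w,\varepsilon)}$ if and only if $(\mathcal{F}^\dag,\mathcal{F})\in\mathbb{O}^\dag_w$ and, for all $\ell\in\mathbb{N}^*$, for $n\in\mathbb{N}^*$ large enough (depending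 on $\ell$), $$\varsigma(\phi:F''_{\sigma(\ell)}\cap V_n)=\varsigma(\phi:F'_{\sigma(\ell)}\cap V_n)+\begin{cases}(1,1)&\text{if }\sigma(w_\ell)\prec\sigma(\ell),\\(1,0)&\text{if }(w_\ell,\varepsilon_\ell)=(\ell,1),\\(0,1)&\text{if }(w_\ell,\varepsilon_\ell)=(\ell,-1),\\(0,0)&\text{if }\sigma(w_\ell)\succ\sigma(\ell).\end{cases}$$ (c) The subsets $\boldsymbol{\mathcal{O}}_{(w,\varepsilon)}$ ($(w,\varepsilon)\in\mathfrak{I}_\infty(N_+,N_-)$) are exactly the $\mathbf{K}$-orbits of $\mathbf{X}$. The subsets $\boldsymbol{\mathfrak{O}}_{(w,\varepsilon)}$ ($(w,\varepsilon)\in\mathfrak{I}_\infty(N_+,N_-)$) are exactly the $\mathbf{G}^0$-orbits of $\mathbf{X}$. Moreover $\boldsymbol{\mathcal{O}}_{(w,\varepsilon)}\cap\boldsymbol{\mathfrak{O}}_{(w,\varepsilon)}$ is a single $\mathbf{K}\cap\mathbf{G}^0$-orbit.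
   Context: $\mathbb{N}^*$ is the set of positive integers; $\mathbf{V}$ is a complex vector space with basis $E=(e_1,e_2,\ldots)$; vectors are identified with coordinate columns, $\overline{x}$ is the coordinatewise conjugate; $V_n=\langle e_1,\ldots,e_n\rangle_{\mathbb C}$. $\mathbf{G}(E)=\{g\in\mathrm{Aut}(\mathbf{V}):g(e_\ell)=e_\ell\text{ for all but finitely many }\ell\}$. Fix a partition $\mathbb{N}^*=N_+\sqcup N_-$ into nonempty subsets; $\Phi$ is the diagonal matrix with $\ell$-th diagonal entry $\pm1$ for $\ell\in N_\pm$, $\phi(x,y)={}^t\overline{x}\,\Phi\,y$, $\delta(x)=\Phi x$, $\mathbf{V}_\pm=\langle e_\ell:\ell\in N_\pm\rangle_{\mathbb C}$. $\mathbf{K}=\{g\in\mathbf{G}(E):\delta g=g\delta\}$, $\mathbf{G}^0=\{g\in\mathbf{G}(E):\phi(gx,gy)=\phi(x,y)\ \forall x,y\}$. $\mathfrak{I}_\infty(N_+,N_-)$ is the set of pairs $(w,\varepsilon)$ with $w:\mathbb{N}^*\to\mathbb{N}^*$, $w^2=\mathrm{id}$ (write $w_\ell=w(\ell)$), and $\varepsilon:\{\ell:w_\ell=\ell\}\to\{1,-1\}$, $\ell\mapsto\varepsilon_\ell$, such that the sets $N'_\pm=\{\ell\in N_\pm:(w_\ell,\varepsilon_\ell)=(\ell,\pm1)\}$ satisfy, for each sign, $$|N_\pm\setminus N'_\pm|=|\{\ell\in N_\mp:(w_\ell,\varepsilon_\ell)=(\ell,\pm1)\}|+\tfrac12|\{\ell\in\mathbb{N}^*:w_\ell\ne\ell\}|<\infty.$$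 In particular $w\in\mathfrak{S}_\infty$, the group of permutations of $\mathbb{N}^*$ fixing all but finitely many elements. For a bijection $\tau:\mathbb{N}^*\to(B,\prec)$ onto a totally ordered set and a basis $\underline v=(v_1,v_2,\ldots)$ of $\mathbf{V}$, $\mathcal{F}_\tau(\underline v)=\{F'_b,F''_b:b\in B\}$ with $F'_b=\langle v_\ell:\tau(\ell)\prec b\rangle_{\mathbb C}$, $F''_b=\langle v_\ell:\tau(\ell)\preceq b\rangle_{\mathbb C}$; $\mathcal{F}_\tau=\mathcal{F}_\tau(E)$. $\mathbf{X}(\mathcal{F}_\tau,E)$ is the $\mathbf{G}(E)$-orbit of $\mathcal{F}_\tau$, i.e. the set of $\mathcal{F}_\tau(\underline v)$ with $v_\ell=e_\ell$ for all but finitely many $\ell$; the labelling of the subspaces of an element of $\mathbf{X}$ as $F'_a,F''_a$ ($a\in A$) is the one coming from such a presentation $\mathcal{F}_\sigma(\underline v)$. For bijections $\tau,\sigma$ onto totally ordered sets and $u\in\mathfrak{S}_\infty$, $(\mathbb{O}_{\tau,\sigma})_u=\{(g\mathcal{F}_\tau,g\mathcal{F}_{\sigma u}):g\in\mathbf{G}(E)\}$. $(A^*,\prec^* )$ is $A$ with the reversed order and $\sigma^\dag:\mathbb{N}^*\to A^*$, $\sigma^\dag(\ell)=\sigma(\ell)$. $\mathbb{O}_u=(\mathbb{O}_{\sigma,\sigma})_u$ and $\mathbb{O}^\dag_u=(\mathbb{O}_{\sigma^\dag,\sigma})_u$. For $\mathcal{F}\in\mathbf{X}$: $\delta(\mathcal{F})=\{\delta(F):F\in\mathcal{F}\}\in\mathbf{X}$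 and $\mathcal{F}^\dag=\{F^\dag:F\in\mathcal{F}\}\in\mathbf{X}(\mathcal{F}_{\sigma^\dag},E)$, where $F^\dag=\{x\in\mathbf{V}:\phi(x,y)=0\ \forall y\in F\}$. For a finite-dimensional subspace $F$, $\varsigma(\phi:F)$ is the signature of the form induced by $\phi$ on the quotient of $F$ by the radical $F\cap F^\dag$ of $\phi|_F$. For $(w,\varepsilon)\in\mathfrak{I}_\infty(N_+,N_-)$ consider bases $\underline v$ of $\mathbf{V}$ with $v_\ell=e_\ell$ for all but finitely many $\ell$. Such $\underline v$ is $(w,\varepsilon)$-conjugate if for all $k$: $\delta(v_k)=v_{w_k}$ when $w_k\ne k$, $\delta(v_k)=\varepsilon_kv_k$ when $w_k=k$. It is $(w,\varepsilon)$-dual if for all $k,\ell$: $\phi(v_k,v_\ell)=0$ if $\ell\ne w_k$, $=1$ if $\ell=w_k\ne k$, $=\varepsilon_k$ if $\ell=w_k=k$. Set $\boldsymbol{\mathcal{O}}_{(w,\varepsilon)}=\{\mathcal{F}_\sigma(\underline v):\underline v\ (w,\varepsilon)\text{-conjugate}\}$, $\boldsymbol{\mathfrak{O}}_{(w,\varepsilon)}=\{\mathcal{F}_\sigma(\underline v):\underline v\ (w,\varepsilon)\text{-dual}\}$. *)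

(* Defs.v *)
From HB Require Import structures.
From mathcomp Require Import all_boot all_order all_algebra.
From mathcomp Require Export finmap complex.
From mathcomp Require Export mathcomp_extra boolp classical_sets functions cardinality fsbigop.
From mathcomp Require Export reals.

(* MathComp world (with the classical layer of MathComp-Analysis).

   Conventions.
   - The index set N* = {1, 2, ...} is represented by nat, the index l of the
     mathematical text being l.-1 here; only its countability and, for V_n, its
     order matter.
   - A subspace is the set of its vectors; a flag is a set of subspaces.
   - Families of vectors are functions nat -> V, and bases are Hamel bases.
   - Signs are booleans, true standing for +; a partition of nat into N_+ and
     N_- is then a function N : bool -> set nat. *)

Set Implicit Arguments.
Unset Strict Implicit.
Unset Printing Implicit Defensive.

Import Order.TTheory GRing.Theory Num.Theory.
Local Open Scope classical_set_scope.
Local Open Scope ring_scope.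

Definition sign_partition (N : bool -> set nat) : Prop :=
  [/\ N true `|` N false = setT, N true `&` N false = set0
    & forall s, N s !=set0].

(* Pairs (w, eps) of a map w : nat -> nat and a map eps from the fixed points
   of w to the signs. *)
Record signed_map := SignedMap {
  smap :> nat -> nat;
  fsign : forall l, smap l = l -> bool }.

(* (w_l, eps_l) = (l, s) *)
Definition fixed_with (c : signed_map) (s : bool) (l : nat) : Prop :=
  exists h : c l = l, fsign h = s.

(* The cardinality identity |A| = |B| + |C| / 2 < oo is stated as finiteness of
   A, B and C together with 2 |A| = 2 |B| + |C|. *)
Definition signed_involutions (N : bool -> set nat) : set signed_map :=
  [set c : signed_map | involutive c /\ forall s : bool,
    let A := N s `\` [set l | N s l /\ fixed_with c s l] in
    let B := [set l | N (~~ s) l /\ fixed_with c s l] in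
    let M := [set l | c l <> l] in
    [/\ finite_set A, finite_set B, finite_set M
      & (#|` fset_set A|.*2 = #|` fset_set B|.*2 + #|` fset_set M|)%N]].

Section LinearAlgebra.
Variables (C : numClosedFieldType) (V : lmodType C).
Implicit Types (v : nat -> V) (U W F : set V).

Definition lspan (P : set nat) v : set V :=
  [set x | exists (n : nat) (c : nat -> C),
    (forall i, ~ P i -> c i = 0) /\ x = \sum_(i < n) c i *: v i].

Definition is_basis v : Prop :=
  (forall (n : nat) (c : nat -> C),
     \sum_(i < n) c i *: v i = 0 -> forall i, (i < n)%N -> c i = 0)
  /\ (forall x, lspan setT v x).

Definition quotient_basis (I : finType) U W (u : I -> V) : Prop :=
  [/\ forall i, U (u i),
      forall c : I -> C, W (\sum_i c i *: u i) -> forall i, c i = 0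
    & forall x, U x -> exists c : I -> C, W (x - \sum_i c i *: u i)].

(* dim U / W = n, for subspaces W of U; as a relation, so that it fails for
   every n when U / W is infinite-dimensional. *)
Definition quotient_dim U W (n : nat) : Prop :=
  exists u : 'I_n -> V, quotient_basis U W u.

Definition signC (s : bool) : C := if s then 1 else -1.

Variable e : nat -> V.

(* The coordinate column of x in the basis e. *)
Definition coord (x : V) : nat -> C :=
  xget (fun=> 0) [set c | exists n : nat,
    (forall i, (n <= i)%N -> c i = 0) /\ x = \sum_(i < n) c i *: e i].

Definition almost_e v : Prop := finite_set [set l | v l <> e l].

(* Bases (v_1, v_2, ...) with v_l = e_l for all but finitely many l. *)
Definition e_basis v : Prop := is_basis v /\ almost_e v.

Definition groupG : set {linear V -> V} :=
  [set g : {linear V -> V} | bijective g /\ almost_e (fun l => g (e l))].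

Definition Vn (n : nat) : set V := lspan [set l | (l < n)%N] e.

Section Flags.
Context {d : Order.disp_t} {B : orderType d}.
Variables (tau : nat -> B) (v : nat -> V).

Definition flag_lt (b : B) : set V := lspan [set l | (tau l < b)%O] v.
Definition flag_le (b : B) : set V := lspan [set l | (tau l <= b)%O] v.
Definition flag : set (set V) :=
  [set U | exists b, U = flag_lt b \/ U = flag_le b].
End Flags.

Definition act (g : V -> V) (F : set (set V)) : set (set V) :=
  [set g @` U | U in F].

Definition orbit (H : set {linear V -> V}) (F : set (set V)) :
    set (set (set V)) :=
  [set act g F | g in H].

Definition orbits (H : set {linear V -> V}) (X : set (set (set V))) :
    set (set (set (set V))) :=
  [set orbit H F | F in X].

Definition flagsX {d : Order.disp_t} {B : orderType d} (tau : nat -> B) :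
    set (set (set V)) :=
  orbit groupG (flag tau e).

(* F1 and F2 are the labellings a |-> F'_a and a |-> F''_a of the subspaces of
   F; they come from a presentation of F by a basis. *)
Definition labelling {d : Order.disp_t} {B : orderType d} (tau : nat -> B)
    (F : set (set V)) (F1 F2 : B -> set V) : Prop :=
  exists v, [/\ e_basis v, F = flag tau v,
                F1 = flag_lt tau v & F2 = flag_le tau v].

(* tau, with values in B endowed with the reversed order. *)
Definition reversed {d : Order.disp_t} {B : orderType d} (tau : nat -> B) :
    nat -> B^d := tau.

(* The orbit (O_{tau,sigma})_u of pairs of flags. *)
Definition pair_orbit {d d' : Order.disp_t} {B : orderType d}
    {B' : orderType d'} (tau : nat -> B) (sigma : nat -> B') (u : nat -> nat) :
    set (set (set V) * set (set V)) :=
  [set (act g (flag tau e), act g (flag (sigma \o u) e)) | g in groupG].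

Section TypeA3.
Variable N : bool -> set nat.

(* The diagonal entries of Phi. *)
Definition Phi (l : nat) : C := signC `[< N true l >].

Definition phi (x y : V) : C :=
  \sum_(l \in setT) (coord x l)^* * Phi l * coord y l.

Definition delta (x : V) : V :=
  \sum_(l \in setT) (Phi l * coord x l) *: e l.

Definition Vsign (s : bool) : set V := lspan (N s) e.

Definition groupK : set {linear V -> V} :=
  [set g : {linear V -> V} | groupG g /\ forall x, delta (g x) = g (delta x)].

Definition groupG0 : set {linear V -> V} :=
  [set g : {linear V -> V} | groupG g /\ forall x y, phi (g x) (g y) = phi x y].

Definition dagger F : set V := [set x | forall y, F y -> phi x y = 0].

Definition dagger_flag (F : set (set V)) : set (set V) :=
  [set dagger U | U in F].

(* The form induced by phi on F / (F `&` dagger F) has signature pq : it is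
   diag(1, ..., 1, -1, ..., -1) in some basis, with pq.1 entries 1 and pq.2
   entries -1. *)
Definition signature F (pq : nat * nat) : Prop :=
  exists u : 'I_pq.1 + 'I_pq.2 -> V,
    quotient_basis F (F `&` dagger F) u /\
    forall i j, phi (u i) (u j) =
      if i == j then signC (if i is inl _ then true else false) else 0.

Definition conjugate_basis (c : signed_map) v : Prop :=
  e_basis v /\ forall k,
    (c k <> k -> delta (v k) = v (c k)) /\
    (forall h : c k = k, delta (v k) = signC (fsign h) *: v k).

Definition dual_basis (c : signed_map) v : Prop :=
  e_basis v /\ forall k l,
    [/\ l <> c k -> phi (v k) (v l) = 0,
        l = c k -> c k <> k -> phi (v k) (v l) = 1
      & forall h : c k = k, l = c k -> phi (v k) (v l) = signC (fsign h)].

Section Orbits.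
Context {d : Order.disp_t} {A : orderType d}.
Variables (sigma : nat -> A) (c : signed_map).

Definition conj_flags : set (set (set V)) :=
  [set flag sigma v | v in conjugate_basis c].

Definition dual_flags : set (set (set V)) :=
  [set flag sigma v | v in dual_basis c].

(* If none of the three tests holds, sigma l precedes sigma (c l), sigma being
   injective. *)
Definition signature_jump (l : nat) : nat * nat :=
  if (sigma (c l) < sigma l)%O then (1, 1)%N
  else if `[< fixed_with c true l >] then (1, 0)%N
  else if `[< fixed_with c false l >] then (0, 1)%N
  else (0, 0)%N.
End Orbits.
End TypeA3.
End LinearAlgebra.

(* Main.v *)
Require Import Defs.
From HB Require Import structures.
From mathcomp Require Import all_boot all_order all_algebra.
From mathcomp Require Import finmap complex.
From mathcomp Require Import mathcomp_extra boolp classical_sets functions cardinality fsbigop.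
From mathcomp Require Import reals.
From mathcomp Require Import ring zify.

Set Implicit Arguments.
Unset Strict Implicit.
Unset Printing Implicit Defensive.

Import Order.TTheory GRing.Theory Num.Theory.
Local Open Scope classical_set_scope.
Local Open Scope ring_scope.

(** A flag [F] of the orbit of [flag sigma e] has many bases presenting it, and
the whole statement rests on finding good ones.

Existence. Every [F] is presented by a conjugate basis and by a dual basis
([exists_conj_basis], [exists_dual_basis]). All but finitely many vectors of a
presentation are those of [e], so that a finite elimination is enough, processing
the remaining vectors in the order of [sigma]. If [x] is the first of them, then
either the line of [x] is stable by [delta] (resp. anisotropic for [phi]) and
splits off, or [x] is paired with [delta x] (resp. with the first vector not
orthogonal to [x]) and the resulting plane splits off. The changes of basis are
triangular with respect to [sigma], hence preserve [F] ([triangular_change]).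

Uniqueness. As a set of subspaces, a flag determines its labelling, because an
increasing map of [A] moving finitely many elements is the identity
([flag_labels]); a pair of labelled flags determines its relative position
([relative_position_unique]). For a conjugate basis [v] the flag
[delta F] is presented by [v \o c], and for a dual basis the flag of orthogonals
is presented by [v \o c] in the reversed order; so the involution [c] is
determined by the flag. The signs at the fixed points are determined by the
dimensions of the intersections with the eigenspaces of [delta] ([conj_dim]), or
by the jumps of signature ([dual_signature]) and Sylvester's law of inertia
([inertia]). This gives the criteria (b): present [F] by an adapted basis for some
signed map [c'] and conclude that [c'] agrees with [c].

Which signed maps occur. Choose one point in each two-point orbit of [c] and give
it the color [+], the other one the color [-], and color the fixed points by their
signs. The cardinality conditions mean that colors and signs of the partition are
equally distributed ([signed_involutions_count]). Adapted bases satisfy them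
because eigenvectors of [delta], or vectors of an orthogonal basis for [phi], are
as many of each sign in [V_n] for [v] as for [e] ([conj_signed_involution],
[dual_signed_involution]). Conversely a permutation of [e] matching colors with
signs, followed by rotations in the planes of the two-point orbits, gives a basis
which is both conjugate and dual ([exists_common_basis]).

Orbits. A linear map carrying one conjugate (resp. dual) basis to another one
with the same signed map commutes with [delta] (resp. preserves [phi]). Thus each
of the sets of flags is a single orbit, and by existence all orbits are obtained.

Intersections. Suppose that [F] is presented by a conjugate basis and by a dual
basis with the same [c]. The form [phi (delta x) y] is positive definite; let [u]
be an orthonormal basis for it presenting [F]. The matrix of [delta] in [u] is also
the Gram matrix of [phi] in [u]. The conjugate basis bounds the support of each
column from above, the dual basis bounds it from below, so that this unitary
matrix is monomial, with the permutation [c] ([unitary_delta]). Rescaling [u]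
gives a basis which is conjugate and dual ([common_basis]). *)

Local Notation coord := Defs.coord.
Local Notation orbit := Defs.orbit.

(** * Spans and bases *)

Lemma fsum_nat (G : nmodType) (F : nat -> G) n :
  (forall i, (n <= i)%N -> F i = 0) -> \sum_(i \in setT) F i = \sum_(i < n) F i.
Proof.
move=> h; rewrite fsbig_ord; apply/esym/fsbig_widen => //= i [_ /=].
by move=> /negP; rewrite -leqNgt; apply: h.
Qed.

Section Bases.
Variables (C : numClosedFieldType) (V : lmodType C).
Implicit Types (v u : nat -> V) (U W F : set V) (P Q : set nat).

Definition subspace W := W 0 /\ forall a x y, W x -> W y -> W (a *: x + y).

Lemma subspaceD W x y : subspace W -> W x -> W y -> W (x + y).
Proof. by move=> [_ h] Wx Wy; rewrite -[x]scale1r; apply: h. Qed.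

Lemma subspaceZ W a x : subspace W -> W x -> W (a *: x).
Proof. by move=> [h0 h] Wx; rewrite -[_ *: _]addr0; apply: h. Qed.

Lemma subspaceB W x y : subspace W -> W x -> W y -> W (x - y).
Proof.
by move=> hW Wx Wy; rewrite addrC -scaleN1r; apply: (proj2 hW).
Qed.

Lemma subspace_sum W I r (p : pred I) (F : I -> V) : subspace W ->
  (forall i, p i -> W (F i)) -> W (\sum_(i <- r | p i) F i).
Proof.
move=> hW h; elim/big_ind : _ => //; first exact: (proj1 hW).
by move=> *; apply: subspaceD.
Qed.

Lemma subspaceI U W : subspace U -> subspace W -> subspace (U `&` W).
Proof.
move=> [U0 hU] [W0 hW]; split; first by split.
by move=> a x y [? ?] [? ?]; split; [apply: hU|apply: hW].
Qed.

Lemma lspan_subspace P v : subspace (lspan P v).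
Proof.
split; first by exists 0%N, (fun=> 0); rewrite big_ord0.
move=> a _ _ [n [c [hc ->]]] [m [b [hb ->]]].
have widen k (c' : nat -> C) (k' := maxn n m) : (k <= k')%N ->
    \sum_(i < k) c' i *: v i =
    \sum_(i < k') (if (i < k)%N then c' i else 0) *: v i.
  move=> kk; rewrite (big_ord_widen k' (fun i => c' i *: v i) kk) big_mkcond.
  by apply: eq_bigr => i _; case: ifP => // _; rewrite scale0r.
rewrite (widen n) ?leq_maxl// (widen m) ?leq_maxr// scaler_sumr -big_split.
exists (maxn n m), (fun i => a * (if (i < n)%N then c i else 0)
                             + (if (i < m)%N then b i else 0)); split.
  by move=> i Pi; rewrite hc// hb// !if_same mulr0 addr0.
by apply: eq_bigr => i _ /=; rewrite scalerDl scalerA.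
Qed.

Lemma lspan_gen P v i : P i -> lspan P v (v i).
Proof.
move=> Pi; exists i.+1, (fun j => (j == i)%:R); split.
  by move=> j Pj; case: eqP => // jE; rewrite jE in Pj.
rewrite (bigD1 ord_max)//= eqxx scale1r big1 ?addr0// => j.
by rewrite -val_eqE /= => /negbTE ->; rewrite scale0r.
Qed.

Lemma lspan_min P v W : subspace W -> (forall i, P i -> W (v i)) ->
  lspan P v `<=` W.
Proof.
move=> hW h _ [n [c [hc ->]]]; apply: subspace_sum => // i _.
have [Pi|nPi] := pselect (P i); first by apply: subspaceZ => //; apply: h.
by rewrite hc// scale0r; case: hW.
Qed.

Lemma lspan_le P v Q u : (forall i, P i -> lspan Q u (v i)) ->
  lspan P v `<=` lspan Q u.
Proof. exact: (lspan_min (lspan_subspace _ _)). Qed.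

Lemma lspan_sub P Q v : P `<=` Q -> lspan P v `<=` lspan Q v.
Proof. by move=> PQ; apply: lspan_le => i Pi; apply/lspan_gen/PQ. Qed.

Lemma lspan_comp P v (w : nat -> nat) : involutive w ->
  lspan P (v \o w) = lspan (P \o w) v.
Proof.
move=> wK; apply/seteqP; split; apply: lspan_le => i Pi /=.
  by apply: lspan_gen; rewrite /= wK.
by rewrite -[ i]wK; apply: (@lspan_gen _ (v \o w)).
Qed.

Lemma lspan_image P v (g : {linear V -> V}) :
  g @` lspan P v = lspan P (g \o v).
Proof.
apply/seteqP; split; last first.
  apply: lspan_min => [|i Pi]; last by exists (v i) => //; apply: lspan_gen.
  have [l0 lS] := lspan_subspace P v.
  split; first by exists 0 => //; rewrite linear0.
  move=> a _ _ [x hx <-] [y hy <-]; exists (a *: x + y); first exact: lS.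
  by rewrite linearP.
move=> _ [x hx <-]; move: x hx; apply: lspan_min => [|i Pi]; last first.
  exact: (@lspan_gen _ (g \o v)).
have [l0 lS] := lspan_subspace P (g \o v).
by split=> [|a x y ? ?]; rewrite ?linear0 ?linearP//; apply: lS.
Qed.

Section OneBasis.
Variables (v : nat -> V) (hv : is_basis v).

Lemma basis_ind W : subspace W -> (forall i, W (v i)) -> forall x, W x.
Proof.
move=> hW h x; have := proj2 hv x; apply: lspan_min => // i _; exact: h.
Qed.

Lemma coord_spec x : exists n : nat,
  (forall i, (n <= i)%N -> coord v x i = 0) /\
  x = \sum_(i < n) coord v x i *: v i.
Proof.
have [n [c [_ xE]]] := proj2 hv x.
rewrite /coord; case: xgetP => [c' -> //|/(_ (fun i => if (i < n)%N then c i else 0))].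
case; exists n; split; first by move=> i; rewrite leqNgt => /negbTE ->.
by rewrite xE; apply: eq_bigr => i _; rewrite ltn_ord.
Qed.

Lemma coord_unique c n : (forall i, (n <= i)%N -> c i = 0) ->
  coord v (\sum_(i < n) c i *: v i) = c.
Proof.
move=> hc; set x := \sum_(i < n) _.
have [m [hm xE]] := coord_spec x.
have H : \sum_(i < maxn n m) (coord v x i - c i) *: v i = 0.
  under eq_bigr do rewrite scalerBl.
  rewrite sumrB; apply/eqP; rewrite subr_eq0; apply/eqP.
  rewrite -(@fsum_nat _ (fun i => coord v x i *: v i)); last first.
    by move=> i; rewrite geq_max => /andP[_ h]; rewrite hm// scale0r.
  rewrite -(@fsum_nat _ (fun i => c i *: v i)); last first.
    by move=> i; rewrite geq_max => /andP[h _]; rewrite hc// scale0r.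
  rewrite (@fsum_nat _ (fun i => coord v x i *: v i) m); last first.
    by move=> i h; rewrite hm// scale0r.
  rewrite -xE (@fsum_nat _ (fun i => c i *: v i) n)//.
  by move=> i h; rewrite hc// scale0r.
apply/funext => i; have [im|im] := ltnP i (maxn n m).
  by apply/eqP; rewrite -subr_eq0; apply/eqP; exact: (proj1 hv _ (fun i => coord v x i - c i) H i im).
by move: im; rewrite geq_max => /andP[hn hm']; rewrite hm// hc.
Qed.

Lemma coord_bound x y : exists n : nat, forall i, (n <= i)%N ->
  coord v x i = 0 /\ coord v y i = 0.
Proof.
have [n [hn _]] := coord_spec x; have [m [hm _]] := coord_spec y.
exists (maxn n m) => i; rewrite geq_max => /andP[? ?].
by rewrite hn// hm.
Qed.

Lemma coord_sumE n x : (forall i, (n <= i)%N -> coord v x i = 0) ->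
  x = \sum_(i < n) coord v x i *: v i.
Proof.
move=> hn; have [m [hm xE]] := coord_spec x.
rewrite {1}xE -(@fsum_nat _ (fun i => coord v x i *: v i)); last first.
  by move=> i h; rewrite hm// scale0r.
by rewrite (@fsum_nat _ _ n)// => i h; rewrite hn// scale0r.
Qed.

Lemma coordP a x y i :
  coord v (a *: x + y) i = a * coord v x i + coord v y i.
Proof.
have [n hn] := coord_bound x y.
rewrite {1}(@coord_sumE n x); last by move=> j /hn[].
rewrite {1}(@coord_sumE n y); last by move=> j /hn[].
rewrite scaler_sumr -big_split /=.
under eq_bigr do rewrite scalerA -scalerDl.
rewrite (@coord_unique (fun j => a * coord v x j + coord v y j))//.
by move=> j /hn[-> ->]; rewrite mulr0 addr0.
Qed.

Lemma coord0 i : coord v 0 i = 0.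
Proof.
by have := coordP (-1) 0 0 i; rewrite scaler0 addr0 mulN1r addNr.
Qed.

Lemma coordD x y i : coord v (x + y) i = coord v x i + coord v y i.
Proof. by rewrite -{1}[x]scale1r coordP mul1r. Qed.

Lemma coordZ a x i : coord v (a *: x) i = a * coord v x i.
Proof. by rewrite -{1}[_ *: _]addr0 coordP coord0 addr0. Qed.

Lemma coordB x y i : coord v (x - y) i = coord v x i - coord v y i.
Proof. by rewrite addrC -scaleN1r coordP mulN1r addrC. Qed.

Lemma coord_sum I r (p : pred I) (F : I -> V) i :
  coord v (\sum_(j <- r | p j) F j) i = \sum_(j <- r | p j) coord v (F j) i.
Proof.
elim: r => [|j r IH]; first by rewrite !big_nil coord0.
by rewrite !big_cons; case: ifP => _; rewrite ?coordD IH.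
Qed.

Lemma coord_basis i j : coord v (v i) j = (j == i)%:R.
Proof.
have -> : v i = \sum_(k < i.+1) (k == i :> nat)%:R *: v k.
  rewrite (bigD1 ord_max)//= eqxx scale1r big1 ?addr0// => k.
  by rewrite -val_eqE /= => /negbTE ->; rewrite scale0r.
rewrite (@coord_unique (fun k => (k == i)%:R))//.
by move=> k; case: eqP => // ->; rewrite ltnn.
Qed.

Lemma coord_inj x y : (forall i, coord v x i = coord v y i) -> x = y.
Proof.
move=> h; have [n hn] := coord_bound x y.
rewrite (@coord_sumE n x); last by move=> i /hn[].
rewrite (@coord_sumE n y); last by move=> i /hn[].
by apply: eq_bigr => i _; rewrite h.
Qed.

Lemma basis_neq0 i : v i != 0.
Proof.
apply/eqP => h; have := coord_basis i i; rewrite h coord0 eqxx => /eqP.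
by rewrite eq_sym oner_eq0.
Qed.

Lemma coord_neq0 x : x != 0 -> exists i, coord v x i != 0.
Proof.
move=> x0; apply: contrapT => h; move/eqP: x0; apply.
apply: coord_inj => i; rewrite coord0; apply/eqP/negPn/negP => hi.
by apply: h; exists i.
Qed.

Lemma lspanE P x : lspan P v x <-> forall i, ~ P i -> coord v x i = 0.
Proof.
split=> [[n [c [hc ->]]] i Pi|h].
  rewrite coord_sum big1// => j _; rewrite coordZ coord_basis.
  by case: eqP => [iE|]; rewrite ?mulr0// -iE hc// mul0r.
have [n [_ xE]] := coord_spec x.
by exists n, (coord v x).
Qed.

Lemma basis_ext (f g : {linear V -> V}) :
  (forall i, f (v i) = g (v i)) -> f =1 g.
Proof.
move=> h; apply: (@basis_ind [set x | f x = g x]) => //.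
split=> [|a x y /=]; first by rewrite /= !linear0.
by move=> hx hy; rewrite !linearP hx hy.
Qed.

Definition basis_map u (x : V) : V := \sum_(l \in setT) coord v x l *: u l.

Lemma basis_mapE u x n : (forall i, (n <= i)%N -> coord v x i = 0) ->
  basis_map u x = \sum_(i < n) coord v x i *: u i.
Proof. by move=> h; apply: fsum_nat => i /h ->; rewrite scale0r. Qed.

Lemma basis_map_linear u : linear (basis_map u).
Proof.
move=> a x y; have [n hn] := coord_bound x y.
rewrite !(@basis_mapE _ _ n); try by move=> i /hn[].
  rewrite scaler_sumr -big_split; apply: eq_bigr => i _ /=.
  by rewrite coordP scalerDl scalerA.
by move=> i /hn[hx hy]; rewrite coordP hx hy mulr0 addr0.
Qed.

Lemma basis_map_basis u i : basis_map u (v i) = u i.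
Proof.
rewrite (@basis_mapE _ _ i.+1); last first.
  by move=> j; rewrite coord_basis; case: eqP => // ->; rewrite ltnn.
rewrite (bigD1 ord_max)//= coord_basis eqxx scale1r big1 ?addr0// => j.
by rewrite coord_basis -val_eqE /= => /negbTE ->; rewrite scale0r.
Qed.

Lemma exists_linear u : exists g : {linear V -> V}, forall i, g (v i) = u i.
Proof.
pose g : {linear V -> V} := HB.pack (basis_map u)
  (GRing.isLinear.Build _ _ _ _ _ (basis_map_linear u)).
exists g; exact: basis_map_basis.
Qed.

Lemma basis_image (g : {linear V -> V}) : bijective g -> is_basis (g \o v).
Proof.
move=> [g' gK g'K]; split.
  move=> n c /= h; apply: (proj1 hv); apply: (can_inj gK).
  rewrite linear0 linear_sum -[RHS]h; apply: eq_bigr => i _.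
  by rewrite linearZ.
move=> x; rewrite -lspan_image; exists (g' x) => //; exact: (proj2 hv).
Qed.

Lemma basis_perm (w : nat -> nat) : bijective w -> is_basis (v \o w).
Proof.
move=> [w' wK w'K]; split; last first.
  move=> x; move: x; apply: basis_ind => [|i]; first exact: lspan_subspace.
  by rewrite -[ i]w'K; apply: (@lspan_gen _ (v \o w)).
move=> n c h i hi.
have := coord0 (w i); rewrite -h coord_sum (bigD1 (Ordinal hi))//=.
rewrite coordZ coord_basis eqxx mulr1 big1 ?addr0// => j ji.
rewrite coordZ coord_basis (can_eq wK).
by rewrite -val_eqE /= in ji; rewrite eq_sym (negbTE ji) mulr0.
Qed.

Lemma basis_transfer u : (forall i, lspan setT u (v i)) ->
  (forall (n : nat) (c : nat -> C), \sum_(i < n) c i *: u i = 0 ->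
     forall i, (i < n)%N -> c i = 0) -> is_basis u.
Proof.
move=> hs hi; split=> // x; move: x; apply: basis_ind => //.
exact: lspan_subspace.
Qed.

End OneBasis.

Lemma exists_basis_change v u : is_basis v -> is_basis u ->
  exists g : {linear V -> V}, bijective g /\ forall i, g (v i) = u i.
Proof.
move=> hv hu.
have [g gE] := exists_linear hv u; have [g' g'E] := exists_linear hu v.
exists g; split=> //; exists g'.
  apply: (@basis_ext _ hv (g' \o g) idfun) => i /=; by rewrite gE g'E.
apply: (@basis_ext _ hu (g \o g') idfun) => i /=; by rewrite g'E gE.
Qed.

End Bases.

(** * Flags *)

Section Extrema.
Context {d : Order.disp_t} {A : orderType d}.

Lemma finite_min (sigma : nat -> A) (P : set nat) n :
  (forall l, P l -> (l < n)%N) -> P !=set0 ->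
  exists2 m, P m & forall l, P l -> (sigma m <= sigma l)%O.
Proof.
move=> hn [l0 Pl0]; pose i0 := Ordinal (hn _ Pl0).
have Pi0 : `[<P i0>] by apply/asboolP.
case: (@Order.TotalTheory.arg_minP _ _ 'I_n i0 (fun i => `[<P i>])
  (fun i => sigma i) Pi0) => m /asboolP Pm hm.
exists m => // l Pl.
by apply: (hm (Ordinal (hn _ Pl))); apply/asboolP.
Qed.

End Extrema.

Lemma finite_max {d : Order.disp_t} {A : orderType d} (sigma : nat -> A)
    (P : set nat) n : (forall l, P l -> (l < n)%N) -> P !=set0 ->
  exists2 m, P m & forall l, P l -> (sigma l <= sigma m)%O.
Proof. exact: (@finite_min _ (A^d)%type sigma). Qed.

Lemma finite_nat_bound (P : set nat) :
  finite_set P <-> exists n, forall l, P l -> (l < n)%N.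
Proof.
split=> [/finite_fsetP[X ->]|[n hn]].
  exists (\max_(x <- X) x).+1 => l /= lX; rewrite ltnS.
  exact: (@leq_bigmax_seq _ _ xpredT id).
exact: (sub_finite_set hn (finite_II n)).
Qed.

Section Flags.
Variables (C : numClosedFieldType) (V : lmodType C) (e : nat -> V).
Hypothesis he : is_basis e.
Implicit Types (v u : nat -> V) (F : set (set V)).

Lemma almost_eP v : almost_e e v <-> exists n, forall l, (n <= l)%N -> v l = e l.
Proof.
rewrite /almost_e finite_nat_bound; split=> -[n hn]; exists n => l.
  by move=> nl; apply: contrapT => /hn; rewrite ltnNge nl.
by move=> /= h; rewrite ltnNge; apply/negP => /hn.
Qed.

Lemma e_basis_common v u : e_basis e v -> e_basis e u ->
  exists n, forall l, (n <= l)%N -> v l = e l /\ u l = e l.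
Proof.
move=> [_ /almost_eP[n hn]] [_ /almost_eP[m hm]]; exists (maxn n m) => l.
by rewrite geq_max => /andP[? ?]; rewrite hn ?hm.
Qed.

Lemma e_basis_e : e_basis e e.
Proof. by split=> //; apply/almost_eP; exists 0%N. Qed.

Lemma e_basis_comp v (w : nat -> nat) n : bijective w ->
  (forall l, (n <= l)%N -> w l = l) -> e_basis e v -> e_basis e (v \o w).
Proof.
move=> wb hw [vb /almost_eP[m hm]]; split; first exact: basis_perm.
apply/almost_eP; exists (maxn n m) => l; rewrite geq_max => /andP[nl ml] /=.
by rewrite hw// hm.
Qed.

Lemma e_basis_image v (g : {linear V -> V}) : groupG e g ->
  e_basis e v -> e_basis e (g \o v).
Proof.
move=> [gb /almost_eP[n hn]] [vb /almost_eP[m hm]]; split.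
  exact: basis_image.
apply/almost_eP; exists (maxn n m) => l; rewrite geq_max => /andP[nl ml] /=.
by rewrite hm// hn.
Qed.

Lemma e_basis_change v u : e_basis e v -> e_basis e u ->
  exists2 g : {linear V -> V}, groupG e g & forall i, g (v i) = u i.
Proof.
move=> hv hu; have [n hn] := e_basis_common hv hu.
have [g [gb gE]] := exists_basis_change (proj1 hv) (proj1 hu).
exists g => //; split=> //; apply/almost_eP; exists n => l /hn[vE uE].
by rewrite -{1}vE gE.
Qed.

Section OneFlag.
Context {d : Order.disp_t} {A : orderType d}.
Variable sigma : nat -> A.

Lemma eq_flag v u : flag_lt sigma v = flag_lt sigma u ->
  flag_le sigma v = flag_le sigma u -> flag sigma v = flag sigma u.
Proof. by rewrite /flag => -> ->. Qed.

Lemma act_flag v (g : {linear V -> V}) :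
  act g (flag sigma v) = flag sigma (g \o v).
Proof.
apply/seteqP; split.
  move=> _ [U [b [->|->]] <-]; exists b; rewrite lspan_image; by [left|right].
move=> _ [b [->|->]]; [exists (flag_lt sigma v b)|exists (flag_le sigma v b)].
- by exists b; left.
- exact: lspan_image.
- by exists b; right.
- exact: lspan_image.
Qed.

Lemma flagsXP F :
  flagsX e sigma F <-> exists2 v, e_basis e v & F = flag sigma v.
Proof.
split=> [[g hg <-]|[v hv ->]].
  exists (g \o e); last exact: act_flag.
  by apply: e_basis_image => //; exact: e_basis_e.
have [g hg gE] := e_basis_change e_basis_e hv.
exists g => //; rewrite act_flag; congr flag; exact/funext.
Qed.

(** Only finitely many vectors change, so the inverse change of basis is
triangular by induction along the finite set of changed indices, although
[A] need not be well ordered. *)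
Lemma triangular_change v u : injective sigma -> e_basis e v -> almost_e e u ->
  (forall l, lspan [set m | (sigma m <= sigma l)%O] v (u l)) ->
  (forall l, coord v (u l) l != 0) ->
  [/\ e_basis e u, flag_lt sigma u = flag_lt sigma v
    & flag_le sigma u = flag_le sigma v].
Proof.
move=> sI [vb /almost_eP[n hn]] ua hu hc.
have [m hm] := proj1 (almost_eP u) ua.
pose bad l := ~ lspan [set m | (sigma m <= sigma l)%O] u (v l).
have inv l : lspan [set m | (sigma m <= sigma l)%O] u (v l).
  apply: contrapT => badl.
  have badn k : bad k -> (k < maxn n m)%N.
    move=> badk; rewrite ltnNge; apply/negP; rewrite geq_max => /andP[nk mk].
    by apply: badk; rewrite hn// -hm//; apply: lspan_gen => /=.
  have [k badk kmin] := finite_min sigma badn (ex_intro _ l badl).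
  apply: badk; have S := lspan_subspace [set m | (sigma m <= sigma k)%O] u.
  have rest : lspan [set m | (sigma m <= sigma k)%O] u
      (u k - coord v (u k) k *: v k).
    have : lspan [set i | (sigma i < sigma k)%O] v
        (u k - coord v (u k) k *: v k).
      apply/lspanE => // i /negP; rewrite -leNgt => ki.
      rewrite coordB// coordZ// coord_basis//.
      have [->|ik] := eqVneq i k; first by rewrite mulr1 subrr.
      rewrite mulr0 subr0; apply: (proj1 (lspanE vb _ _) (hu k)) => /= ik'.
      move/eqP: ik; apply; apply: sI; apply/eqP; by rewrite eq_le ki ik'.
    apply: lspan_le => i /= ik.
    have /contrapT hi : ~ bad i by move=> /kmin; rewrite leNgt ik.
    apply: lspan_sub hi => j /= ji.
    exact: le_trans ji (ltW ik).
  have -> : v k = (coord v (u k) k)^-1 *: (u k - (u k - coord v (u k) k *: v k)).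
    by rewrite subKr scalerA mulVf// scale1r.
  by apply: subspaceZ => //; apply: subspaceB => //; apply: lspan_gen => /=.
have ub : is_basis u.
  apply: (basis_transfer vb) => [i|N c cE i iN].
    exact: (lspan_sub (@subsetT _ _) (inv i)).
  apply: contrapT => /eqP ci.
  pose P k := (k < N)%N /\ c k != 0.
  have [] := @finite_max _ _ sigma P N _ (ex_intro _ i (conj iN ci)).
    by move=> l [].
  move=> k [kN ck] kmax; have := coord0 vb k; rewrite -cE coord_sum//.
  rewrite (bigD1 (Ordinal kN))//= big1 => [|j jk].
    by rewrite addr0 coordZ// => /eqP; rewrite mulf_eq0 (negbTE ck) (negbTE (hc k)).
  rewrite coordZ//; have [->|cj] := eqVneq (c j) 0; first by rewrite mul0r.
  have jk' : (sigma j <= sigma k)%O by apply: kmax.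
  rewrite (proj1 (lspanE vb _ _) (hu j)) ?mulr0//= => kj.
  by move: jk; rewrite -val_eqE /= => /eqP; apply; apply: sI; apply: le_anti; rewrite jk'.
split; first by split.
  apply/funext => b; apply/seteqP; split; apply: lspan_le => l /= lb.
    by apply: lspan_sub (hu l) => k /= kl; apply: le_lt_trans lb.
  by apply: lspan_sub (inv l) => k /= kl; apply: le_lt_trans lb.
apply/funext => b; apply/seteqP; split; apply: lspan_le => l /= lb.
  by apply: lspan_sub (hu l) => k /= kl; apply: le_trans lb.
by apply: lspan_sub (inv l) => k /= kl; apply: le_trans lb.
Qed.

(** The place of a vector in a flag: [a] is the label at which [x] appears. *)
Definition level v (x : V) (a : A) :=
  forall b, (flag_le sigma v b x <-> (a <= b)%O) /\
            (flag_lt sigma v b x <-> (a < b)%O).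

Lemma level_basis v l : is_basis v -> level v (v l) (sigma l).
Proof.
move=> vb b; split; (split; last exact: lspan_gen) => /lspanE h;
  apply/negPn/negP => nb; have := h vb l (elimN idP nb);
  by rewrite coord_basis// eqxx => /eqP; rewrite oner_eq0.
Qed.

Lemma exists_level v (x : V) : is_basis v -> x != 0 -> exists a, level v x a.
Proof.
move=> vb x0; have [n [hn _]] := coord_spec vb x.
have [] := @finite_max _ _ sigma [set i | coord v x i != 0] n _
  (coord_neq0 vb x0).
  by move=> l /=; rewrite ltnNge; apply: contraNN => /hn ->.
move=> m /= cm mmax; exists (sigma m) => b; split; (split=> [/(lspanE vb) h|h]).
- by apply/negPn/negP => nb; have /eqP := h m (elimN idP nb); rewrite (negbTE cm).
- apply/lspanE => // i ib; apply/eqP/negPn/negP => /mmax im.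
  by apply: ib => /=; apply: le_trans h.
- by apply/negPn/negP => nb; have /eqP := h m (elimN idP nb); rewrite (negbTE cm).
- apply/lspanE => // i ib; apply/eqP/negPn/negP => /mmax im.
  by apply: ib => /=; apply: le_lt_trans h.
Qed.

Lemma flag_le_sub v a b : (a <= b)%O -> flag_le sigma v a `<=` flag_le sigma v b.
Proof. by move=> ab; apply: lspan_sub => i /= ia; apply: le_trans ab. Qed.

(** The two subspaces labelled by the level of [x] are the least member of the
flag containing [x] and the greatest member not containing it; hence they
depend only on [x] and on the flag as a set. *)
Lemma level_flag v u x a b : flag sigma v = flag sigma u ->
  level v x a -> level u x b ->
  flag_le sigma v a `<=` flag_le sigma u b /\
  flag_lt sigma v a `<=` flag_lt sigma u b.
Proof.
move=> vu xa xb; split.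
  have : flag sigma v (flag_le sigma u b) by rewrite vu; exists b; right.
  have xin : flag_le sigma u b x by apply/(xb b).1.
  move=> [b' [] E]; rewrite E in xin *.
    have /(xa b').2 ab := xin.
    by apply: lspan_sub => i /= ia; apply: le_lt_trans ab.
  have /(xa b').1 ab := xin; exact: flag_le_sub.
have : flag sigma u (flag_lt sigma v a) by rewrite -vu; exists a; left.
have xin : ~ flag_lt sigma v a x by move=> /(xa a).2; rewrite ltxx.
move=> [a' [] E]; rewrite E in xin *.
  have ab : (a' <= b)%O by rewrite leNgt; apply/negP => /(xb a').2.
  by apply: lspan_sub => i /= ia; apply: lt_le_trans ab.
have ab : (a' < b)%O by rewrite ltNge; apply/negP => /(xb a').1.
by apply: lspan_sub => i /= ia; apply: le_lt_trans ab.
Qed.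

(** A flag determines its labelling: two presentations differ by a strictly
increasing map of [A] into itself that moves only finitely many labels, and
such a map is the identity since the orbit of a moved label would be an
infinite monotone sequence of moved labels. *)
Lemma flag_labels v u : bijective sigma -> e_basis e v -> e_basis e u ->
  flag sigma v = flag sigma u ->
  flag_lt sigma v = flag_lt sigma u /\ flag_le sigma v = flag_le sigma u.
Proof.
move=> [s' sK s'K] hv hu vu; have [n hn] := e_basis_common hv hu.
have vb := proj1 hv; have ub := proj1 hu.
have /choice[rho hrho] : forall l, exists a, level u (v l) a.
  by move=> l; apply: exists_level => //; apply: basis_neq0.
have rmono l m : (sigma l < sigma m)%O -> (rho l < rho m)%O.
  move=> lm; rewrite ltNge; apply/negP => rml.
  have : flag_le sigma u (rho l) (v m) by apply/(hrho m _).1.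
  move=> /(level_flag (esym vu) (hrho l) (level_basis l vb)).1.
  by move=> /(level_basis m vb _).1; rewrite leNgt lm.
have rn l : (n <= l)%N -> rho l = sigma l.
  move=> /hn[vE uE]; have h1 := hrho l; rewrite vE -uE in h1.
  have h2 := level_basis l ub; apply: le_anti; apply/andP; split.
    by apply/(h1 _).1/(h2 _).1.
  by apply/(h2 _).1/(h1 _).1.
have moved (P : rel A) l : (forall a, ~~ P a a) -> P (sigma l) (rho l) -> (l < n)%N.
  by move=> Pirr; rewrite ltnNge; apply: contraL => /rn ->.
have rE l : rho l = sigma l.
  apply: contrapT => /eqP; rewrite neq_lt => /orP[|] h.
    have [] := @finite_min _ _ sigma [set l | (rho l < sigma l)%O] n _
      (ex_intro _ l h).
      by move=> k /(moved (fun a b => (b < a)%O)); apply=> a; rewrite ltxx.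
    move=> m /= hm /(_ (s' (rho m))) /=; rewrite s'K leNgt hm => H.
    suff : false by []; apply: H.
    by have := rmono (s' (rho m)) m; rewrite s'K; apply.
  have [] := @finite_max _ _ sigma [set l | (sigma l < rho l)%O] n _
    (ex_intro _ l h).
    by move=> k /(moved (fun a b => (a < b)%O)); apply=> a; rewrite ltxx.
  move=> m /= hm /(_ (s' (rho m))) /=; rewrite s'K leNgt hm => H.
  suff : false by []; apply: H.
  by have := rmono m (s' (rho m)); rewrite s'K; apply.
have both a : flag_lt sigma v a = flag_lt sigma u a /\
              flag_le sigma v a = flag_le sigma u a.
  rewrite -[a]s'K; set l := s' a.
  have h1 := hrho l; rewrite rE in h1; have h2 := level_basis l vb.
  have [? ?] := level_flag vu h2 h1; have [? ?] := level_flag (esym vu) h1 h2.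
  by split; apply/seteqP; split.
by split; apply/funext => a; have [] := both a.
Qed.

Lemma flag_change v u : bijective sigma -> e_basis e v -> e_basis e u ->
  flag sigma v = flag sigma u -> forall l,
  lspan [set m | (sigma m <= sigma l)%O] v (u l) /\ coord v (u l) l != 0.
Proof.
move=> sb hv hu vu l; have [ltE leE] := flag_labels sb hv hu vu.
have sI := bij_inj sb; have vb := proj1 hv; have ub := proj1 hu.
have hl : flag_le sigma v (sigma l) (u l).
  by rewrite leE; apply: lspan_gen => /=.
split=> //; apply/eqP => c0.
have /(level_basis l ub _).2 : flag_lt sigma u (sigma l) (u l).
  rewrite -ltE; apply/lspanE => // i /negP; rewrite -leNgt le_eqVlt.
  case/orP => [/eqP/sI <- //|li]; apply: (proj1 (lspanE vb _ _) hl) => /=.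
  by apply/negP; rewrite -ltNge.
by rewrite ltxx.
Qed.

End OneFlag.

Section TwoFlags.
Context {d d' : Order.disp_t} {B : orderType d} {A : orderType d'}.
Variables (tau : nat -> B) (sigma : nat -> A).

(** The vector [v l] lies in the members of the two flags labelled [tau l] and
[sigma (w l)]. Expanded in [u], it must involve the vector labelled by both,
for otherwise it would be a sum of elements of the two preceding members, which
have no component along [v l]. *)
Lemma relative_position_unique (w w' : nat -> nat) v u :
  injective tau -> injective sigma -> is_basis v -> is_basis u ->
  flag_lt tau v = flag_lt tau u -> flag_le tau v = flag_le tau u ->
  flag_lt (sigma \o w) v = flag_lt (sigma \o w') u ->
  flag_le (sigma \o w) v = flag_le (sigma \o w') u -> w =1 w'.
Proof.
move=> tI sI vb ub lt1 le1 lt2 le2 l; apply: contrapT => ww.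
have x1 : flag_le tau u (tau l) (v l) by rewrite -le1; apply: lspan_gen => /=.
have x2 : flag_le (sigma \o w') u (sigma (w l)) (v l).
  by rewrite -le2; apply: lspan_gen => /=.
have : lspan [set i | (tau i < tau l)%O || (sigma (w' i) < sigma (w l))%O] u (v l).
  apply/lspanE => // i /negP; rewrite negb_or -!leNgt => /andP[h1 h2].
  apply/eqP/negPn/negP => ci; apply: ww.
  have h3 : (tau i <= tau l)%O.
    by apply: contrapT => h; move/negP: ci; apply; apply/eqP/(proj1 (lspanE ub _ _) x1).
  have h4 : (sigma (w' i) <= sigma (w l))%O.
    by apply: contrapT => h; move/negP: ci; apply; apply/eqP/(proj1 (lspanE ub _ _) x2).
  have il : i = l by apply/tI/le_anti; rewrite h1 h3.
  by move: h2 h4; rewrite il => h2 h4; apply/sI/le_anti; rewrite h2 h4.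
have sub0 : subspace [set x | coord v x l = 0].
  split=> [|a x y /= hx hy] /=; first by rewrite coord0.
  by rewrite coordP// hx hy mulr0 addr0.
have : lspan [set i | (tau i < tau l)%O || (sigma (w' i) < sigma (w l))%O] u
    `<=` [set x | coord v x l = 0].
  apply: lspan_min => // i /= /orP[h|h].
    have : flag_lt tau v (tau l) (u i) by rewrite lt1; apply: lspan_gen.
    by move=> /(proj1 (lspanE vb _ _)); apply=> /=; rewrite ltxx.
  have : flag_lt (sigma \o w) v (sigma (w l)) (u i) by rewrite lt2; apply: lspan_gen.
  by move=> /(proj1 (lspanE vb _ _)); apply=> /=; rewrite ltxx.
move=> h /h /=; rewrite coord_basis// eqxx => /eqP; by rewrite oner_eq0.
Qed.

Lemma pair_orbitP (w : nat -> nat) F F' :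
  pair_orbit e tau sigma w (F, F') <->
  exists v, [/\ e_basis e v, F = flag tau v & F' = flag (sigma \o w) v].
Proof.
split=> [[g hg [<- <-]]|[v [hv -> ->]]].
  exists (g \o e); rewrite !act_flag; split=> //.
  by apply: e_basis_image => //; exact: e_basis_e.
have [g hg gE] := e_basis_change e_basis_e hv.
have -> : v = g \o e by apply/funext => i /=; rewrite gE.
by exists g => //; rewrite !act_flag.
Qed.

Lemma flag_comp v (w : nat -> nat) : involutive w ->
  [/\ flag_lt sigma (v \o w) = flag_lt (sigma \o w) v,
      flag_le sigma (v \o w) = flag_le (sigma \o w) v
    & flag sigma (v \o w) = flag (sigma \o w) v].
Proof.
move=> wK; rewrite /flag.
have -> : flag_lt sigma (v \o w) = flag_lt (sigma \o w) v.
  by apply/funext => a; rewrite /flag_lt lspan_comp.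
have -> // : flag_le sigma (v \o w) = flag_le (sigma \o w) v.
by apply/funext => a; rewrite /flag_le lspan_comp.
Qed.

(** The labels of both flags are determined by the pair, and [w] can be read off
from the labelled flags; precomposing with [w] turns a flag labelled by
[sigma \o w] into one labelled by [sigma]. *)
Lemma pair_orbit_unique (w w' : nat -> nat) n
    (F : set (set V) * set (set V)) :
  bijective tau -> bijective sigma -> involutive w -> involutive w' ->
  (forall l, (n <= l)%N -> w l = l /\ w' l = l) ->
  pair_orbit e tau sigma w F -> pair_orbit e tau sigma w' F -> w =1 w'.
Proof.
case: F => F F' tb sb wK w'K hn.
move=> /pair_orbitP[v [hv vF vF']] /pair_orbitP[u [hu uF uF']].
have [lt1 le1] : _ /\ _ := flag_labels tb hv hu (etrans (esym vF) uF).
have [vlt vle vfl] := flag_comp v wK; have [ult ule ufl] := flag_comp u w'K.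
have [||||] := @flag_labels _ _ sigma (v \o w) (u \o w') => //.
- by apply: (@e_basis_comp _ _ n) => //; [exact: inv_bij|move=> l /hn[]].
- by apply: (@e_basis_comp _ _ n) => //; [exact: inv_bij|move=> l /hn[]].
- by rewrite vfl ufl -vF' uF'.
rewrite vlt ult vle ule => lt2 le2.
by apply: (relative_position_unique (bij_inj tb) (bij_inj sb) (proj1 hv) (proj1 hu)).
Qed.

End TwoFlags.
End Flags.

(** * The involution and the Hermitian form *)

Section Signs.
Variable C : numClosedFieldType.

Lemma signC_sqr s : signC C s * signC C s = 1.
Proof. by case: s; rewrite /signC ?mulr1// mulrNN mulr1. Qed.

Lemma signC_conj s : (signC C s)^* = signC C s.
Proof. by case: s; rewrite /signC ?rmorphN rmorph1. Qed.

Lemma signC_neq0 s : signC C s != 0.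
Proof. by case: s; rewrite /signC ?oppr_eq0 oner_eq0. Qed.

Lemma signC_negb s : signC C (~~ s) = - signC C s.
Proof. by case: s; rewrite /signC //= opprK. Qed.

Lemma signC_inj : injective (signC C).
Proof.
have /eqP h : (1 : C) != -1 by rewrite -subr_eq0 opprK (pnatr_eq0 C 2).
by case=> [] [] //; rewrite /signC => /esym// /esym.
Qed.

(** The sign of a fixed point as a total function; outside the fixed points its
value is irrelevant, because only [coef] is used. *)
Definition fix_sign (c : signed_map) (k : nat) : bool := `[< fixed_with c true k >].

Lemma fixed_withP (c : signed_map) s k : fixed_with c s k <-> c k = k /\ fix_sign c k = s.
Proof.
have irr (h h' : c k = k) : h = h' by exact: eq_irrelevance.
split=> [[h hs]|[h]].
  split=> //; rewrite /fix_sign; case: s hs => hs; first by apply/asboolP; exists h.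
  by apply/asboolPn => -[h']; rewrite (irr h' h) hs.
rewrite /fix_sign; case: s => [/asboolP//|/asboolPn nh].
by exists h; case E: (fsign h) => //; case: nh; exists h.
Qed.

Lemma fix_signE (c : signed_map) k (h : c k = k) : fix_sign c k = fsign h.
Proof. by have [_] := (fixed_withP c (fsign h) k).1 (ex_intro _ h erefl). Qed.

(** With this coefficient both kinds of bases are described by one equation:
[delta (v k)] is [coef k *: v (w k)] for a conjugate basis, and [coef k] is the
only nonzero entry, at [w k], of the [k]-th row of the Gram matrix of a dual
basis. *)
Definition coef (w : nat -> nat) (eps : nat -> bool) (k : nat) : C :=
  if w k == k then signC C (eps k) else 1.

Definition scoef (c : signed_map) : nat -> C := coef c (fix_sign c).

Lemma coef_neq0 w eps k : coef w eps k != 0.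
Proof. by rewrite /coef; case: ifP => _; rewrite ?signC_neq0 ?oner_eq0. Qed.

Lemma coef_conj w eps k : (coef w eps k)^* = coef w eps k.
Proof. by rewrite /coef; case: ifP => _; rewrite ?signC_conj ?rmorph1. Qed.

Lemma coef_inv w eps k : involutive w -> coef w eps (w k) = coef w eps k.
Proof.
move=> wK; rewrite /coef wK; by case: (eqVneq (w k) k) => [->|].
Qed.

End Signs.

Lemma sign_partitionP N s l : sign_partition N -> N s l <-> `[< N true l >] = s.
Proof.
move=> [cover disj _]; case: s; first by split=> /asboolP.
split=> [Nl|/asboolPn nN]; last first.
  by have : [set: nat] l by []; rewrite -cover => -[].
by apply/asboolPn => Nt; have : set0 l by rewrite -disj.
Qed.

Section Forms.
Variables (C : numClosedFieldType) (V : lmodType C) (e : nat -> V).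
Hypothesis he : is_basis e.
Implicit Types (x y z : V) (v u : nat -> V).

Section OneForm.
Variable N : bool -> set nat.

Local Notation Phi := (@Phi C N).
Local Notation phi := (phi e N).
Local Notation delta := (delta e N).

Lemma Phi_sqr l : Phi l * Phi l = 1. Proof. exact: signC_sqr. Qed.
Lemma Phi_conj l : (Phi l)^* = Phi l. Proof. exact: signC_conj. Qed.

Lemma coord_delta x l : coord e (delta x) l = Phi l * coord e x l.
Proof.
have [n [hn _]] := coord_spec he x.
rewrite /Defs.delta (@fsum_nat _ _ n) => [|i ni]; last first.
  by rewrite hn// mulr0 scale0r.
by rewrite (coord_unique he (c := fun i => Phi i * coord e x i))// => i /hn ->;
  rewrite mulr0.
Qed.

Lemma deltaP a x y : delta (a *: x + y) = a *: delta x + delta y.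
Proof.
apply: (coord_inj he) => l; rewrite (coordP he) !coord_delta (coordP he).
by rewrite mulrDr mulrCA.
Qed.

Definition deltaL : {linear V -> V} :=
  HB.pack delta (GRing.isLinear.Build _ _ _ _ delta deltaP).

Lemma deltaK : involutive delta.
Proof.
by move=> x; apply: (coord_inj he) => l; rewrite !coord_delta mulrA Phi_sqr mul1r.
Qed.

Lemma delta_e l : delta (e l) = Phi l *: e l.
Proof.
apply: (coord_inj he) => i; rewrite coord_delta (coordZ he) (coord_basis he).
by case: eqVneq => [->|]; rewrite ?mulr0.
Qed.

Lemma delta0 : delta 0 = 0. Proof. exact: (linear0 deltaL). Qed.

Lemma deltaD x y : delta (x + y) = delta x + delta y.
Proof. exact: (linearD deltaL). Qed.

Lemma deltaB x y : delta (x - y) = delta x - delta y.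
Proof. exact: (linearB deltaL). Qed.

Lemma deltaZ a x : delta (a *: x) = a *: delta x.
Proof. exact: (linearZ_LR deltaL). Qed.

Lemma phiE n x y : (forall i, (n <= i)%N -> coord e y i = 0) ->
  phi x y = \sum_(i < n) (coord e x i)^* * Phi i * coord e y i.
Proof. by move=> h; apply: fsum_nat => i /h ->; rewrite mulr0. Qed.

Lemma phiPr a x y z : phi x (a *: y + z) = a * phi x y + phi x z.
Proof.
have [n hn] := coord_bound he y z.
rewrite !(@phiE n); try by move=> i /hn[].
  rewrite mulr_sumr -big_split; apply: eq_bigr => i _ /=.
  by rewrite (coordP he) mulrDr; congr (_ + _); rewrite mulrCA.
by move=> i /hn[hy hz]; rewrite (coordP he) hy hz mulr0 addr0.
Qed.

Lemma phi_conj x y : (phi x y)^* = phi y x.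
Proof.
have [n hn] := coord_bound he x y.
rewrite !(@phiE n); try by move=> i /hn[].
rewrite rmorph_sum; apply: eq_bigr => i _ /=.
by rewrite !rmorphM /= conjCK Phi_conj mulrC [_ * Defs.Phi _ _ _ in LHS]mulrC mulrA.
Qed.

Definition phiL x : {linear V -> C^o} :=
  HB.pack (phi x : V -> C^o) (GRing.isLinear.Build _ _ _ _ (phi x : V -> C^o)
    (fun a y z => phiPr a x y z)).

Lemma phi0r x : phi x 0 = 0. Proof. exact: (linear0 (phiL x)). Qed.
Lemma phiDr x y z : phi x (y + z) = phi x y + phi x z.
Proof. exact: (linearD (phiL x)). Qed.
Lemma phiBr x y z : phi x (y - z) = phi x y - phi x z.
Proof. exact: (linearB (phiL x)). Qed.
Lemma phiZr a x y : phi x (a *: y) = a * phi x y.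
Proof. exact: (linearZ_LR (phiL x)). Qed.
Lemma phi_sumr I r (p : pred I) (F : I -> V) x :
  phi x (\sum_(i <- r | p i) F i) = \sum_(i <- r | p i) phi x (F i).
Proof. exact: (linear_sum (phiL x)). Qed.

Lemma phi0l x : phi 0 x = 0. Proof. by rewrite -phi_conj phi0r rmorph0. Qed.
Lemma phiDl x y z : phi (y + z) x = phi y x + phi z x.
Proof. by rewrite -phi_conj phiDr rmorphD /= !phi_conj. Qed.
Lemma phiBl x y z : phi (y - z) x = phi y x - phi z x.
Proof. by rewrite -phi_conj phiBr rmorphB /= !phi_conj. Qed.
Lemma phiZl a x y : phi (a *: y) x = a^* * phi y x.
Proof. by rewrite -phi_conj phiZr rmorphM /= phi_conj. Qed.
Lemma phi_suml I r (p : pred I) (F : I -> V) x :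
  phi (\sum_(i <- r | p i) F i) x = \sum_(i <- r | p i) phi (F i) x.
Proof.
by rewrite -phi_conj phi_sumr rmorph_sum; apply: eq_bigr => i _ /=; rewrite phi_conj.
Qed.

Lemma phi_er x i : phi x (e i) = (coord e x i)^* * Phi i.
Proof.
rewrite (@phiE i.+1) => [|j]; last first.
  by rewrite (coord_basis he); case: eqVneq => // ->; rewrite ltnn.
rewrite (bigD1 ord_max)//= (coord_basis he) eqxx mulr1 big1 ?addr0// => j.
by rewrite (coord_basis he) -val_eqE /= => /negbTE ->; rewrite mulr0.
Qed.

Lemma phi_el x i : phi (e i) x = Phi i * coord e x i.
Proof. by rewrite -phi_conj phi_er rmorphM /= conjCK Phi_conj mulrC. Qed.

Lemma phi_ee i j : phi (e i) (e j) = if j == i then Phi i else 0.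
Proof.
by rewrite phi_el (coord_basis he) eq_sym; case: eqP; rewrite ?mulr1 ?mulr0.
Qed.

Lemma phi_nondegenerate x : (forall y, phi x y = 0) -> x = 0.
Proof.
move=> h; apply: (coord_inj he) => i; rewrite (coord0 he); apply/eqP.
have /eqP := h (e i); rewrite phi_er mulf_eq0 conjC_eq0.
by rewrite (negbTE (signC_neq0 _ _)) orbF.
Qed.

Lemma phi_subspace x : subspace [set y | phi x y = 0].
Proof.
split=> [|a y z /= hy hz]; first exact: phi0r.
by rewrite /= phiPr hy hz mulr0 addr0.
Qed.

Lemma phi_subspacel x : subspace [set y | phi y x = 0].
Proof.
split=> [|a y z /= hy hz]; first exact: phi0l.
by rewrite /= phiDl phiZl hy hz mulr0 addr0.
Qed.

Lemma dagger_subspace F : subspace (dagger e N F).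
Proof.
split=> [y _|a x z hx hz y Fy]; first exact: phi0l.
by rewrite phiDl phiZl hx// hz// mulr0 addr0.
Qed.

Lemma conj_basisP (c : signed_map) v : conjugate_basis e N c v <->
  e_basis e v /\ forall k, delta (v k) = scoef C c k *: v (c k).
Proof.
split=> -[hv h]; split=> // k.
  rewrite /scoef /coef; case: eqP => ck; last by rewrite scale1r; apply (h k).1.
  by rewrite (fix_signE ck) ck; apply: (h k).2.
rewrite h /scoef /coef; split=> [/eqP/negbTE -> //|ck]; first by rewrite scale1r.
by rewrite (fix_signE ck) ck eqxx.
Qed.

Lemma dual_basisP (c : signed_map) v : dual_basis e N c v <->
  e_basis e v /\ forall k l, phi (v k) (v l) = if l == c k then scoef C c k else 0.
Proof.
split=> -[hv h]; split=> // k l.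
  have [h1 h2 h3] := h k l; case: eqP => [lE|/h1//]; rewrite /scoef /coef.
  by case: eqP => ck; [rewrite (fix_signE ck); apply: h3|apply: h2].
rewrite h /scoef /coef; split=> [/eqP/negbTE -> //|-> /eqP/negbTE ->|ck ->].
  by rewrite eqxx.
by rewrite (fix_signE ck) ck eqxx.
Qed.

Section DualBasis.
Variables (w : nat -> nat) (eps : nat -> bool) (v : nat -> V).
Hypothesis wK : involutive w.
Hypothesis vb : is_basis v.
Hypothesis vdual :
  forall k l, phi (v k) (v l) = if l == w k then coef C w eps k else 0.

Lemma phi_dual x k : phi (v k) x = coef C w eps k * coord v x (w k).
Proof.
move: x; apply: (basis_ind vb) => [|l /=]; last first.
  by rewrite vdual (coord_basis vb) eq_sym; case: eqP; rewrite ?mulr1 ?mulr0.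
split=> [|a x y /= hx hy]; first by rewrite /= phi0r (coord0 vb) mulr0.
by rewrite /= phiPr hx hy (coordP vb) mulrDr mulrCA.
Qed.

Lemma phi_dual_eq0 x k : (phi (v k) x == 0) = (coord v x (w k) == 0).
Proof. by rewrite phi_dual mulf_eq0 (negbTE (coef_neq0 _ _ _ _)). Qed.

End DualBasis.
End OneForm.

(** The positive definite Hermitian form [sum_l (x_l)^* y_l] is [phi] for the
partition with empty negative part. *)
Definition all_plus : bool -> set nat := fun s => if s then setT else set0.

Lemma Phi_plus l : Phi C all_plus l = 1.
Proof. by rewrite /Phi /signC asboolT. Qed.

Lemma phi_plus_ge0 x : 0 <= phi e all_plus x x.
Proof.
have [n [hn _]] := coord_spec he x; rewrite (phiE _ _ hn); apply: sumr_ge0 => i _.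
by rewrite Phi_plus mulr1 mulrC mul_conjC_ge0.
Qed.

Lemma phi_plus_eq0 x : phi e all_plus x x = 0 -> x = 0.
Proof.
have [n [hn xE]] := coord_spec he x; rewrite (phiE _ _ hn) => /eqP.
rewrite psumr_eq0 => [/allP h|i _]; last first.
  by rewrite Phi_plus mulr1 mulrC mul_conjC_ge0.
rewrite xE big1// => i _; have := h i (mem_index_enum _).
by rewrite Phi_plus mulr1 mulrC mul_conjC_eq0 => /eqP ->; rewrite scale0r.
Qed.

Section Comparison.
Variable N : bool -> set nat.

Lemma phi_deltal x y : phi e N (delta e N x) y = phi e all_plus x y.
Proof.
have [n [hn _]] := coord_spec he y; rewrite !(phiE _ _ hn).
apply: eq_bigr => i _; rewrite coord_delta rmorphM /= Phi_conj Phi_plus mulr1.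
by rewrite (mulrAC (Phi C N i)) Phi_sqr mul1r.
Qed.

Lemma phi_delta2 x y : phi e N (delta e N x) (delta e N y) = phi e N x y.
Proof.
rewrite phi_deltal; have [n [hn _]] := coord_spec he y.
rewrite (phiE _ _ hn) (@phiE _ n) => [|i /hn]; last first.
  by rewrite coord_delta => ->; rewrite mulr0.
by apply: eq_bigr => i _; rewrite coord_delta Phi_plus mulr1 mulrA.
Qed.

Lemma phi_delta_swap x y : phi e N (delta e N x) y = phi e N x (delta e N y).
Proof. by rewrite -{1}[y](deltaK N) phi_delta2. Qed.

Lemma VsignP s x : sign_partition N ->
  Vsign e N s x <-> delta e N x = signC C s *: x.
Proof.
move=> hN; have NP l := sign_partitionP s l hN.
split=> [/(lspanE he) h|h].
  apply: (coord_inj he) => l; rewrite coord_delta (coordZ he).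
  have [/NP Nl|/h ->] := pselect (N s l); last by rewrite !mulr0.
  by rewrite /Phi Nl.
apply/(lspanE he) => l nN; have := coord_delta N x l.
rewrite h (coordZ he) => /eqP; rewrite -subr_eq0 -mulrBl mulf_eq0 => /orP[|/eqP//].
by rewrite subr_eq0 => /eqP/signC_inj sE; case: nN; apply/NP.
Qed.

End Comparison.
End Forms.

(** * Existence of adapted bases *)

(** The involution extending [w] by the exchange of two of its fixed points;
for [m = k] it is [w] itself. *)
Definition swap (w : nat -> nat) (m k l : nat) : nat :=
  if l == m then k else if l == k then m else w l.

Definition update {T : Type} (f : nat -> T) (m : nat) (t : T) (l : nat) : T :=
  if l == m then t else f l.

Section Swap.
Variables (w : nat -> nat) (m k : nat).
Hypotheses (wK : involutive w) (wm : w m = m) (wk : w k = k).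

Lemma swap_inv : involutive (swap w m k).
Proof.
move=> l; rewrite /swap.
case: (eqVneq l m) => [->|lm]; first by rewrite eqxx; case: eqVneq.
case: (eqVneq l k) => [->|lk]; first by rewrite eqxx.
rewrite -{1}wm (can_eq wK) (negbTE lm) -{1}wk (can_eq wK) (negbTE lk).
exact: wK.
Qed.

Lemma coef_swap (C : numClosedFieldType) eps s l : l != m -> l != k ->
  coef C (swap w m k) (update eps m s) l = coef C w eps l.
Proof. by move=> lm lk; rewrite /coef /swap /update (negbTE lm) (negbTE lk). Qed.

Lemma coef_swap_fixed (C : numClosedFieldType) eps s : m = k ->
  coef C (swap w m k) (update eps m s) m = signC C s.
Proof. by move=> mk; rewrite /coef /swap /update mk !eqxx. Qed.

Lemma coef_swap_moved (C : numClosedFieldType) eps s l : m != k ->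
  (l == m) || (l == k) -> coef C (swap w m k) (update eps m s) l = 1.
Proof.
move=> mk /orP[] /eqP ->; rewrite /coef /swap ?eqxx; first by rewrite eq_sym (negbTE mk).
by rewrite (eq_sym k m) !(negbTE mk).
Qed.

End Swap.

Section Elimination.
Variables (C : numClosedFieldType) (V : lmodType C) (e : nat -> V).
Hypothesis he : is_basis e.
Context {d : Order.disp_t} {A : orderType d}.
Variable sigma : nat -> A.
Hypothesis sI : injective sigma.
Implicit Types (v u : nat -> V) (x y z : V) (R : {fset nat}).

Definition eliminate R m k x y (a b : nat -> C) v (l : nat) : V :=
  if l == m then x else if l == k then y
  else if l \in R then v l - a l *: x - b l *: y else v l.

(** The change of basis is triangular for [sigma]: each remaining vector is
corrected along [x], which comes first, and along [y] only when it comes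
after [k]. *)
Lemma eliminate_flag v R m k x y a b :
  e_basis e v -> m \in R -> k \in R ->
  (forall l, l \in R -> (sigma m <= sigma l)%O) ->
  lspan [set i | (sigma i <= sigma m)%O] v x -> coord v x m != 0 ->
  lspan [set i | (sigma i <= sigma k)%O] v y -> coord v y k != 0 ->
  (forall l, l \in R -> (sigma l < sigma k)%O -> b l = 0) ->
  let u := eliminate R m k x y a b v in
  e_basis e u /\ flag sigma u = flag sigma v.
Proof.
move=> hv mR kR mmin hx xm hy yk b0 u; have vb := proj1 hv.
have above w z l j : lspan [set i | (sigma i <= sigma l)%O] w z -> is_basis w ->
    (sigma l <= sigma j)%O -> j != l -> coord w z j = 0.
  move=> hz wb lj jl; apply: (proj1 (lspanE wb _ _) hz) => /= jl'.
  by move/eqP: jl; apply; apply/sI/le_anti; rewrite jl'.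
have [] := triangular_change sI hv (u := u).
- apply/almost_eP; have [n hn] := proj1 (almost_eP _ _) (proj2 hv).
  have [p hp] := proj1 (finite_nat_bound [set` R]) (finite_fset R).
  have hR l : l \in R -> (l < p)%N by move=> lR; apply: hp.
  exists (maxn n p) => l; rewrite geq_max => /andP[nl pl]; rewrite -hn//.
  have lR : l \notin R by apply/negP => /hR; rewrite ltnNge pl.
  rewrite /u /eliminate (negbTE lR); case: eqVneq => [lm|_]; first by rewrite lm mR in lR.
  by case: eqVneq => [lk|//]; rewrite lk kR in lR.
- move=> l; rewrite /u /eliminate; case: (eqVneq l m) => [->//|lm].
  case: (eqVneq l k) => [->//|lk]; case: ifPn => lR; last by apply: lspan_gen => /=.
  have S := lspan_subspace [set i | (sigma i <= sigma l)%O] v.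
  apply: subspaceB => //; first apply: subspaceB => //.
  + by apply: lspan_gen => /=.
  + by apply: subspaceZ => //; apply: lspan_sub hx => i /= im; apply: le_trans im (mmin _ lR).
  have [lk'|kl] := ltP (sigma l) (sigma k).
    by rewrite b0// scale0r; case: S.
  by apply: subspaceZ => //; apply: lspan_sub hy => i /= im; apply: le_trans im kl.
- move=> l; rewrite /u /eliminate; case: (eqVneq l m) => [->//|lm].
  case: (eqVneq l k) => [->//|lk]; case: ifPn => lR; last first.
    by rewrite (coord_basis vb) eqxx oner_eq0.
  rewrite !(coordB vb) !(coordZ vb) (above _ _ _ _ hx)// ?mmin//.
  rewrite mulr0 subr0 (coord_basis vb) eqxx.
  have [lk'|kl] := ltP (sigma l) (sigma k).
    by rewrite b0// mul0r subr0 oner_eq0.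
  by rewrite (above _ _ _ _ hy)// mulr0 subr0 oner_eq0.
by move=> ub ltE leE; split=> //; apply: eq_flag.
Qed.

Lemma subrACA (G : zmodType) (p q r s t n : G) :
  p + q - (r + s) - (t + n) = (p - r - t) + (q - s - n).
Proof. by rewrite !opprD (addrACA p q) (addrACA (p - r)). Qed.

Section Conjugate.
Variable N : bool -> set nat.
Local Notation delta := (delta e N).

(** Elimination of the [sigma]-least remaining index [m]. With [x = v m] and
[y = delta x], the span of the remaining vectors is the direct sum of the
[delta]-stable span of [x] and [y], on which [P] vanishes, and of its image by
the projection [P]. When [y] is not proportional to [x], it takes the place of
[v k], where [k] is the greatest index occurring in [y]. *)
Lemma conj_elimination n R (w : nat -> nat) eps v : (#|` R| <= n)%N ->
  e_basis e v -> involutive w -> {in R, forall l, w l = l} ->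
  (forall l, l \notin R -> delta (v l) = coef C w eps l *: v (w l)) ->
  (forall l, l \in R -> lspan [set` R] v (delta (v l))) ->
  exists w' eps' u, [/\ e_basis e u, involutive w', flag sigma u = flag sigma v
    & forall l, delta (u l) = coef C w' eps' l *: u (w' l)].
Proof.
elim: n R w eps v => [|n IH] R w eps v.
  rewrite leqn0 cardfs_eq0 => /eqP -> hv wK _ hout _.
  by exists w, eps, v; split=> // l; apply: hout; rewrite inE.
move=> cR hv wK wR hout hin; have vb := proj1 hv.
have [R0|[m0 m0R]] := fset_0Vmem R.
  by apply: (IH R w eps v) => //; rewrite R0 cardfs0.
have [p hp] := proj1 (finite_nat_bound [set` R]) (finite_fset R).
have [m /= mR mmin] := finite_min sigma hp (ex_intro _ m0 m0R).
pose x := v m; pose y := delta x.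
have y0 : y != 0.
  apply/eqP => y0; have : delta y = 0 by rewrite y0 (delta0 he).
  by rewrite (deltaK he) => /eqP; rewrite (negbTE (basis_neq0 vb m)).
have ysupp l : coord v y l != 0 -> l \in R.
  move=> yl; apply/negPn/negP => lR; move/negP: yl; apply; apply/eqP.
  by apply: (proj1 (lspanE vb _ _) (hin m mR)); apply/negP.
have [k yk kmax] : exists2 k, coord v y k != 0 &
    forall l, coord v y l != 0 -> (sigma l <= sigma k)%O.
  apply: (@finite_max _ _ sigma [set l | coord v y l != 0] p).
    by move=> l /ysupp; apply: hp.
  exact: coord_neq0.
have kR := ysupp _ yk; set b := coord v y k in yk.
have yspan : lspan [set i | (sigma i <= sigma k)%O] v y.
  apply/(lspanE vb) => l kl; apply/eqP/negPn/negP => /kmax; exact: kl.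
(* [xi] and [eta] are the coordinates along [x] and [y] in the stable plane;
   for [k = m] the line of [x] is stable, and its coordinate is averaged. *)
have [s [y' [xi [eta [[xiP etaP] [hxi heta hb] [Px Py] [y'b ym ydelta]]]]]] :
  exists s y' xi eta,
   [/\ (forall a z z', xi (a *: z + z') = a * xi z + xi z') /\
       (forall a z z', eta (a *: z + z') = a * eta z + eta z'),
       [/\ (forall z, xi (delta z) *: x + eta (delta z) *: y'
             = xi z *: delta x + eta z *: delta y'),
           (forall l, l \in R -> l != k -> eta (v l) = 0)
         & forall l, l \in R -> (sigma l < sigma k)%O -> eta (v l) = 0],
       xi x *: x + eta x *: y' = x /\ xi y' *: x + eta y' *: y' = y'
     & [/\ y' = if m == k then x else y, m == k -> delta x = signC C s *: x
         & m != k -> y' = delta x]].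
  have [mk|mk] := eqVneq m k.
    have yE : y = b *: x.
      rewrite /b -mk; apply: (coord_inj vb) => l; rewrite (coordZ vb) (coord_basis vb).
      have [->|lm] := eqVneq l m; first by rewrite mulr1.
      rewrite mulr0; apply/eqP/negPn/negP => yl; move/eqP: lm; apply.
      by apply/sI/le_anti; rewrite (mmin _ (ysupp _ yl)) mk (kmax _ yl).
    have bb : b * b = 1.
      have : delta y = x by rewrite (deltaK he).
      rewrite yE (deltaZ he) -/y yE scalerA => /(congr1 (fun z => coord v z m)).
      by rewrite (coordZ vb) (coord_basis vb) eqxx mulr1.
    have [s bs] : exists s, b = signC C s.
      have /eqP : b * b = 1 * 1 by rewrite mulr1.
      rewrite -!expr2 eqf_sqr => /orP[] /eqP ->; by [exists true|exists false].
    exists s, x, (fun z => (coord v z m + b * coord v (delta z) m) / 2), (fun=> 0).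
    split=> //; last by split=> // _; rewrite -bs.
    - split=> [a z z'|*]; last by rewrite mulr0 addr0.
      rewrite (deltaP he) !(coordP vb) mulrA -mulrDl; congr (_ / 2).
      ring.
    - split=> // z; rewrite !scale0r !addr0 (deltaK he) -/y yE scalerA.
      congr (_ *: _); rewrite [RHS]mulrAC; congr (_ / 2).
      by rewrite mulrDl (mulrAC b) bb mul1r addrC (mulrC b).
    - have -> : (coord v x m + b * coord v (delta x) m) / 2 = 1.
        rewrite -/y yE (coordZ vb) (coord_basis vb) eqxx mulr1 bb.
        by rewrite -mulr2n divff// pnatr_eq0.
      by rewrite scale1r scale0r addr0.
  exists true, y, (fun z => coord v (delta z) k / b), (fun z => coord v z k / b).
  split=> //.
  - by split=> a z z'; rewrite ?(deltaP he) !(coordP vb) mulrA -mulrDl.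
  - split=> [z|l _ lk|l _ lk].
    + by rewrite !(deltaK he) addrC.
    + by rewrite (coord_basis vb) eq_sym (negbTE lk) mul0r.
    + rewrite (coord_basis vb); case: eqVneq => [kl|_]; last by rewrite mul0r.
      by rewrite kl ltxx in lk.
  - have xk : coord v x k = 0 by rewrite (coord_basis vb) eq_sym (negbTE mk).
    rewrite !(deltaK he) -/y xk -/b divff// mul0r !scale1r !scale0r.
    by rewrite addr0 add0r.
pose P z := z - xi z *: x - eta z *: y'.
have PP a z z' : P (a *: z + z') = a *: P z + P z'.
  rewrite /P xiP etaP !scalerDl !scalerBr -!scalerA; exact: subrACA.
have Pdelta z : delta (P z) = P (delta z).
  by rewrite /P !(deltaB he) !(deltaZ he) -!addrA -!opprD hxi.
pose u := eliminate R m k x y' (fun l => xi (v l)) (fun l => eta (v l)) v.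
pose R' := (R `\ m `\ k)%fset.
have inR' l : (l \in R') = [&& l != k, l != m & l \in R] by rewrite !inE.
have uR l : l \in R' -> u l = P (v l).
  rewrite inR' => /and3P[lk lm lR].
  by rewrite /u /eliminate (negbTE lm) (negbTE lk) lR.
have um : u m = x by rewrite /u /eliminate eqxx.
have uk : u k = y'.
  by rewrite /u /eliminate eqxx y'b; case: (eqVneq m k).
have uout l : l \notin R -> u l = v l.
  move=> lR; rewrite /u /eliminate (negbTE lR).
  case: eqVneq => [lm|_]; first by rewrite lm mR in lR.
  by case: eqVneq => [lk|//]; rewrite lk kR in lR.
have xspan : lspan [set i | (sigma i <= sigma m)%O] v x by apply: lspan_gen => /=.
have xm : coord v x m != 0 by rewrite (coord_basis vb) eqxx oner_eq0.
have [hu fu] : e_basis e u /\ flag sigma u = flag sigma v.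
  by apply: eliminate_flag => //; rewrite y'b; case: (eqVneq m k) => // <-.
have PR z : lspan [set` R] v z -> lspan [set` R'] u (P z).
  have S := lspan_subspace [set` R'] u.
  have SW : subspace [set z | lspan [set` R'] u (P z)].
    split=> [|a z1 z2 /= h1 h2]; last by rewrite /= PP; apply: (proj2 S).
    have := PP (-1) 0 0; rewrite scaler0 addr0 scaleN1r addNr => P0.
    by rewrite /= P0; case: S.
  have P0 z' : xi z' *: x + eta z' *: y' = z' -> P z' = 0.
    by rewrite /P -addrA -opprD => ->; rewrite subrr.
  have hne l : l \in R -> l != k -> lspan [set` R'] u (P (v l)).
    move=> lR lk; have [->|lm] := eqVneq l m; first by rewrite P0//; case: S.
    have lR' : l \in R' by rewrite inR' lk lm.
    by rewrite -uR//; apply: lspan_gen.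
  move: z; apply: lspan_min => // l /= lR.
  have [->|lk] := eqVneq l k; last exact: hne.
  have [mk|mk] := eqVneq m k; first by rewrite -mk P0//; case: S.
  have hy : lspan ([set` R] `\ k) v (y - b *: v k).
    apply/(lspanE vb) => i nRk; rewrite (coordB vb) (coordZ vb) (coord_basis vb).
    have [->|ik] := eqVneq i k; first by rewrite mulr1 subrr.
    rewrite mulr0 subr0; apply/eqP/negPn/negP => /ysupp iR; apply: nRk.
    by split=> //=; apply/eqP.
  have Wy : [set z | lspan [set` R'] u (P z)] y.
    have yE : y' = y by rewrite y'b (negbTE mk).
    by rewrite /= -yE P0//; case: S.
  have Wr : [set z | lspan [set` R'] u (P z)] (y - b *: v k).
    by move: hy; apply: lspan_min => // i [/= iR /eqP ik]; apply: hne.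
  have -> : v k = b^-1 *: (y - (y - b *: v k)).
    by rewrite subKr scalerA mulVf// scale1r.
  have [Q] : exists Q : set V, Q = [set z | lspan [set` R'] u (P z)] by eexists.
  move=> QE; rewrite -QE in SW Wy Wr.
  suff : Q (b^-1 *: (y - (y - b *: v k))) by rewrite QE.
  by apply: subspaceZ => //; apply: subspaceB.
have wm := wR _ mR; have wk := wR _ kR.
have wout l : l \notin R -> w l \notin R.
  by apply: contraNN => wl; rewrite -[l]wK wR.
have [||||||w' [eps' [u' [hu' wK' fu' du']]]] :=
  IH R' (swap w m k) (update eps m s) u.
- by rewrite -ltnS (leq_trans _ cR)// (cardfsD1 m R) mR add1n ltnS fsubset_leq_card// fsubD1set.
- exact: hu.
- exact: swap_inv.
- move=> l; rewrite inR' => /and3P[lk lm lR].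
  by rewrite /swap (negbTE lm) (negbTE lk) wR.
- move=> l; rewrite inR' !negb_and !negbK.
  have [->|lm] := eqVneq l m.
    move=> _; have [mk|mk] := eqVneq m k.
      by rewrite coef_swap_fixed// /swap eqxx -mk um; apply: ym; apply/eqP.
    rewrite coef_swap_moved ?eqxx//.
    by rewrite /swap eqxx um uk scale1r ydelta.
  have [lk|lk] := eqVneq l k.
    move=> _; rewrite lk in lm *; have mk : m != k by rewrite eq_sym.
    rewrite coef_swap_moved ?eqxx ?orbT// /swap eqxx (negbTE lm) um uk scale1r.
    by rewrite ydelta// (deltaK he).
  rewrite /= => lR; rewrite coef_swap// /swap (negbTE lm) (negbTE lk).
  by rewrite !uout ?wout// hout.
- move=> l lR'; rewrite uR// Pdelta; apply: PR; apply: hin.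
  by move: lR'; rewrite inR' => /and3P[].
by exists w', eps', u'; split=> //; rewrite fu'.
Qed.

End Conjugate.
End Elimination.

Section DualElimination.
Variables (C : numClosedFieldType) (V : lmodType C) (e : nat -> V).
Hypothesis he : is_basis e.
Context {d : Order.disp_t} {A : orderType d}.
Variable sigma : nat -> A.
Hypothesis sI : injective sigma.
Implicit Types (v u : nat -> V) (x y z : V) (R : {fset nat}).
Variable N : bool -> set nat.
Local Notation phi := (phi e N).

Lemma phi_real x : phi x x \is Num.real.
Proof. by apply/CrealP; rewrite phi_conj. Qed.

Lemma phi_normalize x : phi x x != 0 ->
  exists s (a : C), a != 0 /\ phi (a *: x) (a *: x) = signC C s.
Proof.
move=> x0; set t := phi x x in x0.
have [s ts] : exists s, t = signC C s * `|t|.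
  have /orP[t0|t0] := phi_real x.
    by exists true; rewrite ger0_norm// mul1r.
  by exists false; rewrite ler0_norm// mulN1r opprK.
have n0 : 0 < `|t| by rewrite normr_gt0.
exists s, (sqrtC `|t|)^-1; split; first by rewrite invr_eq0 sqrtC_eq0 gt_eqF.
rewrite phiZr// phiZl// geC0_conj ?invr_ge0 ?sqrtC_ge0 ?normr_ge0// mulrA -/t.
rewrite -invfM -expr2 sqrtCK [X in _ * X]ts mulrCA mulVf ?mulr1//.
by rewrite normr_eq0.
Qed.

(** Elimination of the [sigma]-least remaining index [m], by the Gram-Schmidt
process. When [x = v m] is isotropic it is paired with the first remaining [v k]
not orthogonal to it, corrected along [x] so as to become isotropic; the choice
of [k] ensures that the other vectors are corrected along earlier ones only. *)
Lemma dual_elimination n R (w : nat -> nat) eps v : (#|` R| <= n)%N ->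
  e_basis e v -> involutive w -> {in R, forall l, w l = l} ->
  (forall k l, k \notin R ->
     phi (v k) (v l) = if l == w k then coef C w eps k else 0) ->
  exists w' eps' u, [/\ e_basis e u, involutive w', flag sigma u = flag sigma v
    & forall k l, phi (u k) (u l) = if l == w' k then coef C w' eps' k else 0].
Proof.
elim: n R w eps v => [|n IH] R w eps v.
  rewrite leqn0 cardfs_eq0 => /eqP -> hv wK _ hout.
  by exists w, eps, v; split=> // k l; apply: hout; rewrite inE.
move=> cR hv wK wR hout; have vb := proj1 hv.
have [R0|[m0 m0R]] := fset_0Vmem R.
  by apply: (IH R w eps v) => //; rewrite R0 cardfs0.
have [p hp] := proj1 (finite_nat_bound [set` R]) (finite_fset R).
have [m /= mR mmin] := finite_min sigma hp (ex_intro _ m0 m0R).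
have wout l : l \notin R -> w l \notin R.
  by apply: contraNN => wl; rewrite -[ l]wK wR.
have ortho k z : k \notin R -> lspan [set` R] v z -> phi (v k) z = 0.
  move=> kR; move: z; apply: lspan_min => [|l /= lR]; first exact: phi_subspace.
  by rewrite /= hout//; case: eqP => // lE; rewrite lE (negbTE (wout _ kR)) in lR.
have orthol k z : k \notin R -> lspan [set` R] v z -> phi z (v k) = 0.
  by move=> kR hz; rewrite -(phi_conj he) ortho ?rmorph0.
have [s [k [x [y [kR [xspan xm yspan yk] [bmin mk] hform]]]]] :
  exists s k x y,
   [/\ k \in R,
       [/\ lspan [set i | i \in R /\ (sigma i <= sigma m)%O] v x, coord v x m != 0,
           lspan [set i | i \in R /\ (sigma i <= sigma k)%O] v y & coord v y k != 0],
       (m != k -> forall l, l \in R -> (sigma l < sigma k)%O -> phi x (v l) = 0) /\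
       (m = k -> x = y)
     & if m == k then phi x x = signC C s
       else [/\ phi x x = 0, phi y y = 0 & phi x y = 1]].
  have xspan l : l \in R -> lspan [set i | i \in R /\ (sigma i <= sigma l)%O] v (v l).
    by move=> lR; apply: lspan_gen.
  have [t0|t0] := eqVneq (phi (v m) (v m)) 0; last first.
    have [s [a [a0 ha]]] := phi_normalize t0.
    have hs : lspan [set i | i \in R /\ (sigma i <= sigma m)%O] v (a *: v m).
      by apply: subspaceZ; [exact: lspan_subspace|exact: xspan].
    have ac : coord v (a *: v m) m != 0.
      by rewrite (coordZ vb) (coord_basis vb) eqxx mulr1.
    exists s, m, (a *: v m), (a *: v m); rewrite eqxx.
    by split=> //; split=> // _ l lR; rewrite ltNge mmin.
  have [k0 k0R k0m] : exists2 k, k \in R & phi (v m) (v k) != 0.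
    apply: contrapT => nk; have /eqP := basis_neq0 vb m; apply.
    apply: (phi_nondegenerate he) => z; move: z.
    apply: (basis_ind vb) => [|l]; first exact: phi_subspace.
    have [lR|lR] := boolP (l \in R); last by apply: orthol => //; apply: lspan_gen.
    by apply/eqP/negPn/negP => hl; apply: nk; exists l.
  have [] := @finite_min _ _ sigma [set l | l \in R /\ phi (v m) (v l) != 0] p _
    (ex_intro _ k0 (conj k0R k0m)); first by move=> l [/hp].
  move=> k [kR km] kmin.
  have mk : m != k by apply: contraNneq km => <-; rewrite t0.
  have [y0 y0E] : exists y0, y0 = (phi (v m) (v k))^-1 *: v k by eexists.
  have xy0 : phi (v m) y0 = 1 by rewrite y0E phiZr// mulVf.
  pose y := y0 - (phi y0 y0 / 2) *: v m.
  have y0x : phi y0 (v m) = 1 by rewrite -phi_conj// xy0 rmorph1.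
  exists true, k, (v m), y; rewrite (negbTE mk); split=> //.
  - split; [exact: xspan|by rewrite (coord_basis vb) eqxx oner_eq0| |].
      have S := lspan_subspace [set i | i \in R /\ (sigma i <= sigma k)%O] v.
      rewrite /y y0E; apply: subspaceB; [exact: S| |]; apply: subspaceZ; try exact: S.
        exact: xspan.
      by apply: lspan_gen; split=> //; apply: mmin.
    rewrite /y y0E (coordB vb) !(coordZ vb) !(coord_basis vb) eqxx (eq_sym k m) (negbTE mk).
    by rewrite mulr0 subr0 mulr1 invr_eq0.
  - split=> [_ l lR lk|/eqP]; last by rewrite (negbTE mk).
    apply/eqP/negPn/negP => ml.
    by have := kmin l (conj lR ml); rewrite leNgt lk.
  - split=> //; last by rewrite phiBr// phiZr// xy0 t0 mulr0 subr0.
    rewrite phiBr// !phiBl// !phiZr// !phiZl// xy0 y0x t0 !mulr0 subr0 !mulr1.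
    rewrite conj_Creal ?rpredM ?rpredV ?phi_real ?realn//.
    by field.
pose al l := if m == k then signC C s * phi x (v l) else phi y (v l).
pose be l := if m == k then 0 else phi x (v l).
pose u := eliminate R m k x y al be v.
pose R' := (R `\ m `\ k)%fset.
have inR' l : (l \in R') = [&& l != k, l != m & l \in R] by rewrite !inE.
have uR l : l \in R' -> u l = v l - al l *: x - be l *: y.
  rewrite inR' => /and3P[lk lm lR].
  by rewrite /u /eliminate (negbTE lm) (negbTE lk) lR.
have um : u m = x by rewrite /u /eliminate eqxx.
have uk : u k = y.
  by rewrite /u /eliminate eqxx; case: eqP => [km|//]; apply: mk.
have uout l : l \notin R -> u l = v l.
  move=> lR; rewrite /u /eliminate (negbTE lR).
  case: eqVneq => [lm|_]; first by rewrite lm mR in lR.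
  by case: eqVneq => [lk|//]; rewrite lk kR in lR.
have xR : lspan [set` R] v x by apply: lspan_sub xspan => i [].
have yR : lspan [set` R] v y by apply: lspan_sub yspan => i [].
have uspan l : l \in R -> lspan [set` R] v (u l).
  have S := lspan_subspace [set` R] v.
  move=> lR; have [->|lm] := eqVneq l m; first by rewrite um.
  have [->|lk] := eqVneq l k; first by rewrite uk.
  rewrite uR ?inR' ?lk ?lm//.
  apply: subspaceB => //; [apply: subspaceB => //|]; try exact: subspaceZ.
  exact: lspan_gen.
have [hu fu] : e_basis e u /\ flag sigma u = flag sigma v.
  apply: eliminate_flag => //.
  - by apply: lspan_sub xspan => i [].
  - by apply: lspan_sub yspan => i [].
  - by rewrite /be; case: eqVneq => // mk' l lR; apply: bmin.
have rowm l : phi x (u l) = if l == k then coef C (swap w m k) (update eps m s) m else 0.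
  have [lR|lR] := boolP (l \in R); last first.
    rewrite uout// orthol//; case: eqP => // lk; by rewrite lk kR in lR.
  have [mk'|mk'] := eqVneq m k.
    rewrite mk' eqxx in hform; rewrite -mk' coef_swap_fixed//.
    have [->|lm] := eqVneq l m; first by rewrite um.
    rewrite uR ?inR' -?mk' ?lm// phiBr// phiBr// !phiZr// hform /al /be mk' eqxx.
    by rewrite mul0r subr0 mulrAC signC_sqr mul1r subrr.
  rewrite coef_swap_moved ?eqxx//; move: hform; rewrite (negbTE mk') => -[xx yy xy].
  have [->|lk] := eqVneq l k; first by rewrite uk.
  have [->|lm] := eqVneq l m; first by rewrite um.
  rewrite uR ?inR' ?lk ?lm// phiBr// phiBr// !phiZr// xx xy /al /be (negbTE mk').
  by rewrite mulr0 subr0 mulr1 subrr.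
have rowk l : m != k -> phi y (u l) = (l == m)%:R.
  move=> mk'; move: hform; rewrite (negbTE mk') => -[xx yy xy].
  have yx : phi y x = 1 by rewrite -phi_conj// xy rmorph1.
  have [lR|lR] := boolP (l \in R); last first.
    rewrite uout// orthol//; case: eqP => // lm; by rewrite lm mR in lR.
  have [->|lm] := eqVneq l m; first by rewrite um.
  have [->|lk] := eqVneq l k; first by rewrite uk.
  rewrite uR ?inR' ?lk ?lm// phiBr// phiBr// !phiZr// yx yy /al /be (negbTE mk').
  by rewrite mulr0 subr0 mulr1 subrr.
have wm := wR _ mR; have wk := wR _ kR.
have [|||||w' [eps' [u' [hu' wK' fu' du']]]] :=
  IH R' (swap w m k) (update eps m s) u.
- by rewrite -ltnS (leq_trans _ cR)// (cardfsD1 m R) mR add1n ltnS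
    fsubset_leq_card// fsubD1set.
- exact: hu.
- exact: swap_inv.
- move=> l; rewrite inR' => /and3P[lk lm lR].
  by rewrite /swap (negbTE lm) (negbTE lk) wR.
- move=> l j; rewrite inR' !negb_and !negbK.
  have [lm|lm] := eqVneq l m.
    by rewrite lm um rowm /swap eqxx.
  have [lk|lk] := eqVneq l k.
    rewrite lk in lm *; have mk' : m != k by rewrite eq_sym.
    rewrite uk rowk// coef_swap_moved ?eqxx ?orbT// /swap eqxx (negbTE lm) => _.
    by case: eqP.
  rewrite /= => lR; rewrite coef_swap// /swap (negbTE lm) (negbTE lk) uout//.
  have [jR|jR] := boolP (j \in R); last by rewrite uout// hout.
  rewrite (ortho _ _ lR (uspan _ jR)); case: eqP => // jE.
  by rewrite jE (negbTE (wout _ lR)) in jR.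
by exists w', eps', u'; split=> //; rewrite fu'.
Qed.

End DualElimination.

Section AdaptedBases.
Variables (C : numClosedFieldType) (V : lmodType C) (e : nat -> V).
Hypothesis he : is_basis e.
Context {d : Order.disp_t} {A : orderType d}.
Variable sigma : nat -> A.
Hypothesis sI : injective sigma.
Variable N : bool -> set nat.
Implicit Types (v u : nat -> V).

Definition signed_map_of (w : nat -> nat) (eps : nat -> bool) : signed_map :=
  @SignedMap w (fun l _ => eps l).

Lemma scoef_of w eps : scoef C (signed_map_of w eps) =1 coef C w eps.
Proof.
move=> k; rewrite /scoef /coef /=; case: eqP => // wk.
by rewrite (@fix_signE (signed_map_of w eps) k wk).
Qed.

Lemma coef_id (eps : nat -> bool) l : coef C id eps l = signC C (eps l).
Proof. by rewrite /coef eqxx. Qed.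

Lemma Vn_basis v : e_basis e v -> exists n0, forall n, (n0 <= n)%N ->
  (forall l, (n <= l)%N -> v l = e l) /\ Vn e n = lspan [set l | (l < n)%N] v.
Proof.
move=> [vb /almost_eP[n1 hn1]].
have [n2 hn2] : exists n2, forall l i, (l < n1)%N -> (n2 <= i)%N ->
    coord e (v l) i = 0.
  elim: n1 {hn1} => [|m [n2 IH]]; first by exists 0%N.
  have [n3 [hn3 _]] := coord_spec he (v m); exists (maxn n2 n3) => l i.
  rewrite ltnS leq_eqVlt geq_max => /orP[/eqP -> /andP[_ /hn3]//|lm /andP[h _]].
  exact: IH.
exists (maxn n1 n2) => n; rewrite geq_max => /andP[n1n n2n].
have vE l : (n <= l)%N -> v l = e l by move=> nl; apply: hn1; apply: leq_trans nl.
have vV l : (l < n)%N -> Vn e n (v l).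
  move=> ln; apply/(lspanE he) => i /negP; rewrite -leqNgt => ni.
  have [n1l|ln1] := leqP n1 l; last by apply: hn2 => //; apply: leq_trans ni.
  rewrite hn1// (coord_basis he); case: eqP => // il.
  by rewrite -il ltnNge ni in ln.
split=> //; apply/seteqP; split=> x; last first.
  by apply: lspan_min => //; exact: lspan_subspace.
move=> hx; apply/(lspanE vb) => i /negP; rewrite -leqNgt => ni.
have [m [hm xE]] := coord_spec vb x.
have := proj1 (lspanE he _ _) hx i; rewrite /= ltnNge ni => /(_ notF).
have [mi|im] := leqP m i; first by rewrite hm.
rewrite {1}xE (coord_sum he) (bigD1 (Ordinal im))//= (coordZ he) vE//.
rewrite (coord_basis he) eqxx mulr1 big1 ?addr0// => j ji.
rewrite (coordZ he); have [jn|nj] := ltnP j n.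
  rewrite (proj1 (lspanE he _ _) (vV _ jn)) ?mulr0//=.
  by apply/negP; rewrite -leqNgt.
rewrite vE// (coord_basis he) -val_eqE /= in ji *.
by rewrite eq_sym (negbTE ji) mulr0.
Qed.

Lemma Vn_delta n x : Vn e n x -> Vn e n (delta e N x).
Proof.
move=> /(lspanE he) hx; apply/(lspanE he) => i /hx; rewrite (coord_delta he) => ->.
by rewrite mulr0.
Qed.

Lemma exists_conj_basis v : e_basis e v ->
  exists (c : signed_map) u, [/\ involutive c, conjugate_basis e N c u & flag sigma u = flag sigma v].
Proof.
move=> hv; have [n hn] := Vn_basis hv; have [vE VnE] := hn n (leqnn n).
pose R := [fset i in iota 0 n]%fset.
have inR l : (l \in R) = (l < n)%N by rewrite !inE mem_iota.
have RE : [set` R] = [set l | (l < n)%N].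
  by apply/funext => l /=; rewrite inR.
have [||||w [eps [u [hu wK fu du]]]] :=
  @conj_elimination _ _ e he _ _ sigma sI N _ R id (fun l => `[< N true l >]) v
    (leqnn _) hv.
- by [].
- by [].
- move=> l; rewrite inR -leqNgt => nl.
  by rewrite /= vE// (delta_e he) coef_id.
- move=> l; rewrite inR => ln; rewrite RE -VnE; apply: Vn_delta.
  by rewrite VnE; apply: lspan_gen.
exists (signed_map_of w eps), u; split=> //; apply/conj_basisP; split=> // k.
by rewrite scoef_of.
Qed.

Lemma exists_dual_basis v : e_basis e v ->
  exists (c : signed_map) u, [/\ involutive c, dual_basis e N c u & flag sigma u = flag sigma v].
Proof.
move=> hv; have [n hn] := Vn_basis hv; have [vE VnE] := hn n (leqnn n).
pose R := [fset i in iota 0 n]%fset.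
have inR l : (l \in R) = (l < n)%N by rewrite !inE mem_iota.
have [|||w [eps [u [hu wK fu du]]]] :=
  @dual_elimination _ _ e he _ _ sigma sI N _ R id (fun l => `[< N true l >]) v
    (leqnn _) hv.
- by [].
- by [].
- move=> k l; rewrite inR -leqNgt => nk; rewrite (vE k)// (phi_el he) coef_id.
  have [nl|ln] := leqP n l.
    by rewrite vE// (coord_basis he) eq_sym; case: eqP; rewrite ?mulr1 ?mulr0.
  have : Vn e n (v l) by rewrite VnE; apply: lspan_gen.
  move=> /(lspanE he) -> /=; last by apply/negP; rewrite -leqNgt.
  by rewrite mulr0; case: eqP => // lk; rewrite lk ltnNge nk in ln.
exists (signed_map_of w eps), u; split=> //; apply/dual_basisP; split=> // k l.
by rewrite scoef_of.
Qed.

End AdaptedBases.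

(** * Flags of conjugate bases and of dual bases *)

Section Presentations.
Variables (C : numClosedFieldType) (V : lmodType C) (e : nat -> V).
Hypothesis he : is_basis e.
Variable N : bool -> set nat.
Implicit Types (v u : nat -> V) (c : signed_map) (g : {linear V -> V}).

(** Adapted bases coincide with [e] far out, which forces this form on their
signed maps; it makes every count below a count over an initial segment. *)
Definition standard_beyond n c : Prop :=
  forall l, (n <= l)%N -> c l = l /\ fix_sign c l = `[< N true l >].

Lemma standard_beyond_le n m c : (n <= m)%N ->
  standard_beyond n c -> standard_beyond m c.
Proof. by move=> nm h l ml; apply/h/(leq_trans nm). Qed.

Lemma conj_standard c v : conjugate_basis e N c v ->
  exists n, standard_beyond n c.
Proof.
move=> /conj_basisP[[vb /almost_eP[n hn]] dv]; exists n => l nl.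
have H : Phi C N l *: v l = scoef C c l *: v (c l).
  by rewrite -dv hn// (delta_e he).
have cl : c l = l.
  have := congr1 (fun x => coord v x (c l)) H.
  rewrite /= !(coordZ vb) !(coord_basis vb) eqxx mulr1; case: eqP => // _ /esym/eqP.
  by rewrite mulr0 (negbTE (coef_neq0 _ _ _ _)).
split=> //; move: (congr1 (fun x => coord v x l) H).
rewrite cl /= !(coordZ vb) !(coord_basis vb) eqxx !mulr1 /scoef /coef cl eqxx.
by move/signC_inj.
Qed.

Lemma dual_standard c v : dual_basis e N c v -> exists n, standard_beyond n c.
Proof.
move=> /dual_basisP[[vb /almost_eP[n hn]] dv]; exists n => l nl.
have := dv l l; rewrite hn// (phi_ee he) eqxx.
case: eqP => [cl|_ /eqP]; last by rewrite (negbTE (signC_neq0 _ _)).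
by rewrite /scoef /coef -cl eqxx => /signC_inj.
Qed.

Lemma conj_image c v g : groupK e N g -> conjugate_basis e N c v ->
  conjugate_basis e N c (g \o v).
Proof.
move=> [hg gd] /conj_basisP[hv dv]; apply/conj_basisP; split.
  exact: e_basis_image.
by move=> k /=; rewrite gd dv linearZ.
Qed.

Lemma dual_image c v g : groupG0 e N g -> dual_basis e N c v ->
  dual_basis e N c (g \o v).
Proof.
move=> [hg gd] /dual_basisP[hv dv]; apply/dual_basisP; split.
  exact: e_basis_image.
by move=> k l /=; rewrite gd dv.
Qed.

Lemma conj_change c v u g : conjugate_basis e N c v -> conjugate_basis e N c u ->
  groupG e g -> (forall i, g (v i) = u i) -> groupK e N g.
Proof.
move=> /conj_basisP[hv dv] /conj_basisP[hu du] hg gE; split=> // x.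
apply: (@basis_ext _ _ _ (proj1 hv) (deltaL he N \o g) (g \o deltaL he N)) => i.
by rewrite /= gE [LHS]du -gE -linearZ -[in RHS]/(delta e N (v i)) dv.
Qed.

Lemma dual_change c v u g : dual_basis e N c v -> dual_basis e N c u ->
  groupG e g -> (forall i, g (v i) = u i) -> groupG0 e N g.
Proof.
move=> /dual_basisP[hv dv] /dual_basisP[hu du] hg gE; split=> // x y.
have [vb _] := hv; move: x; apply: (basis_ind vb).
  split=> [|a x z /= hx hz]; first by rewrite /= linear0 !phi0l.
  by rewrite /= linearP !phiDl// !phiZl// hx hz.
move=> k /=; move: y; apply: (basis_ind vb).
  split=> [|a x z /= hx hz]; first by rewrite /= linear0 !phi0r.
  by rewrite /= linearP !phiPr// hx hz.
by move=> l /=; rewrite !gE dv du.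
Qed.

Lemma lspan_scale P v (a : nat -> C) : (forall l, a l != 0) ->
  lspan P (fun l => a l *: v l) = lspan P v.
Proof.
move=> a0; apply/seteqP; split; apply: lspan_le => i Pi.
  by apply: subspaceZ; [exact: lspan_subspace|exact: lspan_gen].
rewrite -[v i]scale1r -(mulVf (a0 i)) -scalerA.
apply: subspaceZ; first exact: lspan_subspace.
exact: (@lspan_gen _ _ _ (fun l => a l *: v l)).
Qed.

Lemma lspanI P Q v : is_basis v ->
  lspan P v `&` lspan Q v = lspan (P `&` Q) v.
Proof.
move=> vb; apply/seteqP; split=> x; last first.
  by move=> hx; split; move: x hx; apply: lspan_sub => i [].
move=> [/(lspanE vb) hP /(lspanE vb) hQ]; apply/(lspanE vb) => i /not_andP[].
  exact: hP.
exact: hQ.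
Qed.

(** [v (c l)] is the only vector of [v] not orthogonal to [v l]. *)
Lemma dagger_lspan c v P : involutive c -> dual_basis e N c v ->
  dagger e N (lspan P v) = lspan [set i | ~ P (c i)] v.
Proof.
move=> cK /dual_basisP[[vb _] dv]; apply/seteqP; split=> x.
  move=> hx; apply/(lspanE vb) => i /contrapT Pi.
  have /eqP := hx _ (lspan_gen v Pi).
  rewrite -phi_conj// conjC_eq0 (phi_dual_eq0 he vb dv) cK.
  by move/eqP.
move=> /(lspanE vb) hx; apply: lspan_min => [|l Pl]; first exact: phi_subspace.
apply/eqP; rewrite /= -phi_conj// conjC_eq0 (phi_dual_eq0 he vb dv).
by rewrite hx//= cK; apply.
Qed.

Section FlagConditions.
Context {d : Order.disp_t} {A : orderType d}.
Variable sigma : nat -> A.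

Lemma conj_position c v n : involutive c -> standard_beyond n c ->
  conjugate_basis e N c v ->
  pair_orbit e sigma sigma c (act (delta e N) (flag sigma v), flag sigma v).
Proof.
move=> cK cn /conj_basisP[hv dv]; apply/(pair_orbitP he); exists (v \o c).
have [_ _ <-] := flag_comp sigma (v \o c) cK.
have -> : (v \o c) \o c = v by apply/funext => i /=; rewrite cK.
split=> //; first by apply: (e_basis_comp (inv_bij cK) (n := n)) => // l /cn[].
rewrite (act_flag sigma v (deltaL he N)).
have -> : deltaL he N \o v = fun l => scoef C c l *: (v \o c) l.
  by apply/funext => l; exact: dv.
by apply: eq_flag; apply/funext => b; apply: lspan_scale => l; apply: coef_neq0.
Qed.

Lemma dual_position c v n : involutive c -> standard_beyond n c ->
  dual_basis e N c v ->
  pair_orbit e (reversed sigma) sigma c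
    (dagger_flag e N (flag sigma v), flag sigma v).
Proof.
move=> cK cn hv; have [vE _] := hv.
apply/(pair_orbitP he); exists (v \o c).
have [_ _ <-] := flag_comp sigma (v \o c) cK.
have -> : (v \o c) \o c = v by apply/funext => i /=; rewrite cK.
split=> //; first by apply: (e_basis_comp (inv_bij cK) (n := n)) => // l /cn[].
have lt_le b : dagger e N (flag_lt sigma v b) = flag_le (reversed sigma) (v \o c) b.
  rewrite (dagger_lspan _ cK hv) /flag_le lspan_comp//; congr lspan.
  by apply/funext => i /=; apply/propext; rewrite leNgt; split=> /negP.
have le_lt b : dagger e N (flag_le sigma v b) = flag_lt (reversed sigma) (v \o c) b.
  rewrite (dagger_lspan _ cK hv) /flag_lt lspan_comp//; congr lspan.
  by apply/funext => i /=; apply/propext; rewrite ltNge; split=> /negP.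
apply/seteqP; split=> [_ [U [b [->|->]] <-]|_ [b [->|->]]].
- by exists b; right.
- by exists b; left.
- by exists (flag_le sigma v b) => //; exists b; right.
- by exists (flag_lt sigma v b) => //; exists b; left.
Qed.

Lemma quotient_dim0 (U W : set V) : quotient_dim U W 0 -> U `<=` W.
Proof.
move=> [u [_ _ h]] x /h[a]; by rewrite big_ord0 subr0.
Qed.

Lemma quotient_dim1 (U W : set V) : quotient_dim U W 1 -> exists2 x, U x & ~ W x.
Proof.
move=> [u [hU hW _]]; exists (u ord0) => // h.
have := hW (fun=> 1); rewrite big_ord1 scale1r => /(_ h ord0) /eqP.
by rewrite oner_eq0.
Qed.

Lemma quotient_dim_eq (U W : set V) : subspace W -> U `<=` W -> quotient_dim U W 0.
Proof.
move=> hW UW; exists (fun=> 0); split=> [[]//|a _ []//|x Ux].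
by exists (fun=> 0); rewrite big_ord0 subr0; apply: UW.
Qed.

Lemma quotient_dim_bool (U W : set V) (b b' : bool) : quotient_dim U W b ->
  quotient_dim U W b' -> b = b'.
Proof.
case: b b' => [] [] //.
  by move=> /quotient_dim1[x Ux Wx] /quotient_dim0 h; case: Wx; apply: h.
by move=> /quotient_dim0 h /quotient_dim1[x Ux Wx]; case: Wx; apply: h.
Qed.

Hypothesis sI : injective sigma.
Hypothesis hN : sign_partition N.

Lemma Vsign_subspace s : subspace (Vsign e N s).
Proof. exact: lspan_subspace. Qed.

Lemma flag_step v l x : is_basis v -> flag_le sigma v (sigma l) x ->
  coord v x l = 0 -> flag_lt sigma v (sigma l) x.
Proof.
move=> vb /(lspanE vb) hx x0; apply/(lspanE vb) => i /negP; rewrite -leNgt.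
rewrite le_eqVlt => /orP[/eqP/sI <- //|li]; apply: hx => /=; apply/negP.
by rewrite -ltNge.
Qed.

(** The quotient has dimension at most one, and the coordinate of [x] on [v l]
vanishes on the intersection unless some vector of the flag at [l] with leading
term [v l] is an eigenvector of sign [s]: up to signs, the coordinates of
[delta x] are those of [x] permuted by [c]. *)
Lemma conj_dim c v l s : involutive c -> conjugate_basis e N c v ->
  quotient_dim (flag_le sigma v (sigma l) `&` Vsign e N s)
    (flag_lt sigma v (sigma l) `&` Vsign e N s)
    (if `[< (sigma (c l) < sigma l)%O \/ fixed_with c s l >] then 1%N else 0%N).
Proof.
move=> cK /conj_basisP[[vb _] dv].
have Slt := subspaceI (lspan_subspace [set m | (sigma m < sigma l)%O] v)
  (Vsign_subspace s).
have dcoord x k : coord v (delta e N x) (c k) = scoef C c k * coord v x k.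
  move: x; apply: (basis_ind vb).
    split=> [|a x y /= hx hy]; first by rewrite /= (delta0 he) !(coord0 vb) mulr0.
    by rewrite /= (deltaP he) !(coordP vb) hx hy mulrDr mulrCA.
  move=> i /=; rewrite dv (coordZ vb) !(coord_basis vb) (can_eq cK).
  by case: eqVneq => [->|]; rewrite ?mulr0.
case: asboolP => cond; last first.
  apply: quotient_dim_eq => // x [hx /(VsignP he _ _ hN) dx]; split; last first.
    exact/(VsignP he _ _ hN).
  apply: flag_step => //; have := dcoord x l; rewrite dx (coordZ vb) => H.
  have [cl|cl] := eqVneq (c l) l.
    move: H; rewrite cl /scoef /coef cl eqxx => /eqP; rewrite -subr_eq0 -mulrBl.
    rewrite mulf_eq0 => /orP[|/eqP//]; rewrite subr_eq0 => /eqP/signC_inj sE.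
    by case: cond; right; apply/fixed_withP.
  apply/eqP; have /eqP := H; rewrite (_ : coord v x (c l) = 0).
    by rewrite mulr0 eq_sym mulf_eq0 (negbTE (coef_neq0 _ _ _ _)).
  apply: (proj1 (lspanE vb _ _) hx) => /= lecl; apply: cond; left.
  by rewrite lt_neqAle lecl andbT (inj_eq sI).
have [x [hx dx xl]] : exists x, [/\ flag_le sigma v (sigma l) x,
    delta e N x = signC C s *: x & coord v x l = 1].
  have hl : flag_le sigma v (sigma l) (v l) by apply: lspan_gen => /=.
  case: cond => [cl|/fixed_withP[cl sE]].
    have ncl : (c l == l) = false by apply: contraTF cl => /eqP ->; rewrite ltxx.
    exists (v l + signC C s *: v (c l)); split.
    - apply: subspaceD => //; first exact: lspan_subspace.
      apply: subspaceZ; first exact: lspan_subspace.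
      by apply: lspan_gen => /=; apply: ltW.
    - rewrite (deltaD he) (deltaZ he) !dv cK /scoef coef_inv// /coef ncl !scale1r.
      by rewrite scalerDr scalerA signC_sqr scale1r addrC.
    - by rewrite (coordD vb) (coordZ vb) !(coord_basis vb) eqxx eq_sym ncl mulr0 addr0.
  exists (v l); split=> //; last by rewrite (coord_basis vb) eqxx.
  by rewrite dv /scoef /coef cl eqxx sE.
have nlt : forall y, flag_lt sigma v (sigma l) y -> coord v y l = 0.
  by move=> y /(lspanE vb); apply=> /=; rewrite ltxx.
exists (fun=> x); split.
- by move=> _; split=> //; apply/(VsignP he _ _ hN).
- move=> a; rewrite big_ord1 => -[/nlt h _] i; move: h.
  by rewrite (coordZ vb) xl mulr1 (ord1 i).
- move=> y [hy /(VsignP he _ _ hN) dy]; exists (fun=> coord v y l).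
  rewrite big_ord1; split; last first.
    apply: subspaceB; first exact: Vsign_subspace.
      exact/(VsignP he _ _ hN).
    by apply: subspaceZ; [exact: Vsign_subspace|exact/(VsignP he _ _ hN)].
  apply: flag_step => //; last by rewrite (coordB vb) (coordZ vb) xl mulr1 subrr.
  apply: subspaceB => //; first exact: lspan_subspace.
  by apply: subspaceZ => //; exact: lspan_subspace.
Qed.

End FlagConditions.

(** Equality of the two records would require transporting the signs along [c =1 c'];
but the signed map enters the definitions only through its values. *)
Lemma eq_conj_basis c c' v : c =1 c' -> (forall l, c l = l -> fix_sign c l = fix_sign c' l) ->
  conjugate_basis e N c v -> conjugate_basis e N c' v.
Proof.
move=> cc sE /conj_basisP[hv dv]; apply/conj_basisP; split=> // k.
by rewrite dv /scoef /coef -cc; case: eqP => // /sE ->.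
Qed.

Lemma eq_dual_basis c c' v : c =1 c' -> (forall l, c l = l -> fix_sign c l = fix_sign c' l) ->
  dual_basis e N c v -> dual_basis e N c' v.
Proof.
move=> cc sE /dual_basisP[hv dv]; apply/dual_basisP; split=> // k l.
by rewrite dv /scoef /coef -cc; case: (c k =P k) => // /sE ->.
Qed.

End Presentations.

(** * Signatures *)

Lemma linear_dependence (C : fieldType) (I J : finType) (f : I -> J -> C) :
  (#|J| < #|I|)%N ->
  exists a : I -> C, (exists i, a i != 0) /\ forall j, \sum_i a i * f i j = 0.
Proof.
move=> IJ; pose M : 'M[C]_(#|I|, #|J|) := \matrix_(i, j) f (enum_val i) (enum_val j).
have kM : kermx M != 0.
  by rewrite kermx_eq0 /row_free neq_ltn (leq_ltn_trans (rank_leq_col M)).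
have [i0 hi0] : exists i, row i (kermx M) != 0.
  apply: contrapT => nk; move/eqP: kM; apply; apply/row_matrixP => i.
  by rewrite row0; apply/eqP/negPn/negP => hi; apply: nk; exists i.
have KM : row i0 (kermx M) *m M = 0 by apply/sub_kermxP/row_sub.
move: (row i0 _) hi0 KM => K K0 KM.
have [j0 hj0] : exists j, K 0 j != 0.
  apply: contrapT => nk; move/eqP: K0; apply; apply/rowP => j.
  by rewrite [RHS]mxE; apply/eqP/negPn/negP => hj; apply: nk; exists j.
exists (fun i => K 0 (enum_rank i)); split.
  by exists (enum_val j0); rewrite enum_valK.
move=> j; have /matrixP/(_ 0 (enum_rank j)) := KM.
rewrite !mxE => H; rewrite -[RHS]H (reindex _ (onW_bij _ (enum_val_bij I))).
by apply: eq_bigr => i _; rewrite mxE enum_rankK enum_valK.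
Qed.

Section Signature.
Variables (C : numClosedFieldType) (V : lmodType C) (e : nat -> V).
Hypothesis he : is_basis e.
Variable N : bool -> set nat.
Local Notation phi := (phi e N).
Implicit Types (F : set V) (v : nat -> V).

Definition radical F : set V := F `&` dagger e N F.

Definition orthonormal (I : finType) (u : I -> V) (sg : I -> bool) : Prop :=
  forall i j, phi (u i) (u j) = if i == j then signC C (sg i) else 0.

(** [signature] with an arbitrary index type, so that the two signs can be
treated alike. *)
Definition diag_basis (I : finType) F (u : I -> V) (sg : I -> bool) : Prop :=
  quotient_basis F (radical F) u /\ orthonormal u sg.

Lemma orthonormal_phi (I : finType) (u : I -> V) sg (a : I -> C) i :
  orthonormal u sg -> phi (u i) (\sum_j a j *: u j) = a i * signC C (sg i).
Proof.
move=> h; rewrite phi_sumr// (bigD1 i)//= phiZr// h eqxx big1 ?addr0// => j ji.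
by rewrite phiZr// h eq_sym (negbTE ji) mulr0.
Qed.

Lemma orthonormal_norm (I : finType) (u : I -> V) sg (a : I -> C) :
  orthonormal u sg ->
  phi (\sum_i a i *: u i) (\sum_i a i *: u i) = \sum_i `|a i| ^+ 2 * signC C (sg i).
Proof.
move=> h; rewrite phi_suml//; apply: eq_bigr => i _.
by rewrite phiZl// (orthonormal_phi _ _ h) mulrA (mulrC _ (a i)) normCK.
Qed.

Lemma radical_subspace F : subspace F -> subspace (radical F).
Proof. by move=> hF; apply: subspaceI => //; exact: dagger_subspace. Qed.

(** Sylvester's law of inertia. If [u] had more vectors of sign [s] than [u'],
some nonzero combination of them would be congruent modulo the radical to a
combination of the vectors of [u'] of the opposite sign. *)
Lemma inertia_le F (I J : finType) (u : I -> V) (u' : J -> V) sg sg' s :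
  subspace F -> diag_basis F u sg -> diag_basis F u' sg' ->
  (#|[pred i | sg i == s]| <= #|[pred j | sg' j == s]|)%N.
Proof.
move=> hF [[uF uind uspan] uo] [[uF' uind' uspan'] uo'].
rewrite leqNgt -(card_sig (fun i => sg i == s)) -(card_sig (fun j => sg' j == s)).
apply/negP => IJ.
have /choice[a ha] : forall i, exists a : J -> C,
    radical F (u i - \sum_j a j *: u' j).
  by move=> i; apply: uspan'.
have [b [[i0 bi0] hb]] := linear_dependence
  (fun (i : {i | sg i == s}) (j : {j | sg' j == s}) => a (val i) (val j)) IJ.
pose x := \sum_(i : {i | sg i == s}) b i *: u (val i).
pose g j := \sum_(i : {i | sg i == s}) b i * a (val i) j.
pose y := \sum_j g j *: u' j.
have g0 j : sg' j = s -> g j = 0.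
  by move=> /eqP js; have := hb (exist _ j js).
have Srad := radical_subspace hF.
have rad : radical F (x - y).
  have -> : x - y = \sum_(i : {i | sg i == s}) b i *: (u (val i) - \sum_j a (val i) j *: u' j).
    under [RHS]eq_bigr do rewrite scalerBr.
    rewrite sumrB; congr (_ - _).
    under [RHS]eq_bigr do rewrite scaler_sumr.
    rewrite exchange_big /y; apply: eq_bigr => j _.
    by rewrite /g scaler_suml; apply: eq_bigr => i _; rewrite scalerA.
  apply: subspace_sum => // i _; exact: subspaceZ.
have yF : F y by apply: subspace_sum => // j _; exact: subspaceZ.
have xF : F x by apply: subspace_sum => // i _; exact: subspaceZ.
have xy : phi x x = phi y y.
  have h1 : phi (x - y) x = 0 by apply: (proj2 rad).
  have h2 : phi (x - y) y = 0 by apply: (proj2 rad).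
  move: h1 h2; rewrite !phiBl// => /eqP; rewrite subr_eq0 => /eqP -> /eqP.
  by rewrite subr_eq0 => /eqP h2; rewrite -[LHS]phi_conj// h2 phi_conj.
have xx : phi x x = signC C s * \sum_(i : {i | sg i == s}) `|b i| ^+ 2.
  have uo0 : orthonormal (fun i : {i | sg i == s} => u (val i)) (fun=> s).
    by move=> i j; rewrite uo (eqP (valP i)).
  by rewrite /x (orthonormal_norm _ uo0) -mulr_suml mulrC.
have yy : phi y y = - (signC C s * \sum_j `|g j| ^+ 2).
  rewrite /y (orthonormal_norm _ uo') mulr_sumr -sumrN; apply: eq_bigr => j _.
  have [/g0 ->|js] := eqVneq (sg' j) s; first by rewrite normr0 expr0n /= mulr0 mul0r oppr0.
  have -> : sg' j = ~~ s by move: js; clear; case: (sg' j); case: s.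
  by rewrite signC_negb mulrN mulrC.
have /eqP : signC C s * (\sum_(i : {i | sg i == s}) `|b i| ^+ 2 + \sum_j `|g j| ^+ 2) = 0.
  by rewrite mulrDr -xx xy yy addNr.
rewrite mulf_eq0 (negbTE (signC_neq0 _ _)) /= paddr_eq0; last 2 first.
- by apply: sumr_ge0 => i _; apply: exprn_ge0.
- by apply: sumr_ge0 => i _; apply: exprn_ge0.
move=> /andP[]; rewrite psumr_eq0 => [/allP/(_ i0)|i _]; last exact: exprn_ge0.
by rewrite mem_index_enum => /(_ isT); rewrite expf_eq0 normr_eq0 (negbTE bi0).
Qed.

Lemma inertia F (I J : finType) (u : I -> V) (u' : J -> V) sg sg' s :
  subspace F -> diag_basis F u sg -> diag_basis F u' sg' ->
  #|[pred i | sg i == s]| = #|[pred j | sg' j == s]|.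
Proof.
by move=> hF h h'; apply/eqP; rewrite eqn_leq (inertia_le s hF h h') (inertia_le s hF h' h).
Qed.

Lemma diag_basis_reindex F (I J : finType) (f : J -> I) (u : I -> V) sg :
  bijective f -> diag_basis F u sg -> diag_basis F (u \o f) (sg \o f).
Proof.
move=> fb [[uF uind uspan] uo].
have fI := bij_inj fb; have fon := onW_bij xpredT fb; have [f' fK f'K] := fb.
have sumE (a : J -> C) : \sum_j a j *: u (f j) = \sum_i a (f' i) *: u i.
  by rewrite [RHS](reindex f fon); apply: eq_bigr => j _; rewrite fK.
split; last by move=> i j /=; rewrite uo (inj_eq fI).
split=> [j|a /=|x /uspan[a ha]].
- exact: uF.
- by rewrite sumE => /uind h j; rewrite -[j]fK h.
- exists (a \o f); rewrite /= sumE; congr (radical F (x - _)) : ha.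
  by apply: eq_bigr => i _ /=; rewrite f'K.
Qed.

Lemma signature_diag F (pq : nat * nat) : signature e N F pq <->
  exists u : 'I_pq.1 + 'I_pq.2 -> V, diag_basis F u (fun i => if i is inl _ then true else false).
Proof. by []. Qed.

Lemma card_inl p q s : #|[pred i : 'I_p + 'I_q |
  (if i is inl _ then true else false) == s]| = if s then p else q.
Proof.
rewrite -sum1_card big_sumType /=; case: s => /=.
  by rewrite sum1_card card_ord big_pred0 ?addn0.
by rewrite big_pred0 ?add0n// sum1_card card_ord.
Qed.

Lemma signature_unique F p q (I : finType) (u : I -> V) sg : subspace F ->
  diag_basis F u sg -> signature e N F (p, q) ->
  p = #|[pred i | sg i == true]| /\ q = #|[pred i | sg i == false]|.
Proof.
move=> hF hu /signature_diag[u' hu'].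
by rewrite (inertia true hF hu hu') (inertia false hF hu hu') !card_inl.
Qed.

Lemma signature_exists F (I : finType) (u : I -> V) sg : diag_basis F u sg ->
  signature e N F (#|[pred i | sg i == true]|, #|[pred i | sg i == false]|).
Proof.
move=> hu; apply/signature_diag => /=.
pose f (i : 'I_#|[pred i | sg i == true]| + 'I_#|[pred i | sg i == false]|) : I :=
  match i with inl i => enum_val i | inr i => enum_val i end.
have sf i : sg (f i) = if i is inl _ then true else false.
  by case: i => i /=; have := enum_valP i; rewrite inE => /eqP.
have fI : injective f.
  move=> i j fij; have := sf i; rewrite fij sf.
  by case: i j fij => i [] j //= /enum_val_inj ->.
have fb : bijective f.
  apply: inj_card_bij => //; rewrite card_sum !card_ord -(cardC [pred i | sg i == true]).
  by rewrite leq_add2l; apply/eq_leq/eq_card => i; rewrite !inE; case: (sg i).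
exists (u \o f); have := diag_basis_reindex fb hu.
by have -> : sg \o f = (fun i => if i is inl _ then true else false) by apply/funext.
Qed.

End Signature.

(** * Counting colors *)

Section Counting.

Lemma card_ord_count n (p : nat -> bool) :
  #|[pred i : 'I_n | p i]| = count p (iota 0 n).
Proof. by rewrite cardE /enum_mem size_filter -val_enum_ord count_map enumT. Qed.

Lemma card_sig_pred (T : finType) (P Q : pred T) :
  #|[pred i : {x | P x} | Q (val i)]| = #|[pred x | P x && Q x]|.
Proof.
rewrite -(fintype.card_image val_inj); apply: eq_card => x; rewrite !inE.
apply/fintype.imageP/andP => [[y /= Qy ->]|[Px Qx]]; first by split=> //; exact: (valP y).
by exists (exist _ x Px).
Qed.

Lemma count_add1 (p q : nat -> bool) (b : bool) x n : (x < n)%N -> ~~ p x ->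
  (forall i, q i = p i || (b && (i == x))) ->
  count q (iota 0 n) = (count p (iota 0 n) + b)%N.
Proof.
move=> xn px qE; rewrite (eq_count qE); have := count_predUI p (fun i => b && (i == x)) (iota 0 n).
rewrite [X in (_ + X)%N = _](_ : _ = 0%N) => [|]; last first.
  by apply/eqP; rewrite -leqn0 leqNgt -has_count; apply/hasPn => i _ /=;
    rewrite andbA negb_and; case: eqVneq => [->|]; rewrite ?orbT ?andbF//=; rewrite negb_and px.
rewrite addn0 => ->; congr (_ + _)%N; case: b {qE} => /=; last by rewrite count_pred0.
by rewrite count_uniq_mem ?iota_uniq// mem_iota xn.
Qed.

Lemma count_involution (p : nat -> bool) (c : nat -> nat) n : involutive c ->
  (forall l, (n <= l)%N -> c l = l) ->
  count (p \o c) (iota 0 n) = count p (iota 0 n).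
Proof.
move=> cK cn; rewrite -count_map; apply/permP/uniq_perm.
- by rewrite map_inj_uniq ?iota_uniq//; exact: inv_inj.
- exact: iota_uniq.
move=> l; rewrite mem_iota /= add0n; have lt k : (k < n)%N -> (c k < n)%N.
  by move=> kn; rewrite ltnNge; apply/negP => ck; move: kn; rewrite -[k]cK cn// ltnNge ck.
apply/mapP/idP => [[k]|ln]; first by rewrite mem_iota add0n => /andP[_ /lt kn] ->.
by exists (c l); rewrite ?cK// mem_iota add0n lt.
Qed.

Lemma card_fset_count (P : set nat) n : (forall l, P l -> (l < n)%N) ->
  #|` fset_set P| = count (fun l => `[< P l >]) (iota 0 n).
Proof.
move=> hP; have fP : finite_set P by apply/finite_nat_bound; exists n.
rewrite -size_filter; apply/perm_size/uniq_perm.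
- exact: fset_uniq.
- exact/filter_uniq/iota_uniq.
move=> l; rewrite in_fset_set// mem_filter mem_iota /= add0n; apply/idP/andP.
  by move=> /set_mem Pl; split; [apply/asboolP|apply: hP].
by move=> [/asboolP Pl _]; apply: mem_set.
Qed.

End Counting.

Section Colors.
Implicit Types (c : signed_map).

(** The signs of the fixed points, extended by a choice of sign for each element
of the two-point orbits: such an orbit contributes one eigenvector of each sign,
and one vector of each sign to an orthogonal basis. *)
Definition color c (l : nat) : bool :=
  if c l == l then fix_sign c l else (l < c l)%N.

Lemma color_inv c l : involutive c -> c l != l -> color c (c l) = ~~ color c l.
Proof.
move=> cK cl; rewrite /color cK (eq_sym l) (negbTE cl) -leqNgt [RHS]leq_eqVlt.
by rewrite (negbTE cl).
Qed.

Lemma color_standard N n c l : standard_beyond N n c -> (n <= l)%N ->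
  color c l = `[< N true l >].
Proof. by move=> h /h[cl <-]; rewrite /color cl eqxx. Qed.

(** Each two-point orbit of [c] has one element of each color, so that half the
number of moved points is the number of moved points of color [s]. After the
points of sign [s] fixed with sign [s] are cancelled, the cardinality condition
for [s] equates the number of points of sign [s] with that of points of
color [s]. *)
Lemma signed_involutions_count N n c : sign_partition N -> involutive c ->
  standard_beyond N n c ->
  signed_involutions N c <->
    count (color c) (iota 0 n) = count (fun l => `[< N true l >]) (iota 0 n).
Proof.
move=> hN cK cn; pose t l := `[< N true l >]; pose f l := c l == l.
pose r := iota 0 n.
have cn' l : (n <= l)%N -> c l = l by move=> /cn[].
have NP s l := @sign_partitionP N s l hN.
have bA s l : (N s `\` [set l | N s l /\ fixed_with c s l]) l -> (l < n)%N.
  move=> [/NP Nl nf]; rewrite ltnNge; apply/negP => /cn[cl fl]; apply: nf.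
  by split; [exact/NP|apply/fixed_withP; rewrite fl].
have bB s l : [set l | N (~~ s) l /\ fixed_with c s l] l -> (l < n)%N.
  move=> [/NP Nl /fixed_withP[_ fs]]; rewrite ltnNge; apply/negP => /cn[_].
  by rewrite fs Nl; case: (s).
have bM l : [set l | c l <> l] l -> (l < n)%N.
  by rewrite /= => cl; rewrite ltnNge; apply/negP => /cn'.
have cA s : count (fun l => `[< (N s `\` [set l | N s l /\ fixed_with c s l]) l >]) r =
    count (fun l => (t l == s) && ~~ (f l && (fix_sign c l == s))) r.
  apply: eq_count => l; apply/asboolP/andP => [[/NP Nl nf]|[/eqP Nl nf]].
    split; first exact/eqP.
    apply/negP => /andP[/eqP cl /eqP fs]; apply: nf; split; first exact/NP.
    exact/fixed_withP.
  split; first exact/NP; move=> [_ /fixed_withP[cl fs]]; move/negP: nf; apply.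
  by rewrite /f cl fs !eqxx.
have cB s : count (fun l => `[< [set l | N (~~ s) l /\ fixed_with c s l] l >]) r =
    count (fun l => (t l != s) && (f l && (fix_sign c l == s))) r.
  apply: eq_count => l; apply/asboolP/andP => [[/NP Nl /fixed_withP[cl fs]]|].
    by rewrite /t Nl /f cl fs !eqxx; case: (s).
  move=> [tl /andP[/eqP cl /eqP fs]]; split; last exact/fixed_withP.
  by apply/NP; move: tl; rewrite /t; clear; case: `[< _ >]; case: s.
have cM : count (fun l => `[< [set l | c l <> l] l >]) r = count (fun l => ~~ f l) r.
  by apply: eq_count => l; apply/asboolP/negP => /= h; [move/eqP/h|move=> cl; apply: h; apply/eqP].
pose H s := count (fun l => ~~ f l && ((l < c l)%N == s)) r.
have HE : H false = H true.
  rewrite /H -(count_involution _ cK cn'); apply: eq_count => l /=.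
  rewrite /f cK eq_sym; case: eqVneq => //= cl.
  by rewrite eqb_id eqbF_neg -leqNgt leq_eqVlt eq_sym (negbTE cl).
have HM : (count (fun l => ~~ f l) r = H true + H false)%N.
  rewrite /H -count_predUI [X in (_ + X)%N](_ : _ = 0%N) ?addn0.
    by apply: eq_count => l /=; case: (f l) => //=; case: ltnP.
  apply/eqP; rewrite -leqn0 leqNgt -has_count; apply/hasPn => l _ /=.
  by case: (f l) => //=; case: ltnP.
have split2 (p p1 p2 : pred nat) : (forall l, p l = p1 l (+) p2 l) ->
    (forall l, ~~ (p1 l && p2 l)) -> (count p r = count p1 r + count p2 r)%N.
  move=> h1 h2; rewrite -count_predUI [X in (_ + X)%N](_ : _ = 0%N) ?addn0.
    by apply: eq_count => l /=; rewrite h1; have := h2 l; case: (p1 l) (p2 l) => [] [].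
  by apply/eqP; rewrite -leqn0 leqNgt -has_count; apply/hasPn => l _; exact: h2.
pose a s := count (fun l => (t l == s) && ~~ (f l && (fix_sign c l == s))) r.
pose b s := count (fun l => (t l != s) && (f l && (fix_sign c l == s))) r.
pose g s := count (fun l => (t l == s) && (f l && (fix_sign c l == s))) r.
pose F s := count (fun l => f l && (fix_sign c l == s)) r.
have TE s : (count (fun l => t l == s) r = a s + g s)%N.
  by apply: split2 => l; case: (t l == s); case: (f l && _).
have FE s : (F s = b s + g s)%N.
  by apply: split2 => l; case: (t l == s); case: (f l && _).
have CE s : (count (fun l => color c l == s) r = F s + H s)%N.
  by apply: split2 => l; rewrite /color /f; case: (c l == l); rewrite ?addbF ?andbF.
have T1 : (count t r + count (fun l => t l == false) r = size r)%N.
  rewrite -(count_predC t); congr (_ + _)%N; apply: eq_count => l /=; by case: (t l).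
have C1 : (count (color c) r + count (fun l => color c l == false) r = size r)%N.
  rewrite -(count_predC (color c)); congr (_ + _)%N; apply: eq_count => l /=.
  by case: (color c l).
have T2 : count t r = count (fun l => t l == true) r.
  by apply: eq_count => l; rewrite eqb_id.
have C2 : count (color c) r = count (fun l => color c l == true) r.
  by apply: eq_count => l; rewrite eqb_id.
have key : (forall s, (a s).*2 = (b s).*2 + count (fun l => ~~ f l) r)%N <->
    count (color c) r = count t r.
  have := TE true; have := TE false; have := FE true; have := FE false.
  have := CE true; have := CE false.
  move=> h1 h2 h3 h4 h5 h6; split=> [h|h [|]]; [have := h true; lia|lia|lia].
split=> [[_ h]|h].
  apply/key => s; have [_ _ _] := h s.
  rewrite (card_fset_count (bA s)) (card_fset_count (bB s)) (card_fset_count bM).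
  by rewrite -/r cA cB cM.
split=> // s /=.
rewrite (card_fset_count (bA s)) (card_fset_count (bB s)) (card_fset_count bM).
rewrite -/r cA cB cM; split; [| | |exact: (proj2 key h s)].
- by apply/finite_nat_bound; exists n; exact: bA.
- by apply/finite_nat_bound; exists n; exact: bB.
- by apply/finite_nat_bound; exists n; exact: bM.
Qed.

Lemma signed_involutions_standard N c : sign_partition N ->
  signed_involutions N c -> exists n, standard_beyond N n c.
Proof.
move=> hN [cK h]; have [At _ M _] := h true; have [Af _ _ _] := h false.
have [n1 h1] := proj1 (finite_nat_bound _) At.
have [n2 h2] := proj1 (finite_nat_bound _) Af.
have [n3 h3] := proj1 (finite_nat_bound _) M.
exists (maxn n1 (maxn n2 n3)) => l; rewrite !geq_max => /and3P[l1 l2 l3].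
have cl : c l = l by apply: contrapT => /h3; rewrite ltnNge l3.
split=> //; have Nl : N `[< N true l >] l by apply/sign_partitionP.
case: `[< _ >] Nl => Nl.
  apply: contrapT => fl; have : (l < n1)%N; last by rewrite ltnNge l1.
  by apply: h1; split=> // -[_ /fixed_withP[_ //]].
apply: contrapT => fl; have : (l < n2)%N; last by rewrite ltnNge l2.
by apply: h2; split=> // -[_ /fixed_withP[_ //]].
Qed.

End Colors.

(** * Diagonalization of adapted bases *)

Section Colored.
Variables (C : numClosedFieldType) (V : lmodType C) (e : nat -> V).
Hypothesis he : is_basis e.
Variable N : bool -> set nat.
Local Notation phi := (phi e N).
Implicit Types (v u : nat -> V) (c : signed_map).

Definition half : C := (sqrtC 2)^-1.

Lemma half_conj : half^* = half.
Proof. by rewrite geC0_conj// invr_ge0 sqrtC_ge0 ler0n. Qed.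

Lemma half_sqr : half * half * 2 = 1.
Proof. by rewrite -invfM -expr2 sqrtCK mulVf// pnatr_eq0. Qed.

Lemma half_neq0 : half != 0.
Proof. by rewrite invr_eq0 sqrtC_eq0 pnatr_eq0. Qed.

Lemma scale_swap (a b : C) (x : V) : a *: (b *: x) = b *: (a *: x).
Proof. by rewrite !scalerA mulrC. Qed.

(** Orthonormalization of the hyperbolic planes spanned by [v l] and [v (c l)];
for a conjugate basis this diagonalizes [delta]. *)
Definition eigenvec c v l : V :=
  if c l == l then v l else half *: (v l + signC C (color c l) *: v (c l)).

(** Inverse to [eigenvec]: it makes a conjugate basis out of eigenvectors of
[delta]. *)
Definition pairvec c v l : V :=
  if c l == l then v l else half *: (v l - signC C (color c l) *: v (c l)).

Lemma pairvecK c v l : involutive c -> pairvec c (eigenvec c v) l = v l.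
Proof.
move=> cK; rewrite /pairvec /eigenvec cK; case: eqVneq => // cl.
rewrite color_inv// signC_negb (scale_swap _ half) -scalerBr.
rewrite (_ : v l + _ - _ = 2 *: v l); first by rewrite !scalerA mulrA half_sqr scale1r.
rewrite scalerDr scalerA mulrN signC_sqr scaleN1r opprD opprK.
by rewrite (addrC (- _)) addrACA subrr addr0 scaler_nat.
Qed.

Lemma eigenvecK c v l : involutive c -> eigenvec c (pairvec c v) l = v l.
Proof.
move=> cK; rewrite /pairvec /eigenvec cK; case: eqVneq => // cl.
rewrite color_inv// signC_negb (scale_swap _ half) -scalerDr.
rewrite (_ : v l - _ + _ = 2 *: v l); first by rewrite !scalerA mulrA half_sqr scale1r.
rewrite scalerBr scalerA mulrN signC_sqr scaleN1r opprK.
by rewrite (addrC (signC C _ *: _)) addrACA addNr addr0 scaler_nat.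
Qed.

Lemma eigenvec_delta c v l : involutive c -> conjugate_basis e N c v ->
  delta e N (eigenvec c v l) = signC C (color c l) *: eigenvec c v l.
Proof.
move=> cK /conj_basisP[_ dv]; rewrite /eigenvec /color.
case: eqVneq => [cl|cl]; first by rewrite dv /scoef /coef !cl eqxx.
rewrite (deltaZ he) (deltaD he) (deltaZ he) !dv cK /scoef coef_inv// /coef.
rewrite (negbTE cl) !scale1r [RHS]scale_swap; congr (half *: _).
by rewrite [RHS]scalerDr scalerA signC_sqr scale1r addrC.
Qed.

Lemma eigenvec_orthonormal c v : involutive c -> dual_basis e N c v ->
  forall i j, phi (eigenvec c v i) (eigenvec c v j) =
    if i == j then signC C (color c i) else 0.
Proof.
move=> cK /dual_basisP[_ dv] i j; rewrite /eigenvec.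
have sep k l : c k = k -> c l != l -> (l == k) = false /\ (c l == k) = false.
  move=> ck cl; split; first by apply: contra_neqF cl => /eqP ->.
  by apply: contra_neqF cl => /eqP clk; rewrite -[RHS]cK clk ck.
have [ci|ci] := eqVneq (c i) i; have [cj|cj] := eqVneq (c j) j.
- by rewrite dv ci eq_sym /scoef /coef /color ci eqxx.
- have [h1 h2] := sep _ _ ci cj.
  by rewrite phiZr// phiDr// phiZr// !dv ci h1 h2 eq_sym h1 mulr0 addr0 mulr0.
- have [h1 h2] := sep _ _ cj ci.
  rewrite phiZl// phiDl// phiZl// !dv cK !(eq_sym j) h1 h2.
  by rewrite mulr0 addr0 mulr0.
rewrite phiZl// phiDl// !phiZr// !phiDr// !phiZl// !phiZr// !dv !cK half_conj signC_conj.
rewrite /scoef !coef_inv// /coef (negbTE ci) (eq_sym j i) !(can_eq cK).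
have [<-|ij] := eqVneq i j.
  rewrite (eq_sym i (c i)) (negbTE ci).
  transitivity (half * half * 2 * signC C (color c i)); first ring.
  by rewrite half_sqr mul1r.
rewrite (eq_sym j (c i)) (can2_eq cK cK) (eq_sym i (c j)).
have [ji|ji] := eqVneq (c j) i; last by rewrite !(mulr0, addr0).
rewrite -ji color_inv// signC_negb.
transitivity (half * half * (1 - signC C (color c j) * signC C (color c j))); first ring.
by rewrite signC_sqr subrr mulr0.
Qed.

End Colored.

Section DualSignature.
Variables (C : numClosedFieldType) (V : lmodType C) (e : nat -> V).
Hypothesis he : is_basis e.
Variable N : bool -> set nat.
Local Notation phi := (phi e N).
Implicit Types (v u : nat -> V) (c : signed_map) (P Q : set nat).

Lemma eigenvec_lspan P c v l : P l -> P (c l) -> lspan P v (eigenvec c v l).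
Proof.
move=> Pl Pcl; have S := lspan_subspace P v; rewrite /eigenvec.
case: ifP => _; first exact: lspan_gen.
apply: subspaceZ => //; apply: subspaceD => //; first exact: lspan_gen.
by apply: subspaceZ => //; exact: lspan_gen.
Qed.

(** The radical of the span of [v l], for [l] in [P], is spanned by the [v l] such
that [c l] is not in [P]; the other ones can be diagonalized. *)
Lemma span_diag c v n P : involutive c -> dual_basis e N c v ->
  (forall l, P l -> (l < n)%N) ->
  diag_basis e N (lspan P v)
    (fun i : {i : 'I_n | `[< P i >] && `[< P (c i) >]} => eigenvec c v (val (val i)))
    (fun i => color c (val (val i))).
Proof.
move=> cK hv bP; have [[vb _] dv] := proj1 (dual_basisP _ _ _ _) hv.
pose I : finType := {i : 'I_n | `[< P i >] && `[< P (c i) >]}; pose u (i : I) := eigenvec c v (val (val i)).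
have uo : orthonormal e N u (fun i => color c (val (val i))).
  by move=> i j; rewrite /u (eigenvec_orthonormal he cK hv) -!val_eqE.
have Pi (i : I) : P (val (val i)) /\ P (c (val (val i))).
  by have /andP[/asboolP ? /asboolP ?] := valP i.
have uP i : lspan P v (u i) by have [? ?] := Pi i; apply: eigenvec_lspan.
have S := lspan_subspace P v; have Srad := radical_subspace he N S.
split; last exact: uo.
split=> [i|a|x]; first exact: uP.
  move=> [_ /(_ _ (uP _)) h] i; have := h i.
  rewrite -phi_conj// (orthonormal_phi he _ _ uo) => /eqP.
  by rewrite conjC_eq0 mulf_eq0 (negbTE (signC_neq0 _ _)) orbF => /eqP.
pose W := [set x | exists a : I -> C, radical e N (lspan P v) (x - \sum_i a i *: u i)].
have SW : subspace W.
  split; first by exists (fun=> 0); rewrite big1 ?subr0 => [|i _]; [case: Srad|rewrite scale0r].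
  move=> b y z [a ha] [a' ha']; exists (fun i => b * a i + a' i).
  have -> : b *: y + z - \sum_i (b * a i + a' i) *: u i =
      b *: (y - \sum_i a i *: u i) + (z - \sum_i a' i *: u i).
    under eq_bigr do rewrite scalerDl -scalerA.
    by rewrite big_split /= -scaler_sumr scalerBr opprD addrACA.
  exact: (proj2 Srad).
have Wu l : P l -> P (c l) -> W (eigenvec c v l).
  move=> Pl Pcl; have ln := bP _ Pl.
  have hl : `[< P (Ordinal ln) >] && `[< P (c (Ordinal ln)) >].
    by apply/andP; split; apply/asboolP.
  exists (fun i => (i == exist _ (Ordinal ln) hl)%:R).
  rewrite (bigD1 (exist _ (Ordinal ln) hl))//= eqxx scale1r big1 => [|i /negbTE ->].
    by rewrite addr0 subrr; case: Srad.
  by rewrite scale0r.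
move: x; apply: lspan_min => // l Pl.
have [Pcl|nPcl] := pselect (P (c l)); last first.
  exists (fun=> 0); rewrite big1 ?subr0 => [|i _]; last by rewrite scale0r.
  by split; [exact: lspan_gen|rewrite (dagger_lspan he _ cK hv); exact: lspan_gen].
rewrite -(pairvecK v l cK) /pairvec; case: ifP => _; first exact: Wu.
apply: (@subspaceZ _ _ W) => //; apply: (@subspaceB _ _ W) => //; first exact: Wu.
by apply: (@subspaceZ _ _ W) => //; apply: Wu; rewrite ?cK.
Qed.

Definition signature_count c n P s : nat :=
  count (fun i => [&& `[< P i >], `[< P (c i) >] & color c i == s]) (iota 0 n).

Lemma span_diag_card c n P s :
  #|[pred i : {i : 'I_n | `[< P i >] && `[< P (c i) >]} | color c (val (val i)) == s]| =
  signature_count c n P s.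
Proof.
rewrite (@card_sig_pred _ (fun i : 'I_n => `[< P i >] && `[< P (c i) >])
  (fun i => color c i == s)).
by rewrite (card_ord_count n (fun i => (`[< P i >] && `[< P (c i) >]) && (color c i == s)));
  apply: eq_count => i; rewrite andbA.
Qed.

Lemma signature_unique2 (F : set V) (pq pq' : nat * nat) : subspace F ->
  signature e N F pq -> signature e N F pq' -> pq = pq'.
Proof.
case: pq pq' => [p q] [p' q'] hF /signature_diag[u hu] h.
by have [-> ->] := signature_unique he hF hu h; rewrite !card_inl.
Qed.

(** Adding [l] to [P] makes [c l] leave the radical when [c l] is another element
of [P]; the new hyperbolic plane gains one vector of each color, namely [l] and
[c l]. If [c l] is outside [P] and [l] is moved, [v l] only joins the radical. *)
Lemma signature_count_step c n P l s : involutive c -> (l < n)%N -> (c l < n)%N -> ~ P l ->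
  signature_count c n (P `|` [set l]) s =
  (signature_count c n P s +
     (if c l == l then color c l == s else `[< P (c l) >]))%N.
Proof.
move=> cK ln cln Pl.
apply: (@count_add1 _ _ (if c l == l then color c l == s else `[< P (c l) >])
  (if color c l == s then l else c l)).
- by case: ifP.
- case: ifP => _; first by rewrite asboolF.
  by rewrite cK (asboolF Pl) andbF.
have PE i : `[< (P `|` [set l]) i >] = `[< P i >] || (i == l).
  apply/asboolP/orP => [[Pi|->]|[/asboolP|/eqP ->]]; rewrite ?eqxx; try by [left|right].
  by left; apply/asboolP.
move=> i; rewrite !PE (can2_eq cK cK).
have [il|il] := eqVneq i l.
  rewrite il (asboolF Pl) /=; have [cl|cl] := eqVneq (c l) l.
    by rewrite cl; case: (color c l == s); rewrite ?eqxx ?orbT ?andbT ?andbF.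
  case: (color c l == s); rewrite ?eqxx ?orbF ?andbT ?andbF//.
  by rewrite eq_sym (negbTE cl) andbF.
rewrite orbF; have [icl|icl] := eqVneq i (c l).
  rewrite icl in il *; rewrite cK (asboolF Pl) ?andbF /=.
  rewrite (negbTE il) color_inv//.
  by case: (color c l) s => [] [] /=; rewrite ?eqxx ?(negbTE il) ?andbT ?andbF.
by case: (color c l == s); rewrite ?(negbTE il) ?(negbTE icl) !andbF !orbF.
Qed.

Section Flags.
Context {d : Order.disp_t} {A : orderType d}.
Variable sigma : nat -> A.
Hypothesis sI : injective sigma.

Lemma standard_lt c n l : involutive c -> standard_beyond N n c ->
  (l < n)%N -> (c l < n)%N.
Proof.
move=> cK cn ln; rewrite ltnNge; apply/negP => ncl.
have [ccl _] := cn _ ncl; rewrite cK in ccl.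
by move: ln; rewrite {1}ccl ltnNge ncl.
Qed.

Lemma dual_signature c v l : involutive c -> dual_basis e N c v ->
  exists n0 : nat, forall n : nat, (n0 <= n)%N -> exists p q : nat,
    signature e N (flag_lt sigma v (sigma l) `&` Vn e n) (p, q) /\
    signature e N (flag_le sigma v (sigma l) `&` Vn e n)
      (p + (signature_jump sigma c l).1, q + (signature_jump sigma c l).2)%N.
Proof.
move=> cK hv; have [hve dv] := proj1 (dual_basisP _ _ _ _) hv.
have [n1 hn1] := dual_standard he hv; have [n2 hn2] := Vn_basis he hve.
exists (maxn l.+1 (maxn n1 n2)) => n; rewrite !geq_max => /and3P[ln n1n n2n].
have [_ VnE] := hn2 _ n2n; have cn := standard_beyond_le n1n hn1.
have cln := standard_lt cK cn ln.
pose P := [set i | (sigma i < sigma l)%O] `&` [set i | (i < n)%N].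
have ltE : flag_lt sigma v (sigma l) `&` Vn e n = lspan P v.
  by rewrite VnE /flag_lt lspanI//; case: hve.
have leE : flag_le sigma v (sigma l) `&` Vn e n = lspan (P `|` [set l]) v.
  rewrite VnE /flag_le lspanI//; last by case: hve.
  congr lspan; apply/seteqP; split=> i /=.
    by rewrite le_eqVlt => -[/orP[/eqP/sI|]]; [right|left].
  by move=> [[/ltW ? ?]|->].
have Pl : ~ P l by move=> [/=]; rewrite ltxx.
have bP i : P i -> (i < n)%N by case.
have bQ i : (P `|` [set l]) i -> (i < n)%N by move=> [/bP|->].
have h1 := signature_exists (span_diag cK hv bP).
have h2 := signature_exists (span_diag cK hv bQ).
rewrite !span_diag_card in h1 h2; rewrite ltE leE.
exists (signature_count c n P true), (signature_count c n P false); split=> //.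
move: h2; rewrite !signature_count_step//.
suff -> : signature_jump sigma c l =
  (nat_of_bool (if c l == l then color c l == true else `[< P (c l) >]),
   nat_of_bool (if c l == l then color c l == false else `[< P (c l) >])) by [].
have PE : `[< P (c l) >] = (sigma (c l) < sigma l)%O.
  by apply/asboolP/idP => [[]|].
rewrite /signature_jump PE /color.
have fE s : `[< fixed_with c s l >] = (c l == l) && (fix_sign c l == s).
  by apply/asboolP/andP => [/fixed_withP[-> ->]//|[/eqP ? /eqP ?]]; apply/fixed_withP.
rewrite !fE; have [cl|cl] := eqVneq (c l) l; last by case: ifP.
by rewrite cl ltxx; case: (fix_sign c l).
Qed.

Lemma signature_jump_fixed c c' l : c =1 c' -> c l = l ->
  signature_jump sigma c l = signature_jump sigma c' l -> fix_sign c l = fix_sign c' l.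
Proof.
move=> cc cl; rewrite /signature_jump -cc cl ltxx -/(fix_sign c l) -/(fix_sign c' l).
by case: (fix_sign c l); case: (fix_sign c' l) => //; case: ifP.
Qed.

End Flags.

Hypothesis hN : sign_partition N.

Definition standard_map : signed_map := signed_map_of id (fun l => `[< N true l >]).

Lemma fix_sign_of w eps l : w l = l -> fix_sign (signed_map_of w eps) l = eps l.
Proof. by move=> wl; rewrite (@fix_signE (signed_map_of w eps) l wl). Qed.

Lemma standard_dual : dual_basis e N standard_map e.
Proof.
apply/dual_basisP; split=> [|k l]; first exact: e_basis_e.
by rewrite (phi_ee he) scoef_of coef_id.
Qed.

(** For large [n], both [e] and [v] diagonalize the form on [V_n]: the law of
inertia equates the distributions of signs and of colors. *)
Lemma dual_signed_involution c v : involutive c -> dual_basis e N c v ->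
  signed_involutions N c.
Proof.
move=> cK hv; have [hve _] := hv.
have [n1 hn1] := dual_standard he hv; have [n2 hn2] := Vn_basis he hve.
set n := maxn n1 n2; have cn := standard_beyond_le (leq_maxl n1 n2) hn1.
have [_ VnE] := hn2 _ (leq_maxr n1 n2).
apply/(signed_involutions_count hN cK cn).
have b P : P = [set l | (l < n)%N] -> forall l, P l -> (l < n)%N by move=> ->.
have h1 := span_diag cK hv (b _ erefl).
have h2 := @span_diag standard_map e n _ (fun=> erefl) standard_dual (b _ erefl).
rewrite -/(Vn e n) VnE in h2.
have := inertia he true (lspan_subspace _ _) h1 h2.
rewrite !span_diag_card /signature_count => H.
have aT j : (j < n)%N -> `[< [set l | (l < n)%N] j >] = true by move=> jn; rewrite asboolT.
transitivity (count (fun i => [&& `[< [set l | (l < n)%N] i >],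
    `[< [set l | (l < n)%N] (c i) >] & color c i == true]) (iota 0 n)).
  apply: eq_in_count => i; rewrite mem_iota add0n => /= ni.
  by rewrite !aT//= ?eqb_id//; apply: standard_lt cn _.
rewrite H; apply: eq_in_count => i; rewrite mem_iota add0n => /= ni.
by rewrite !aT//= /color eqxx fix_sign_of// eqb_id.
Qed.

Lemma coord_eigenvec_neq0 c v l : is_basis v -> coord v (eigenvec c v l) l != 0.
Proof.
move=> vb; rewrite /eigenvec; case: (eqVneq (c l) l) => cl.
  by rewrite (coord_basis vb) eqxx oner_eq0.
rewrite (coordZ vb) (coordD vb) (coordZ vb) !(coord_basis vb) eqxx.
by rewrite (eq_sym l) (negbTE cl) mulr0 addr0 mulr1 half_neq0.
Qed.

Lemma coord_eigenvec0 c v l k : involutive c -> is_basis v ->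
  color c k = color c l -> k != l -> coord v (eigenvec c v l) k = 0.
Proof.
move=> cK vb ckl kl; rewrite /eigenvec; case: (eqVneq (c l) l) => cl.
  by rewrite (coord_basis vb) (negbTE kl).
rewrite (coordZ vb) (coordD vb) (coordZ vb) !(coord_basis vb) (negbTE kl).
case: eqVneq => [kE|_]; last by rewrite !(mulr0, addr0).
by have := color_inv cK cl; rewrite -kE ckl; case: (color c l).
Qed.

(** The eigenvectors of [delta] constructed from [v] are independent, so those
of each sign are at most as many as the basis vectors of this sign; the totals
agree. *)
Lemma conj_signed_involution c v : involutive c -> conjugate_basis e N c v ->
  signed_involutions N c.
Proof.
move=> cK hv; have [hve _] := hv; have vb := proj1 hve.
have [n1 hn1] := conj_standard he hv; have [n2 hn2] := Vn_basis he hve.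
set n := maxn n1 n2; have cn := standard_beyond_le (leq_maxl n1 n2) hn1.
have [_ VnE] := hn2 _ (leq_maxr n1 n2).
apply/(signed_involutions_count hN cK cn).
pose t l := `[< N true l >].
have le s : (count (fun l => color c l == s) (iota 0 n)
    <= count (fun l => t l == s) (iota 0 n))%N.
  rewrite -(card_ord_count n (fun l => color c l == s)).
  rewrite -(card_ord_count n (fun l => t l == s)).
  rewrite -(card_sig (fun i : 'I_n => color c i == s)).
  rewrite -(card_sig (fun i : 'I_n => t i == s)) leqNgt; apply/negP => IJ.
  have [a [[i0 ai0] ha]] := linear_dependence
    (fun (i : {i : 'I_n | color c i == s}) (j : {j : 'I_n | t j == s}) =>
       coord e (eigenvec c v (val (val i))) (val (val j))) IJ.
  pose x := \sum_i a i *: eigenvec c v (val (val i)).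
  have dx : delta e N x = signC C s *: x.
    rewrite -[delta e N]/(deltaL he N : V -> V) linear_sum scaler_sumr.
    apply: eq_bigr => i _; rewrite linearZ /= (eigenvec_delta he _ cK hv).
    by rewrite (eqP (valP i)) scale_swap.
  have xV : Vn e n x.
    rewrite VnE; apply: subspace_sum => [|i _]; first exact: lspan_subspace.
    apply: subspaceZ; first exact: lspan_subspace.
    by apply: eigenvec_lspan => //=; apply: standard_lt cn _.
  have x0 : x = 0.
    apply: (coord_inj he) => j; rewrite (coord0 he).
    have [nj|jn] := leqP n j.
      by apply: (proj1 (lspanE he _ _) xV) => /=; rewrite ltnNge nj.
    have [tj|tj] := eqVneq (t j) s.
      have tj' : t (Ordinal jn) == s by rewrite /= tj.
      rewrite -[RHS](ha (exist _ (Ordinal jn) tj')) (coord_sum he).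
      by apply: eq_bigr => i _; rewrite (coordZ he).
    have := coord_delta he N x j; rewrite dx (coordZ he) => /eqP.
    rewrite -subr_eq0 -mulrBl mulf_eq0 subr_eq0 => /orP[/eqP/signC_inj ts|/eqP//].
    by rewrite /t -ts eqxx in tj.
  have := coord0 vb (val (val i0)); rewrite -x0 (coord_sum vb) (bigD1 i0)//= big1.
      rewrite addr0 (coordZ vb) => /eqP; rewrite mulf_eq0 (negbTE ai0).
    by rewrite (negbTE (coord_eigenvec_neq0 _ _ vb)).
  move=> i ii0; rewrite (coordZ vb) coord_eigenvec0 ?mulr0//.
    by rewrite (eqP (valP i)) (eqP (valP i0)).
  by rewrite !val_eqE eq_sym.
have tot (p : nat -> bool) : (count (fun l => p l == true) (iota 0 n)
    + count (fun l => p l == false) (iota 0 n) = size (iota 0 n))%N.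
  rewrite -(count_predC p); congr (_ + _)%N; apply: eq_count => l /=; by case: (p l).
have E (p : nat -> bool) : count p (iota 0 n) = count (fun l => p l == true) (iota 0 n).
  by apply: eq_count => l; rewrite eqb_id.
have := le true; have := le false; have := tot t; have := tot (color c).
rewrite (E (color c)) -/t (E t); lia.
Qed.

End DualSignature.

(** * Bases that are both conjugate and dual *)

Section CommonBases.
Variables (C : numClosedFieldType) (V : lmodType C) (e : nat -> V).
Hypothesis he : is_basis e.
Variable N : bool -> set nat.
Hypothesis hN : sign_partition N.
Implicit Types (v u : nat -> V) (c : signed_map).
Local Notation delta := (delta e N).
Local Notation phi := (phi e N).
Local Notation herm := (Defs.phi e all_plus).

Definition unitary u : Prop := forall i j, herm (u i) (u j) = (i == j)%:R.

Lemma herm_delta x y : herm (delta x) (delta y) = herm x y.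
Proof. by rewrite -(phi_deltal he N) (deltaK he) -phi_delta_swap// phi_deltal. Qed.

Lemma herm_deltar x y : herm x (delta y) = phi x y.
Proof. by rewrite -(phi_deltal he N) phi_delta2. Qed.

(** The Gram matrix of [u] for [phi] is the matrix of [delta] in [u]. *)
Lemma unitary_conj_dual c u : conjugate_basis e N c u -> unitary u -> dual_basis e N c u.
Proof.
move=> /conj_basisP[hu du] uu; apply/dual_basisP; split=> // k l.
rewrite -{1}[u k](deltaK he N) phi_deltal// du phiZl// uu /scoef coef_conj eq_sym.
by case: eqP; rewrite ?mulr1 ?mulr0.
Qed.

Lemma unitary_coord u x i : is_basis u -> unitary u -> herm (u i) x = coord u x i.
Proof.
move=> ub uu; move: x; apply: (basis_ind ub) => [|j /=]; last first.
  by rewrite uu (coord_basis ub) eq_sym.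
split=> [|a x y /= hx hy]; first by rewrite /= phi0r// (coord0 ub).
by rewrite /= phiPr// (coordP ub) hx hy.
Qed.

Lemma unitary_free u (n : nat) (a : nat -> C) : unitary u ->
  \sum_(i < n) a i *: u i = 0 -> forall i, (i < n)%N -> a i = 0.
Proof.
move=> uu h i ni; have := phi0r he all_plus (u i).
rewrite -h phi_sumr// (bigD1 (Ordinal ni))//= phiZr// uu eqxx mulr1 big1 ?addr0// => j.
by rewrite -val_eqE /= phiZr// uu eq_sym => /negbTE ->; rewrite mulr0.
Qed.

Lemma pairvec_unitary c u : involutive c -> unitary u -> unitary (pairvec c u).
Proof.
move=> cK uu i j; rewrite /pairvec.
have sep k l : c k = k -> c l != l -> (k == l) = false /\ (k == c l) = false.
  move=> ck cl; split; first by apply: contra_neqF cl => /eqP <-.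
  by apply: contra_neqF cl => /eqP klc; rewrite -klc -[RHS]cK -klc.
case: (eqVneq (c i) i) => ci; case: (eqVneq (c j) j) => cj.
- exact: uu.
- have [h1 h2] := sep _ _ ci cj.
  by rewrite phiZr// phiBr// phiZr// !uu h1 h2 mulr0 subr0 mulr0.
- have [h1 h2] := sep _ _ cj ci.
  by rewrite phiZl// phiBl// phiZl// !uu !(eq_sym _ j) h1 h2 mulr0 subr0 mulr0.
rewrite phiZl// phiBl// !phiZr// !phiBr// !phiZl// !phiZr// !uu half_conj signC_conj.
rewrite (can_eq cK) (can2_eq cK cK).
have [<-|ij] := eqVneq i j.
  rewrite (eq_sym i (c i)) (negbTE ci) mulr1n mulr0n.
  transitivity (half C * half C * (1 + signC C (color c i) * signC C (color c i)));
    first ring.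
  by rewrite signC_sqr -[RHS](half_sqr C); ring.
have [->|ji] := eqVneq i (c j); last by rewrite !(mulr0, subr0).
by rewrite mulr1n mulr0n color_inv// signC_negb; ring.
Qed.

Lemma pairvec_delta c f : involutive c ->
  (forall l, delta (f l) = signC C (color c l) *: f l) ->
  forall l, delta (pairvec c f l) = scoef C c l *: pairvec c f (c l).
Proof.
move=> cK df l; rewrite /pairvec /scoef /coef cK.
case: (eqVneq (c l) l) => cl; first by rewrite df /color !cl eqxx.
rewrite scale1r (deltaZ he) (deltaB he) (deltaZ he) !df color_inv//.
rewrite signC_negb; congr (half C *: _).
by rewrite scalerA mulrN signC_sqr !scaleNr scale1r !opprK addrC.
Qed.

(** A permutation of the basis matching the colors of [c] with the signs of the
partition turns each [e l] into an eigenvector of the right sign; combining these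
in pairs gives vectors exchanged by [delta]. *)
Lemma exists_common_basis c : signed_involutions N c ->
  exists v, conjugate_basis e N c v /\ dual_basis e N c v.
Proof.
move=> hc; have [n cn] := signed_involutions_standard hN hc.
have cK : involutive c by case: hc.
have cnt := proj1 (signed_involutions_count hN cK cn) hc.
pose t l := `[< N true l >].
have cntF : count (predC (color c)) (iota 0 n) = count (predC t) (iota 0 n).
  by apply/eqP; rewrite -(eqn_add2l (count (color c) (iota 0 n))) count_predC cnt count_predC.
have st : perm_eq [seq color c l | l <- iota 0 n] [seq t l | l <- iota 0 n].
  rewrite /perm_eq; apply/allP => b _ /=; rewrite !count_map; apply/eqP.
  have E (p : nat -> bool) : count (preim p (pred1 b)) (iota 0 n) =
      if b then count p (iota 0 n) else count (predC p) (iota 0 n).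
    by case: b; apply: eq_count => l /=; case: (p l).
  by rewrite !E cnt cntF.
have [s' sp sE'] := perm_iotaP false st.
have su : uniq s' by rewrite (perm_uniq sp) iota_uniq.
have ss : size s' = n by rewrite (perm_size sp) size_iota size_map size_iota.
have sm l : (l \in s') = (l < n)%N.
  by rewrite (perm_mem sp) mem_iota add0n size_map size_iota.
pose pi l := if (l < n)%N then nth 0%N s' l else l.
pose pi' l := if (l < n)%N then index l s' else l.
have pib : bijective pi.
  exists pi' => l; rewrite /pi /pi'.
    have [ln|nl] := ltnP l n; last by rewrite ltnNge nl.
    by rewrite -sm mem_nth ?ss// index_uniq ?ss.
  have [ln|nl] := ltnP l n; last by rewrite ltnNge nl.
  by rewrite -{1}ss index_mem sm ln nth_index ?sm.
have pin l : (n <= l)%N -> pi l = l by rewrite /pi leqNgt => /negbTE ->.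
have pic l : t (pi l) = color c l.
  have [nl|ln] := leqP n l; first by rewrite pin// (color_standard cn).
  have := congr1 (fun s => nth false s l) sE'.
  rewrite (nth_map 0%N) ?size_iota// nth_iota// add0n => ->.
  rewrite (nth_map 0%N) ?ss// (nth_map 0%N) /pi ?ln ?size_iota.
    by rewrite nth_iota ?add0n// -sm mem_nth ?ss.
  by rewrite -sm mem_nth ?ss.
pose f := e \o pi.
have hf : e_basis e f := e_basis_comp pib pin (e_basis_e he).
have fd l : delta (f l) = signC C (color c l) *: f l.
  by rewrite /f /= (delta_e he) -pic.
have fu : unitary f.
  by move=> i j; rewrite /f /= (phi_ee he) Phi_plus (bij_eq pib) eq_sym; case: eqP.
have vu := pairvec_unitary cK fu.
exists (pairvec c f); suff hv : conjugate_basis e N c (pairvec c f).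
  by split=> //; apply: unitary_conj_dual.
apply/conj_basisP; split; last exact: pairvec_delta.
split; last first.
  have [m hm] := proj1 (almost_eP _ _) (proj2 hf).
  apply/almost_eP; exists (maxn n m) => l; rewrite geq_max => /andP[nl ml].
  by rewrite /pairvec (proj1 (cn _ nl)) eqxx hm.
apply: (basis_transfer (proj1 hf)) => [l|k a h]; last exact: unitary_free vu h.
by rewrite -(eigenvecK f l cK); apply: eigenvec_lspan.
Qed.

Section Flag.
Context {d : Order.disp_t} {A : orderType d}.
Variable sigma : nat -> A.
Hypothesis sb : bijective sigma.

(** Gram-Schmidt, as the existence of a dual basis for the positive definite form:
by positivity the involution is the identity and all signs are [+]. *)
Lemma exists_unitary_basis v : e_basis e v ->
  exists u, [/\ e_basis e u, unitary u & flag sigma u = flag sigma v].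
Proof.
move=> hv; have [c [u [cK /dual_basisP[hu du] fu]]] :=
  exists_dual_basis he (bij_inj sb) all_plus hv.
exists u; split=> // i j.
have pos k : c k = k /\ scoef C c k = 1.
  have u0 : herm (u k) (u k) != 0.
    by apply/eqP => /(phi_plus_eq0 he) /eqP; rewrite (negbTE (basis_neq0 (proj1 hu) k)).
  have uge0 := phi_plus_ge0 he (u k); rewrite du in u0 uge0.
  have [ck|ck] := eqVneq k (c k); last by rewrite (negbTE ck) eqxx in u0.
  split=> //; rewrite -ck eqxx in uge0; move: uge0; rewrite /scoef /coef -ck eqxx.
  by case: (fix_sign c k) => //; rewrite /signC oppr_ge0 ler10.
by rewrite du; have [-> ->] := pos i; rewrite eq_sym; case: eqP.
Qed.

(** Let [u] be a unitary basis of the flag. The conjugate basis [v] shows that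
[delta (u l)] has no component along [u i] for [i] after [c l], once the
components along the [u (c j)] with [j] before [l] are excluded by orthogonality;
the dual basis [v'] excludes the [i] before [c l]. Hence [delta] permutes the
lines spanned by the [u l]. *)
Lemma unitary_delta c v v' u : involutive c ->
  conjugate_basis e N c v -> dual_basis e N c v' -> e_basis e u -> unitary u ->
  flag sigma v = flag sigma u -> flag sigma v' = flag sigma u ->
  forall l, delta (u l) = coord u (delta (u l)) (c l) *: u (c l).
Proof.
move=> cK hc hd hu uu fv fv'; have sI := bij_inj sb; have ub := proj1 hu.
have [hv dv] := proj1 (conj_basisP _ _ _ _) hc; have vb := proj1 hv.
have [hv' dv'] := proj1 (dual_basisP _ _ _ _) hd; have vb' := proj1 hv'.
have [ltv lev] := flag_labels sb hv hu fv.
have [ltv' lev'] := flag_labels sb hv' hu fv'.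
pose bad l := exists i, i != c l /\ coord u (delta (u l)) i != 0.
have good l : ~ bad l -> delta (u l) = coord u (delta (u l)) (c l) *: u (c l).
  move=> nb; apply: (coord_inj ub) => i; rewrite (coordZ ub) (coord_basis ub).
  have [->|ic] := eqVneq i (c l); first by rewrite mulr1.
  by rewrite mulr0; apply/eqP/negPn/negP => hi; apply: nb; exists i.
move=> l0; apply: (good) => bad0.
have [n1 cn] := conj_standard he hc; have [n2 un] := proj1 (almost_eP _ _) (proj2 hu).
have badn l : bad l -> (l < maxn n1 n2)%N.
  move=> [i [ic hi]]; rewrite ltnNge geq_max; apply/negP => /andP[/cn[cl _] /un ul].
  move: hi; rewrite ul (delta_e he) -ul (coordZ ub) (coord_basis ub) -cl.
  by rewrite (negbTE ic) mulr0 eqxx.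
have [l [i [ic /eqP hi]] lmin] := finite_min sigma badn (ex_intro _ l0 bad0).
have before j : (sigma j < sigma l)%O ->
    delta (u j) = coord u (delta (u j)) (c j) *: u (c j).
  by move=> jl; apply: good => /lmin; rewrite leNgt jl.
have theta0 j : (sigma j < sigma l)%O -> coord u (delta (u j)) (c j) != 0.
  move=> /before h; apply/eqP => h0; rewrite h0 scale0r in h.
  have := basis_neq0 ub j; rewrite -[u j](deltaK he N) h (delta0 he) eqxx.
  by [].
have S := lspan_subspace.
(* Components along earlier images vanish by orthogonality. *)
have early j : (sigma j < sigma l)%O -> coord u (delta (u l)) (c j) = 0.
  move=> jl; rewrite -unitary_coord//.
  have : herm (delta (u j)) (delta (u l)) = 0.
    by rewrite herm_delta uu; case: eqP => // jE; rewrite jE ltxx in jl.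
  rewrite {1}before// phiZl// => /eqP; rewrite mulf_eq0 conjC_eq0.
  by rewrite (negbTE (theta0 _ jl)) => /eqP.
have [ci|ci] := ltP (sigma (c i)) (sigma l).
  by apply: hi; rewrite -[ i]cK; apply: early.
apply: hi; have [ilt|] := ltP (sigma i) (sigma (c l)).
  rewrite -unitary_coord// herm_deltar.
  have hl : flag_le sigma v' (sigma l) (u l) by rewrite lev'; apply: lspan_gen => /=.
  have ui : flag_lt sigma v' (sigma (c l)) (u i) by rewrite ltv'; apply: lspan_gen.
  have iv' : phi (u i) (v' l) = 0.
    move: (u i) ui; apply: lspan_min; first exact: phi_subspacel.
    move=> m /= ml; rewrite dv'; case: eqP => // lm.
    by move: ml; rewrite lm cK ltxx.
  have decomp : flag_lt sigma v' (sigma l) (u l - coord v' (u l) l *: v' l).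
    apply: flag_step => //; last first.
      by rewrite (coordB vb') (coordZ vb') (coord_basis vb') eqxx mulr1 subrr.
    apply: subspaceB; [exact: S|exact: hl|].
    by apply: subspaceZ; [exact: S|apply: lspan_gen => /=].
  rewrite ltv' in decomp.
  have r0 : phi (u i) (u l - coord v' (u l) l *: v' l) = 0.
    move: (u l - _) decomp; apply: lspan_min; first exact: phi_subspace.
    move=> j /= jl; rewrite -herm_deltar before// phiZr// uu.
    case: eqP => [iE|_]; last by rewrite mulr0.
    by move: ci; rewrite iE cK leNgt jl.
  by move: r0; rewrite phiBr// phiZr// iv' mulr0 subr0.
rewrite le_eqVlt => /orP[/eqP/sI cli|cli]; first by rewrite cli eqxx in ic.
have hl : flag_le sigma v (sigma l) (u l) by rewrite lev; apply: lspan_gen => /=.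
have decomp : flag_lt sigma v (sigma l) (u l - coord v (u l) l *: v l).
  apply: flag_step => //; last first.
    by rewrite (coordB vb) (coordZ vb) (coord_basis vb) eqxx mulr1 subrr.
  apply: subspaceB; [exact: S|exact: hl|].
    by apply: subspaceZ; [exact: S|apply: lspan_gen => /=].
rewrite ltv in decomp.
have r0 : coord u (delta (u l - coord v (u l) l *: v l)) i = 0.
  move: (u l - _) decomp; apply: lspan_min.
    split=> [|a x y /= hx hy]; first by rewrite /= (delta0 he) (coord0 ub).
    by rewrite /= (deltaP he) (coordP ub) hx hy mulr0 addr0.
  move=> j /= jl; rewrite before// (coordZ ub) (coord_basis ub).
  case: eqP => [iE|_]; last by rewrite mulr0.
  by move: ci; rewrite iE cK leNgt jl.
have vcl : flag_le sigma u (sigma (c l)) (v (c l)).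
  by rewrite -lev; apply: lspan_gen => /=.
move: r0; rewrite (deltaB he) (deltaZ he) dv (coordB ub) !(coordZ ub).
rewrite (proj1 (lspanE ub _ _) vcl) => [|/=]; last by rewrite leNgt cli.
by rewrite !mulr0 subr0.
Qed.

(** After a unitary basis [u] of the flag has been found whose lines are permuted
by [delta], it remains to rescale one vector of each pair to get a conjugate
basis; it stays unitary, hence is dual. *)
Lemma common_basis c v v' : involutive c ->
  conjugate_basis e N c v -> dual_basis e N c v' -> flag sigma v = flag sigma v' ->
  exists u, [/\ conjugate_basis e N c u, dual_basis e N c u & flag sigma u = flag sigma v].
Proof.
move=> cK hc hd fvv'; have sI := bij_inj sb.
have [hv dv] := proj1 (conj_basisP _ _ _ _) hc; have vb := proj1 hv.
have [u [hu uu fu]] := exists_unitary_basis hv; have ub := proj1 hu.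
have fv' : flag sigma v' = flag sigma u by rewrite fu.
have [ltv lev] := flag_labels sb hv hu (esym fu).
have du := unitary_delta cK hc hd hu uu (esym fu) fv'.
pose th l := coord u (delta (u l)) (c l).
have thE l : (th l)^* * th l = 1.
  have := herm_delta (u l) (u l); rewrite uu eqxx du phiZl// phiZr// uu eqxx mulr1.
  by [].
have th0 l : th l != 0.
  by apply/eqP => h; have /eqP := thE l; rewrite h mulr0 eq_sym oner_eq0.
(* The sign of a fixed point is read off the quotient of the flag at [l]. *)
have thfix l : c l = l -> th l = signC C (fix_sign c l).
  move=> cl; have hl : flag_le sigma v (sigma l) (u l).
    by rewrite lev; apply: lspan_gen => /=.
  have ul0 : coord v (u l) l != 0 by have [_] := flag_change sb hv hu (esym fu) l.
  have := du l; rewrite cl -/(th l) => dul.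
  have lt_coord y : flag_lt sigma v (sigma l) y -> coord v (delta y) l = 0.
    move: y; apply: lspan_min.
      split=> [|a x y /= hx hy]; first by rewrite /= (delta0 he) (coord0 vb).
      by rewrite /= (deltaP he) (coordP vb) hx hy mulr0 addr0.
    move=> j /= jl; rewrite dv (coordZ vb) (coord_basis vb).
    case: eqP => [lE|_]; last by rewrite mulr0.
    by move: jl; rewrite -[j]cK -lE cl ltxx.
  have := lt_coord (u l - coord v (u l) l *: v l).
  rewrite (deltaB he) (deltaZ he) dv {1}(_ : delta (u l) = th l *: u l); last first.
    by rewrite {1}dul /th cl.
  rewrite (coordB vb) !(coordZ vb) cl (coord_basis vb) eqxx mulr1 => h.
  have /eqP : th l * coord v (u l) l - coord v (u l) l * scoef C c l = 0.
    apply: h; apply: flag_step => //; last first.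
      by rewrite (coordB vb) (coordZ vb) (coord_basis vb) eqxx mulr1 subrr.
    have S := lspan_subspace; apply: subspaceB; [exact: S|exact: hl|].
    by apply: subspaceZ; [exact: S|apply: lspan_gen => /=].
  rewrite subr_eq0 mulrC => /eqP/(mulfI ul0) ->.
  by rewrite /scoef /coef cl eqxx.
pose a l := if (l <= c l)%N then 1 else th (c l).
pose u' l := a l *: u l.
have aE l : (a l)^* * a l = 1 by rewrite /a; case: ifP => _; rewrite ?rmorph1 ?mulr1.
have a0 l : a l != 0.
  by apply/eqP => h; have /eqP := aE l; rewrite h mulr0 eq_sym oner_eq0.
have [n cn] := conj_standard he hc; have [m um] := proj1 (almost_eP _ _) (proj2 hu).
have [] := triangular_change sI hu (u := u').
- apply/almost_eP; exists (maxn n m) => l; rewrite geq_max => /andP[/cn[cl _] /um ul].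
  by rewrite /u' /a cl leqnn scale1r.
- move=> l; apply: subspaceZ; first exact: lspan_subspace.
  by apply: lspan_gen => /=.
- by move=> l; rewrite (coordZ ub) (coord_basis ub) eqxx mulr1.
move=> hu' lt' le'.
have uu' : unitary u'.
  move=> i j; rewrite /u' phiZl// phiZr// uu; case: eqP => [->|_]; last by rewrite !mulr0.
  by rewrite mulr1 aE.
have hcu : conjugate_basis e N c u'.
  apply/conj_basisP; split=> // l; rewrite /u' (deltaZ he) du -/(th l) !scalerA.
  congr (_ *: _); rewrite /scoef /coef /a cK.
  have [cl|cl] := eqVneq (c l) l; first by rewrite cl leqnn mul1r mulr1 thfix.
  rewrite mul1r (leq_eqVlt l) eq_sym (negbTE cl) /= (leqNgt (c l)).
  case: ltnP => //= _; first by rewrite mul1r.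
  have := deltaK he N (u l); rewrite (du l) -/(th l) (deltaZ he) du cK scalerA.
  have -> : coord u (delta (u (c l))) l = th (c l) by rewrite /th cK.
  move=> /(congr1 (fun x => coord u x l)).
  by rewrite (coordZ ub) (coord_basis ub) eqxx mulr1 mulrC.
exists u'; split=> //; first exact: unitary_conj_dual.
by rewrite -fu; apply: eq_flag.
Qed.

End Flag.
End CommonBases.

(** * Orbits *)

Section Orbits.
Variables (C : numClosedFieldType) (V : lmodType C) (e : nat -> V).
Hypothesis he : is_basis e.
Variable N : bool -> set nat.
Hypothesis hN : sign_partition N.
Context {d : Order.disp_t} {A : orderType d}.
Variable sigma : nat -> A.
Hypothesis sb : bijective sigma.
Implicit Types (v u : nat -> V) (c : signed_map) (F : set (set V)).

Lemma conj_orbit c v : conjugate_basis e N c v ->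
  orbit (groupK e N) (flag sigma v) = conj_flags e N sigma c.
Proof.
move=> hv; apply/seteqP; split=> [_ [g hg <-]|_ [u hu <-]].
  by rewrite act_flag; exists (g \o v) => //; apply: conj_image.
have [g hg gE] := e_basis_change (proj1 hv) (proj1 hu).
exists g; first exact: (conj_change he hv hu).
by rewrite act_flag; congr flag; apply/funext.
Qed.

Lemma dual_orbit c v : dual_basis e N c v ->
  orbit (groupG0 e N) (flag sigma v) = dual_flags e N sigma c.
Proof.
move=> hv; apply/seteqP; split=> [_ [g hg <-]|_ [u hu <-]].
  by rewrite act_flag; exists (g \o v) => //; apply: dual_image.
have [g hg gE] := e_basis_change (proj1 hv) (proj1 hu).
exists g; first exact: (dual_change he hv hu).
by rewrite act_flag; congr flag; apply/funext.
Qed.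

Lemma common_orbit c v : conjugate_basis e N c v -> dual_basis e N c v ->
  orbit (groupK e N `&` groupG0 e N) (flag sigma v) =
  [set flag sigma u | u in [set u | conjugate_basis e N c u /\ dual_basis e N c u]].
Proof.
move=> cv dv; apply/seteqP; split=> [_ [g [gK gG] <-]|_ [u [cu du] <-]].
  rewrite act_flag; exists (g \o v) => //; split; first exact: conj_image.
  exact: dual_image.
have [g hg gE] := e_basis_change (proj1 cv) (proj1 cu).
exists g; first by split; [exact: (conj_change he cv cu)|exact: (dual_change he dv du)].
by rewrite act_flag; congr flag; apply/funext.
Qed.

Lemma conj_dual_flags c : involutive c ->
  conj_flags e N sigma c `&` dual_flags e N sigma c =
  [set flag sigma u | u in [set u | conjugate_basis e N c u /\ dual_basis e N c u]].
Proof.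
move=> cK; apply/seteqP; split=> [F [[v hv <-] [v' hv' fE]]|_ [u [cu du] <-]].
  have [u [cu du fu]] := common_basis he sb cK hv hv' (esym fE).
  by rewrite -fu; exists u.
by split; exists u.
Qed.

(** For the converse, [F] has a conjugate basis for some signed map [c']. The
relative position forces [c' =1 c], and the dimensions force the same signs. *)
Lemma conj_flags_criterion c F (F1 F2 : A -> set V) :
  signed_involutions N c -> labelling e sigma F F1 F2 ->
  conj_flags e N sigma c F <->
    pair_orbit e sigma sigma c (act (delta e N) F, F) /\
    forall (l : nat) (s : bool),
      quotient_dim (F2 (sigma l) `&` Vsign e N s) (F1 (sigma l) `&` Vsign e N s)
        (if `[< (sigma (c l) < sigma l)%O \/ fixed_with c s l >] then 1%N else 0%N).
Proof.
move=> hc [v0 [hv0 FE F1E F2E]]; have [cK _] := hc; have sI := bij_inj sb.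
have [n cn] := signed_involutions_standard hN hc.
have dims c' v : involutive c' -> conjugate_basis e N c' v -> F = flag sigma v ->
    forall l s, quotient_dim (F2 (sigma l) `&` Vsign e N s)
      (F1 (sigma l) `&` Vsign e N s)
      (if `[< (sigma (c' l) < sigma l)%O \/ fixed_with c' s l >] then 1%N else 0%N).
  move=> c'K hv Fv l s.
  have [ltE leE] := flag_labels sb hv0 (proj1 hv) (etrans (esym FE) Fv).
  by rewrite F1E F2E ltE leE; apply: conj_dim.
split=> [[v hv Fv]|[pos dim]].
  by split; [rewrite -Fv; apply: conj_position cn hv|apply: dims (esym Fv)].
have [c' [u [c'K hu fu]]] := exists_conj_basis he sI N hv0.
have Fu : F = flag sigma u by rewrite fu.
have [n' cn'] := conj_standard he hu.
have cc : c' =1 c.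
  have bound l : (maxn n n' <= l)%N -> c' l = l /\ c l = l.
    by rewrite geq_max => /andP[/cn[] cl _ /cn'[] cl' _].
  apply: (pair_orbit_unique he sb sb c'K cK bound _ pos).
  by rewrite Fu; apply: conj_position cn' hu.
exists u; last by rewrite Fu.
apply: eq_conj_basis (hu) => // l cl; have := dim l true.
have := dims _ _ c'K hu Fu l true; rewrite -!/(nat_of_bool `[< _ >]).
move=> h1 h2; have := quotient_dim_bool h1 h2.
have nlt : (sigma l < sigma l)%O = false by rewrite ltxx.
rewrite -cc cl !nlt /fix_sign => E.
have simp (P : Prop) : `[< is_true false \/ P >] = `[< P >].
  by apply: asbool_equiv_eq; split=> [[]|]; [by []|by []|right].
by rewrite !simp in E.
Qed.

(** For the converse, [F] has a dual basis for some signed map [c']. The relative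
position forces [c' =1 c]; by the law of inertia the signature jumps of [c] and
[c'] agree, hence so do the signs of the fixed points. *)
Lemma dual_flags_criterion c F (F1 F2 : A -> set V) :
  signed_involutions N c -> labelling e sigma F F1 F2 ->
  dual_flags e N sigma c F <->
    pair_orbit e (reversed sigma) sigma c (dagger_flag e N F, F) /\
    forall l : nat, exists n0 : nat, forall n : nat, (n0 <= n)%N ->
      exists p q : nat,
        signature e N (F1 (sigma l) `&` Vn e n) (p, q) /\
        signature e N (F2 (sigma l) `&` Vn e n)
          (p + (signature_jump sigma c l).1, q + (signature_jump sigma c l).2)%N.
Proof.
move=> hc [v0 [hv0 FE F1E F2E]]; have [cK _] := hc; have sI := bij_inj sb.
have [n cn] := signed_involutions_standard hN hc.
have sigs c' v : involutive c' -> dual_basis e N c' v -> F = flag sigma v ->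
    forall l : nat, exists n0 : nat, forall n : nat, (n0 <= n)%N ->
      exists p q : nat,
        signature e N (F1 (sigma l) `&` Vn e n) (p, q) /\
        signature e N (F2 (sigma l) `&` Vn e n)
          (p + (signature_jump sigma c' l).1, q + (signature_jump sigma c' l).2)%N.
  move=> c'K hv Fv l.
  have [ltE leE] := flag_labels sb hv0 (proj1 hv) (etrans (esym FE) Fv).
  by rewrite F1E F2E ltE leE; apply: dual_signature.
split=> [[v hv Fv]|[pos sig]].
  by split; [rewrite -Fv; apply: dual_position cn hv|apply: sigs (esym Fv)].
have [c' [u [c'K hu fu]]] := exists_dual_basis he sI N hv0.
have Fu : F = flag sigma u by rewrite fu.
have [n' cn'] := dual_standard he hu.
have cc : c' =1 c.
  have bound l : (maxn n n' <= l)%N -> c' l = l /\ c l = l.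
    by rewrite geq_max => /andP[/cn[] cl _ /cn'[] cl' _].
  apply: (pair_orbit_unique he (tau := reversed sigma) sb sb c'K cK bound _ pos).
  by rewrite Fu; apply: dual_position cn' hu.
exists u; last by rewrite Fu.
apply: eq_dual_basis (hu) => // l cl.
apply: (signature_jump_fixed cc cl (sigma := sigma)).
have [m hm] := sig l; have [m' hm'] := sigs _ _ c'K hu Fu l.
have [p [q [h1 h2]]] := hm _ (leq_maxl m m').
have [p' [q' [h1' h2']]] := hm' _ (leq_maxr m m').
have S1 : subspace (F1 (sigma l) `&` Vn e (maxn m m')).
  by rewrite F1E; apply: subspaceI; exact: lspan_subspace.
have S2 : subspace (F2 (sigma l) `&` Vn e (maxn m m')).
  by rewrite F2E; apply: subspaceI; exact: lspan_subspace.
have [pE qE] := signature_unique2 he S1 h1 h1'.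
have [] := signature_unique2 he S2 h2' h2; rewrite pE qE.
move=> /addnI j1 /addnI j2.
by case: (signature_jump sigma c' l) (signature_jump sigma c l) j1 j2 => a b [a' b'] /= -> ->.
Qed.

Lemma conj_orbits : [set conj_flags e N sigma c | c in signed_involutions N] =
  orbits (groupK e N) (flagsX e sigma).
Proof.
apply/seteqP; split=> [_ [c hc <-]|_ [F /(flagsXP he)[v hv ->] <-]].
  have [v [cv _]] := exists_common_basis he hN hc.
  exists (flag sigma v); last exact: conj_orbit.
  by apply/flagsXP => //; exists v => //; case: cv.
have [c [u [cK hu fu]]] := exists_conj_basis he (bij_inj sb) N hv.
exists c; first exact: conj_signed_involution hu.
by rewrite -fu (conj_orbit hu).
Qed.

Lemma dual_orbits : [set dual_flags e N sigma c | c in signed_involutions N] =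
  orbits (groupG0 e N) (flagsX e sigma).
Proof.
apply/seteqP; split=> [_ [c hc <-]|_ [F /(flagsXP he)[v hv ->] <-]].
  have [v [_ dv]] := exists_common_basis he hN hc.
  exists (flag sigma v); last exact: dual_orbit.
  by apply/flagsXP => //; exists v => //; case: dv.
have [c [u [cK hu fu]]] := exists_dual_basis he (bij_inj sb) N hv.
exists c; first exact: dual_signed_involution hu.
by rewrite -fu (dual_orbit hu).
Qed.

End Orbits.

Theorem proposition8 (R : realType) (V : lmodType R[i]) (e : nat -> V)
    (he : is_basis e) (N : bool -> set nat) (hN : sign_partition N)
    (d : Order.disp_t) (A : orderType d) (sigma : nat -> A)
    (hsigma : bijective sigma) :
  (* (a) *)
  (forall c : signed_map, signed_involutions N c ->
     conj_flags e N sigma c `&` dual_flags e N sigma c =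
       [set flag sigma v
          | v in [set v | conjugate_basis e N c v /\ dual_basis e N c v]]
     /\ conj_flags e N sigma c `&` dual_flags e N sigma c !=set0)
  /\
  (* (b) *)
  (forall (c : signed_map) (F : set (set V)) (F1 F2 : A -> set V),
     signed_involutions N c -> flagsX e sigma F -> labelling e sigma F F1 F2 ->
     (conj_flags e N sigma c F <->
        pair_orbit e sigma sigma c (act (delta e N) F, F) /\
        forall (l : nat) (s : bool),
          quotient_dim (F2 (sigma l) `&` Vsign e N s)
                       (F1 (sigma l) `&` Vsign e N s)
            (if `[< (sigma (c l) < sigma l)%O \/ fixed_with c s l >]
             then 1%N else 0%N))
     /\
     (dual_flags e N sigma c F <->
        pair_orbit e (reversed sigma) sigma c (dagger_flag e N F, F) /\
        forall l : nat, exists n0 : nat, forall n : nat, (n0 <= n)%N ->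
          exists p q : nat,
            signature e N (F1 (sigma l) `&` Vn e n) (p, q) /\
            signature e N (F2 (sigma l) `&` Vn e n)
              (p + (signature_jump sigma c l).1,
               q + (signature_jump sigma c l).2)%N))
  /\
  (* (c) *)
  [/\ [set conj_flags e N sigma c | c in signed_involutions N]
        = orbits (groupK e N) (flagsX e sigma),
      [set dual_flags e N sigma c | c in signed_involutions N]
        = orbits (groupG0 e N) (flagsX e sigma)
    & forall c : signed_map, signed_involutions N c ->
        orbits (groupK e N `&` groupG0 e N) (flagsX e sigma)
          (conj_flags e N sigma c `&` dual_flags e N sigma c)].
Proof.
split; [|split; [|split]].
- move=> c hc; have [cK _] := hc; split; first exact: conj_dual_flags.
  have [v [cv dv]] := exists_common_basis he hN hc.
  by exists (flag sigma v); split; exists v.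
- move=> c F F1 F2 hc _ hF; split; first exact: conj_flags_criterion.
  exact: dual_flags_criterion.
- exact: conj_orbits.
- exact: dual_orbits.
- move=> c hc; have [cK _] := hc.
  have [v [cv dv]] := exists_common_basis he hN hc.
  exists (flag sigma v); first by apply/flagsXP => //; exists v => //; case: cv.
  by rewrite conj_dual_flags//; apply: common_orbit.
Qed.
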